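(* Let $X=\{X_n\}_{n\ge 0}$ be a time-homogeneous Markov chain with state space a Borel set $S\subseteq\mathbb{R}$, with arbitrary initial distribution, such that $\limsup_{n\to\infty}X_n=\infty$ almost surely. Suppose there are $b\in(0,\infty)$, $\mu>b/2$ and an increasing function $s(x)>0$ with $s(x)=o(x)$ as $x\to\infty$ such that $$m_1^{[s(x)]}(x)\sim\frac{\mu}{x},\qquad m_2^{[s(x)]}(x)\to b\qquad\text{as }x\to\infty .$$ Assume also that, for some decreasing function $p$ that is integrable at infinity, $$\mathbb{P}\{|\xi(y)|\ge s(y)\}\le \frac{p(y)}{y}\qquad\text{for all }y>0,$$ and that there is a random variable $\widehat\xi$ with $\mathbb{E}\widehat\xi^{\,2}<\infty$ such that $$|\xi(y)|\,\mathbb{I}\{|\xi(y)|\le s(y)\}\le_{\rm st}\widehat\xi\qquad\text{for all }y\ge 0.$$ Then, for every function $h(x)\uparrow\infty$ with $h(x)=o(x)$ as $x\to\infty$, $$H(x,x+h(x)]\sim\frac{2}{2\mu-b}\,x\,h(x)\qquad\text{as }x\to\infty.$$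
   Context: For a time-homogeneous Markov chain $X_n$ with state space a Borel set $S\subseteq\mathbb{R}$, $\xi(x)$ denotes a random variable with the distribution of the jump of the chain from state $x\in S$, i.e. $\mathbb{P}\{\xi(x)\in B\}=\mathbb{P}\{X_{n+1}-X_n\in B\mid X_n=x\}$ for Borel $B\subseteq\mathbb{R}$. All conditions involving $\xi(x)$ are understood for $x\in S$. For $s>0$, the $s$-truncated $k$th moment of the jump is $m_k^{[s]}(x):=\mathbb{E}\{\xi^k(x);\ |\xi(x)|\le s\}$, where $\mathbb{E}\{Y;A\}$ means $\mathbb{E}[Y\mathbb{I}_A]$. For random variables, $\xi\le_{\rm st}\eta$ means $\mathbb{P}\{\xi>t\}\le\mathbb{P}\{\eta>t\}$ for all $t\in\mathbb{R}$. The renewal measure (Green function) of the chain is $H(B):=\sum_{n=0}^\infty\mathbb{P}\{X_n\in B\}$ for Borel $B\subseteq\mathbb{R}$. The notation $h(x)\uparrow\infty$ means that $h$ increases to infinity as $x\to\infty$, and $f\sim g$ means $f/g\to1$. *)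

(* Defs.v *)
From HB Require Import structures.
From mathcomp Require Import all_boot all_order all_algebra.
From mathcomp Require Import all_classical all_reals all_analysis measurable_realfun.

Set Implicit Arguments.
Unset Strict Implicit.
Unset Printing Implicit Defensive.

Import Order.TTheory GRing.Theory Num.Theory.
Import numFieldNormedType.Exports.

Local Open Scope classical_set_scope.
Local Open Scope ring_scope.
Local Open Scope ereal_scope.

(* [K x] is the conditional law of the next state given the current state [x];
   only its values at points of [S] are constrained. *)
Definition transition_kernel (R : realType) (S : set R)
    (K : R -> probability R R) : Prop :=
  (forall x, S x -> K x S = 1) /\
  (forall B : set R, measurable B -> measurable_fun S (fun x => K x B)).

Definition history (d : measure_display) (T : measurableType d) (R : realType)
    (Pr : probability T R) (X : nat -> {RV Pr >-> R}) (n : nat) :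
    set (set T) :=
  <<s \bigcup_(i in `I_n.+1) preimage_set_system setT (X i) measurable >>.

(* The last clause says that [K (X n) B] is a version of the conditional
   probability of [X n.+1 \in B] given the sigma-algebra [history X n]. *)
Definition markov_chain (d : measure_display) (T : measurableType d)
    (R : realType) (Pr : probability T R) (S : set R)
    (K : R -> probability R R) (X : nat -> {RV Pr >-> R}) : Prop :=
  [/\ measurable S,
      transition_kernel S K,
      forall n w, S (X n w) &
      forall n (A : set T) (B : set R), history X n A -> measurable B ->
        Pr (A `&` X n.+1 @^-1` B) = \int[Pr]_(w in A) K (X n w) B].

(* The jump from [x], as a random variable on the probability space
   [(R, K x)] of the next state. *)
Definition jump (R : realType) (x : R) : R -> R := fun y => (y - x)%R.

Definition small_jump (R : realType) (s x : R) : set R :=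
  [set y | (`|jump x y| <= s)%R].

Definition truncated_moment (R : realType) (K : R -> probability R R)
    (k : nat) (s x : R) : \bar R :=
  'E_(K x)[fun y => (jump x y ^+ k * \1_(small_jump s x) y)%R].

Definition st_le (d d' : measure_display) (T : measurableType d)
    (T' : measurableType d') (R : realType) (P : probability T R) (Y : T -> R)
    (Q : probability T' R) (Z : T' -> R) : Prop :=
  forall t : R, P [set w | (Y w > t)%R] <= Q [set w | (Z w > t)%R].

Definition green (d : measure_display) (T : measurableType d) (R : realType)
    (Pr : probability T R) (X : nat -> {RV Pr >-> R}) (B : set R) : \bar R :=
  \sum_(0 <= n <oo) Pr (X n @^-1` B).

(* [f] is extended-real-valued because the Green function could a priori be
   infinite; the limit 1 forces [f] to be finite eventually along [F]. *)
Definition asymp_equiv (R : realType) (F : set_system R) (f : R -> \bar R)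
    (g : R -> R) : Prop :=
  f x / (g x)%:E @[x --> F] --> 1.

Definition integrable_at_infinity (R : realType) (p : R -> R) : Prop :=
  exists a : R,
    (@lebesgue_measure R).-integrable `[a, +oo[ (EFin \o p).

(* Main.v *)
(** Potential-theoretic proof.  Let [a0 = 2 mu / b - 1]: far to the right,
    [- y ^ -a] is a strict submartingale function for the truncated chain when
    [a < a0] and a supermartingale function when [a > a0].  Let [f] vanish below
    [x0], have second derivative [1] on [[x0, e]], and be continued after [e] by
    a multiple of [- y ^ -a].  Up to errors, the generator maps [f] to [b / 2]
    times the indicator of [[x0, e]], while [sup f] is about [(e - x0) e / a], so
    Dynkin's formula bounds the expected occupation of [(x, x + h]] from above
    ([a < a0]) and, since the chain tends to infinity, from below ([a > a0]),
    by constants close to [2 / (2 mu - b)] times [x h].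

    The jumps larger than [s] are compensated by a bounded Lyapunov function [U]
    with [E_y U - U y >= p y / y], a sum of dyadic copies of [(1 - (v / y) ^ a)_+]
    weighted by [v p v], which is summable by condensation.  [U] is a bounded
    submartingale function, strictly increasing far out, which also yields
    transience.  Truncated jumps that overshoot the interval in the lower bound
    are controlled by the upper bound itself and the second moment of [xihat]. *)
Require Import Defs.
From HB Require Import structures.
From mathcomp Require Import all_boot all_order all_algebra.
From mathcomp Require Import all_classical all_reals all_analysis measurable_realfun.
From mathcomp Require Import ring lra.

Set Implicit Arguments.
Unset Strict Implicit.
Unset Printing Implicit Defensive.

Import Order.TTheory GRing.Theory Num.Theory.
Import numFieldNormedType.Exports.

Local Open Scope classical_set_scope.
Local Open Scope ring_scope.

(** * Convexity and Taylor bounds for negative powers *)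

Section powers.
Variable R : realType.
Implicit Types (a c u v y z : R).

(** The exponent and the constant come from the generator of the truncated chain: on $y^{-a}$ it is
    close to $-a y^{-a-2} (mu - (a+1) b/2)$, which vanishes at [a0]. As $b a_0 = 2 mu - b$, dividing
    $x h / a_0$ by $b / 2$ gives $2 x h / (2 mu - b)$. The obstacle is that [h] may grow much more
    slowly than [s]: a truncated jump can leap over the whole window, and no second-order expansion
    of the test function holds along it. Every drift bound is therefore an inequality valid for each
    landing point, which is then integrated. The window is widened by a fraction [t] for the upper
    bound, so that short jumps made inside it stay in the core, and narrowed for the lower bound, so
    that only jumps longer than [t * h] reach the core from outside the window. The second moment of
    [xihat] makes the squared truncated jumps uniformly integrable, hence thresholds independent of
    the starting point. The upper bound is uniform in the position and width of the window, because
    the overshoot terms of the lower bound are occupations of windows of widths [j + 1] reaching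
    about [s (2 * x)]. *)

Lemma convex_ge0 (g dg d2g : R -> R) (c r : R) : 0 < r ->
  (forall x : R, `|x - c| < r -> is_derive x 1 g (dg x)) ->
  (forall x : R, `|x - c| < r -> is_derive x 1 dg (d2g x)) ->
  (forall x : R, `|x - c| < r -> 0 <= d2g x) ->
  g c = 0 -> dg c = 0 ->
  forall x : R, `|x - c| < r -> 0 <= g x.
Proof.
move=> r0 Hg Hdg H2 gc dgc.
have mvt (f df : R -> R) (u v : R) :
    (forall x : R, `|x - c| < r -> is_derive x 1 f (df x)) ->
    `|u - c| < r -> `|v - c| < r -> u < v ->
    exists2 w, u < w < v & f v - f u = df w * (v - u).
  move=> Hf; rewrite !ltr_norml => /andP[u1 u2] /andP[v1 v2] uv.
  have [||w] := @MVT R f df u v uv.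
  - move=> x; rewrite in_itv/= => /andP[ux xv]; apply: Hf.
    by rewrite ltr_norml; apply/andP; split; lra.
  - apply: continuous_in_subspaceT => x; rewrite inE/= in_itv/= => /andP[ux xv].
    apply: differentiable_continuous; apply/derivable1_diffP.
    have /(_ _)/(@ex_derive _ _ _ _ _ _ _)// := Hf x _.
    by apply; rewrite ltr_norml; apply/andP; split; lra.
  by rewrite in_itv/= => uwv ->; exists w.
have cc : `|c - c| < r by rewrite subrr normr0.
move=> x xr; have := xr; rewrite ltr_norml => /andP[xr1 xr2].
case: (ltgtP c x) => [cx|xc|<-]; last by rewrite gc.
- have [w /andP[cw wx]] := mvt g dg c x Hg cc xr cx.
  rewrite gc subr0 => ->.
  have wr : `|w - c| < r by rewrite ltr_norml; apply/andP; split; lra.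
  have [v /andP[cv vw]] := mvt dg d2g c w Hdg cc wr cw.
  rewrite dgc subr0 => ->.
  have vr : `|v - c| < r by rewrite ltr_norml; apply/andP; split; lra.
  by rewrite !mulr_ge0 ?H2 ?subr_ge0// ltW.
- have [w /andP[xw wc]] := mvt g dg x c Hg xr cc xc.
  rewrite gc sub0r => gx; have {gx}-> : g x = - dg w * (c - x).
    by rewrite mulNr -gx opprK.
  have wr : `|w - c| < r by rewrite ltr_norml; apply/andP; split; lra.
  have [v /andP[wv vc]] := mvt dg d2g w c Hdg wr cc wc.
  rewrite dgc sub0r => ->.
  have vr : `|v - c| < r by rewrite ltr_norml; apply/andP; split; lra.
  by rewrite !mulr_ge0 ?H2 ?subr_ge0// ltW.
Qed.

(** At [u = 1] the bracket and its derivative vanish, and its second derivative is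
    [2 * c - a * (a + 1)]. The sign of [k] decides on which side of half the curvature [c] lies, so
    one statement yields both the lower and the upper quadratic bound. *)
Lemma powRN_taylor a c (k : R) : 0 < a -> 0 < k * (2 * c - a * (a + 1)) ->
  exists2 dl : R, 0 < dl <= 1 / 2 &
    forall u, `|u - 1| < dl ->
      0 <= k * (1 - u `^ (- a) - a * (u - 1) + c * (u - 1) ^+ 2).
Proof.
move=> a0 kc.
pose d2g u := k * (2 * c - a * (a + 1) * u `^ (- a - 1 - 1)).
have d2g1 : 0 < d2g 1 by rewrite /d2g powR1 mulr1.
have [dl dl0 Hdl] : exists2 dl : R, 0 < dl <= 1 / 2 &
    forall u, `|u - 1| < dl -> 0 <= d2g u.
  have : d2g x @[x --> (1 : R)] --> d2g 1.
    apply: cvgM; first exact: cvg_cst.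
    apply: cvgB; first exact: cvg_cst.
    apply: cvgM; first exact: cvg_cst.
    have D : derivable (fun x : R => x `^ (- a - 1 - 1)) 1 1.
      exact: (@ex_derive _ _ _ _ _ _ _ (is_derive1_powR (- a - 1 - 1) (@ltr01 R))).
    by have /derivable1_diffP/differentiable_continuous := D.
  move=> /cvgrPdist_lt/(_ _ d2g1) [r /= r0 Hr].
  exists (Num.min r (1 / 2)); first by rewrite lt_min r0 ge_min lexx orbT; lra.
  move=> u; rewrite lt_min => /andP[ur _].
  have := Hr u; rewrite /= distrC => /(_ ur); rewrite ltr_norml; lra.
exists dl => // u udl.
pose g u := k * (1 - u `^ (- a) - a * (u - 1) + c * (u - 1) ^+ 2).
pose dg u := k * (a * u `^ (- a - 1) - a + 2 * c * (u - 1)).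
apply: (@convex_ge0 g dg d2g 1 dl).
- by case/andP: dl0.
- move=> x xdl; have x0 : 0 < x by move: xdl; rewrite ltr_norml; lra.
  have := is_derive1_powR (- a) x0 => ?.
  apply: is_derive_eq; rewrite /dg /GRing.scale/=; ring.
- move=> x xdl; have x0 : 0 < x by move: xdl; rewrite ltr_norml; lra.
  have := is_derive1_powR (- a - 1) x0 => ?.
  apply: is_derive_eq; rewrite /d2g /GRing.scale/=; ring.
- exact: Hdl.
- by rewrite /g powR1; ring.
- by rewrite /dg powR1; ring.
- exact: udl.
Qed.

(** Through $1 - u^{-a} \le a \ln u \le a (u - 1)$. *)
Lemma powRN_bernoulli a u : 0 < a -> 0 < u -> 1 - u `^ (- a) <= a * (u - 1).
Proof.
move=> a0 u0; rewrite /powR gt_eqF//.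
have h1 := expR_ge1Dx (- a * ln u).
have h2 : ln u <= u - 1.
  have := @le_ln1Dx R (u - 1); rewrite (_ : 1 + (u - 1) = u); last by ring.
  by apply; lra.
nra.
Qed.

Lemma powRN_tangent a y z : 0 < a -> 0 < y -> 0 < z ->
  y `^ (- a) - z `^ (- a) <= a * y `^ (- a - 1) * (z - y).
Proof.
move=> a0 y0 z0.
have zy : 0 < z / y by rewrite divr_gt0.
have := powRN_bernoulli a0 zy.
have -> : z `^ (- a) = y `^ (- a) * (z / y) `^ (- a).
  by rewrite -powRM ?ltW// mulrC divfK// gt_eqF.
have -> : y `^ (- a - 1) = y `^ (- a) / y.
  by rewrite powRB ?(gt_eqF y0) ?implybT// powRr1// ltW.
have p0 : 0 < y `^ (- a) by rewrite powR_gt0.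
have -> : a * (y `^ (- a) / y) * (z - y) = y `^ (- a) * (a * (z / y - 1)).
  by field; rewrite gt_eqF.
by rewrite -{1}[y `^ (- a)]mulr1 -mulrBr ler_pM2l.
Qed.

Lemma powRN_le a y z : 0 < a -> 0 < y -> y <= z -> z `^ (- a) <= y `^ (- a).
Proof.
move=> a0 y0 yz; have z0 := lt_le_trans y0 yz.
rewrite !powRN lef_pV2 ?posrE ?powR_gt0//.
by apply: ge0_ler_powR => //; rewrite ?nnegrE; apply: ltW.
Qed.

Lemma powRN_lt a y z : 0 < a -> 0 < y -> y < z -> z `^ (- a) < y `^ (- a).
Proof.
move=> a0 y0 yz; have z0 := lt_trans y0 yz.
rewrite !powRN ltf_pV2 ?posrE ?powR_gt0//.
by apply: gt0_ltr_powR => //; rewrite ?nnegrE; apply: ltW.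
Qed.

(** By homogeneity the bound at 1 holds around [y] on a radius proportional to [y]. As [s y] is
    negligible compared with [y], this radius eventually covers all truncated jumps. *)
Lemma powRN_scale_taylor a c k : 0 < a -> 0 < k * (2 * c - a * (a + 1)) ->
  exists2 dl : R, 0 < dl <= 1 / 2 &
    forall y z, 0 < y -> `|z - y| < dl * y ->
      0 <= k * (y `^ (- a) - z `^ (- a)
                - y `^ (- a - 2) * (a * y * (z - y) - c * (z - y) ^+ 2)).
Proof.
move=> a0 kc; have [dl dl0 Hdl] := powRN_taylor a0 kc.
exists dl => // y z y0 zy.
have zy1 : `|z / y - 1| < dl.
  have -> : z / y - 1 = (z - y) / y by field; rewrite gt_eqF.
  by rewrite normrM normfV (gtr0_norm y0) ltr_pdivrMr.
have := Hdl _ zy1.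
have z0 : 0 < z by move: zy; rewrite ltr_norml; nra.
have -> : z `^ (- a) = y `^ (- a) * (z / y) `^ (- a).
  by rewrite -powRM ?divr_ge0 ?ltW// mulrC divfK// gt_eqF.
have -> : y `^ (- a - 2) = y `^ (- a) / y ^+ 2.
  by rewrite powRB ?(gt_eqF y0) ?implybT// powR_mulrn// ltW.
have p0 : 0 < y `^ (- a) by rewrite powR_gt0.
set q := (z / y) `^ _ => /(mulr_ge0 (ltW p0)).
suff -> : y `^ (- a) * (k * (1 - q - a * (z / y - 1) + c * (z / y - 1) ^+ 2)) =
   k * (y `^ (- a) - y `^ (- a) * q -
  y `^ (- a) / y ^+ 2 * (a * y * (z - y) - c * (z - y) ^+ 2)) by [].
by field; rewrite gt_eqF.
Qed.

End powers.

(** * The test function of a window and one-sided bounds for its increments *)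

Section test_function.
Variables (R : realType) (x0 e a : R).
Hypotheses (x0_gt0 : 0 < x0) (x0e : x0 < e) (a_gt0 : 0 < a).
Implicit Types (y z m : R).

(* The coefficient [w] for which [- w * z ^ -a] has slope [m] at [z = y]. *)
Definition slope_weight (y m : R) := m * y `^ (a + 1) / a.

Let e_gt0 : 0 < e. Proof. exact: lt_trans x0e. Qed.

Lemma slope_weight_ge0 y m : 0 <= m -> 0 <= slope_weight y m.
Proof. by move=> m0; rewrite divr_ge0// ?(ltW a_gt0)// mulr_ge0// powR_ge0. Qed.

Lemma slope_weight_tangent y z m : 0 < y -> 0 < z -> 0 <= m ->
  slope_weight y m * (y `^ (- a) - z `^ (- a)) <= m * (z - y).
Proof.
move=> y0 z0 m0.
have := ler_wpM2l (slope_weight_ge0 y m0) (powRN_tangent a_gt0 y0 z0).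
move=> /le_trans; apply; rewrite /slope_weight.
have E : y `^ (a + 1) * y `^ (- a - 1) = 1.
  by rewrite -powRD ?(gt_eqF y0) ?implybT// (_ : a + 1 + (- a - 1) = 0) ?powRr0//; ring.
have -> : m * y `^ (a + 1) / a * (a * y `^ (- a - 1) * (z - y)) =
   m * (z - y) * (y `^ (a + 1) * y `^ (- a - 1)) by field; rewrite gt_eqF.
by rewrite E mulr1.
Qed.

Lemma slope_weight_mul y m : 0 < y -> slope_weight y m * y `^ (- a) = m * y / a.
Proof.
move=> y0; rewrite /slope_weight.
have E : y `^ (a + 1) * y `^ (- a) = y.
  by rewrite -powRD ?(gt_eqF y0) ?implybT// (_ : a + 1 + (- a) = 1) ?powRr1 ?(ltW y0)//; ring.
have -> : m * y `^ (a + 1) / a * y `^ (- a) =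
   m * (y `^ (a + 1) * y `^ (- a)) / a by field; rewrite gt_eqF.
by rewrite E.
Qed.

(** The weight for which [- test_weight y * z ^ -a], as a function of [z], has the same slope at
    [z = y] as [test_fun]. *)
Definition test_weight y :=
  if y <= x0 then 0 else
  if y <= e then slope_weight y (y - x0) else slope_weight e (e - x0).

(* [f'' = 1] on [[x0, e]], continued after [e] as a [C^1] function by a
   multiple of the scale function. *)
Definition test_fun z :=
  if z <= x0 then 0 else
  if z <= e then (z - x0) ^+ 2 / 2
  else (e - x0) ^+ 2 / 2 + slope_weight e (e - x0) * (e `^ (- a) - z `^ (- a)).

(** The limit of [test_fun] at infinity, since [slope_weight e m * e ^ -a = m * e / a]. *)
Definition test_sup := (e - x0) ^+ 2 / 2 + (e - x0) * e / a.

Let l_ge0 : 0 <= e - x0. Proof. by rewrite subr_ge0 ltW. Qed.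
Let we_ge0 := slope_weight_ge0 e l_ge0.

Let tangent_e z : 0 < z ->
  slope_weight e (e - x0) * (e `^ (- a) - z `^ (- a)) <= (e - x0) * (z - e).
Proof. by move=> z0; exact: slope_weight_tangent. Qed.

Let tail_ge0 z : e <= z ->
  0 <= slope_weight e (e - x0) * (e `^ (- a) - z `^ (- a)).
Proof. by move=> ez; rewrite mulr_ge0// subr_ge0 powRN_le. Qed.

Lemma test_weight_ge0 y : 0 <= test_weight y.
Proof.
rewrite /test_weight; case: (leP y x0) => // ?; case: (leP y e) => // ?.
by rewrite slope_weight_ge0// subr_ge0 ltW.
Qed.

Lemma test_fun0 z : z <= x0 -> test_fun z = 0.
Proof. by rewrite /test_fun => ->. Qed.

Lemma test_fun_core z : x0 <= z -> z <= e -> test_fun z = (z - x0) ^+ 2 / 2.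
Proof.
rewrite /test_fun => x0z ->; case: (leP z x0) => // zx0.
have -> : z = x0 by apply/le_anti; rewrite zx0.
by rewrite subrr expr0n mul0r.
Qed.

Lemma test_fun_tail z : e <= z ->
  test_fun z = (e - x0) ^+ 2 / 2 +
               slope_weight e (e - x0) * (e `^ (- a) - z `^ (- a)).
Proof.
move=> ez; rewrite /test_fun leNgt (lt_le_trans x0e ez)/=.
case: (leP z e) => // ze; have -> : z = e by apply/le_anti; rewrite ze.
by rewrite subrr mulr0 addr0.
Qed.

Lemma test_fun_ge0 z : 0 <= test_fun z.
Proof.
rewrite /test_fun; case: (leP z x0) => // _; case: (leP z e) => [_|ez].
  by rewrite divr_ge0// sqr_ge0.
by rewrite addr_ge0 ?tail_ge0 ?(ltW ez)// divr_ge0// sqr_ge0.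
Qed.

Lemma test_fun_quad z : 0 < z -> x0 <= z -> test_fun z <= (z - x0) ^+ 2 / 2.
Proof.
move=> z0 x0z; case: (leP z e) => [ze|/ltW ez]; first by rewrite test_fun_core.
rewrite test_fun_tail//; have := tangent_e z0.
have := sqr_ge0 (z - e); set t := slope_weight _ _ * _; lra.
Qed.

Lemma test_fun_lip z : 0 < z -> x0 <= z -> test_fun z <= (e - x0) * (z - x0).
Proof.
move=> z0 x0z; case: (leP z e) => [ze|/ltW ez].
  by rewrite test_fun_core//; nra.
rewrite test_fun_tail//; have := tangent_e z0.
by have := sqr_ge0 (e - x0); set t := slope_weight _ _ * _; lra.
Qed.

Lemma test_fun_homo : {homo test_fun : y z / y <= z}.
Proof.
move=> y z yz; case: (leP y x0) => yx0; first by rewrite (test_fun0 yx0) test_fun_ge0.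
have x0z := lt_le_trans yx0 yz.
have z0 := lt_trans x0_gt0 x0z.
case: (leP z e) => [ze|ez].
  rewrite !test_fun_core ?(ltW yx0) ?(ltW x0z)// ?(le_trans yz)//.
  by nra.
case: (leP y e) => [ye|ey].
  rewrite (test_fun_core (ltW yx0))// (test_fun_tail (ltW ez)).
  have := tail_ge0 (ltW ez); set t := slope_weight _ _ * _.
  have : (y - x0) ^+ 2 <= (e - x0) ^+ 2 by rewrite ler_sqr ?nnegrE; lra.
  lra.
rewrite (test_fun_tail (ltW ez)) (test_fun_tail (ltW ey)) lerD2l ler_wpM2l//.
by rewrite lerD2l lerN2 powRN_le// (lt_trans e_gt0).
Qed.

Lemma test_fun_ge_tail z : e <= z ->
  test_sup - slope_weight e (e - x0) * z `^ (- a) <= test_fun z.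
Proof.
move=> ez; rewrite test_fun_tail// /test_sup mulrBr slope_weight_mul// addrA.
by [].
Qed.

Lemma test_fun_le_sup z : test_fun z <= test_sup.
Proof.
have := test_fun_homo (_ : z <= Num.max z e); rewrite le_max lexx => /(_ isT).
move=> /le_trans; apply; rewrite test_fun_tail ?le_max ?lexx ?orbT//.
rewrite /test_sup mulrBr slope_weight_mul// lerD2l gerDl oppr_le0.
by rewrite mulr_ge0// powR_ge0.
Qed.

Lemma slope_weight_homo y z m n : 0 < y -> y <= z -> 0 <= m -> m <= n ->
  slope_weight y m <= slope_weight z n.
Proof.
move=> y0 yz m0 mn; rewrite /slope_weight ler_pM2r ?invr_gt0//.
apply: ler_pM => //; first exact: powR_ge0.
have a1 : 0 <= a + 1 by have := a_gt0; lra.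
by apply: (ge0_ler_powR a1); rewrite ?nnegrE ?(ltW y0)// (le_trans (ltW y0)).
Qed.

(** Both functions are compared through their common slope at [y]. On the core [test_fun] exceeds
    its tangent by exactly [(z - y) ^+ 2 / 2], while the concave function [- z ^ -a] stays below
    that tangent. Beyond [e] the tail of [test_fun] carries the weight of [e], which is at least
    that of [y], so it rises at least as fast. *)
Lemma test_fun_sub y z : 0 < y -> 0 < z ->
  test_weight y * (y `^ (- a) - z `^ (- a)) +
  ((x0 <= y <= e) && (x0 <= z <= e))%:R * ((z - y) ^+ 2 / 2)
  <= test_fun z - test_fun y.
Proof.
move=> y0 z0; rewrite /test_weight.
case: (leP y x0) => yx0 /=.
  rewrite (test_fun0 yx0) mul0r add0r subr0.
  case: andP => [[/andP[x0y _] /andP[x0z ze]]|_]; last first.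
    by rewrite mul0r test_fun_ge0.
  have -> : y = x0 by apply/le_anti; rewrite yx0.
  by rewrite mul1r test_fun_core.
have x0y := ltW yx0; rewrite x0y.
case: (leP y e) => [ye|ey] /=.
  have m0 : 0 <= y - x0 by rewrite subr_ge0.
  have tang := slope_weight_tangent y0 z0 m0.
  rewrite (test_fun_core x0y ye).
  case: (leP x0 z) => [x0z|zx0] /=; last first.
    rewrite (test_fun0 (ltW zx0)) mul0r; move: tang; set t := _ * _.
    have : 0 <= (y - x0) * (x0 - z) by rewrite mulr_ge0// subr_ge0 ltW.
    have := sqr_ge0 (y - x0); lra.
  case: (leP z e) => [ze|ez].
    rewrite (test_fun_core x0z ze) mul1r; move: tang; set t := _ * _; lra.
  rewrite (test_fun_tail (ltW ez)).
  have tange := slope_weight_tangent y0 e_gt0 m0.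
  have sle : slope_weight y (y - x0) <= slope_weight e (e - x0).
    by apply: slope_weight_homo => //; lra.
  have pz : 0 <= e `^ (- a) - z `^ (- a) by rewrite subr_ge0 powRN_le// ltW.
  have := ler_wpM2r pz sle.
  set t1 := slope_weight y _ * (e `^ _ - _); set t2 := slope_weight e _ * _.
  move=> t12.
  have -> : slope_weight y (y - x0) * (y `^ (- a) - z `^ (- a)) =
    slope_weight y (y - x0) * (y `^ (- a) - e `^ (- a)) + t1 by rewrite /t1; ring.
  rewrite mul0r; move: tange; set t := _ * _.
  have := sqr_ge0 (e - y); lra.
rewrite mul0r addr0 (test_fun_tail (ltW ey)).
have tang := tangent_e z0.
suff : (e - x0) ^+ 2 / 2 +
  slope_weight e (e - x0) * (e `^ (- a) - z `^ (- a)) <= test_fun z by lra.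
case: (leP e z) => [ez|ze]; first by rewrite (test_fun_tail ez).
have l0 := l_ge0.
move: tang; set t := _ * _ => tang.
case: (leP x0 z) => [x0z|zx0] /=; last first.
  rewrite (test_fun0 (ltW zx0)).
  have : 0 <= (e - x0) * (x0 - z) by rewrite mulr_ge0// subr_ge0 ltW.
  by have := sqr_ge0 (e - x0); lra.
by rewrite (test_fun_core x0z (ltW ze)); have := sqr_ge0 (e - z); lra.
Qed.

(** Valid for every landing point because the second derivative never exceeds 1: the function is
    flat before [x0] and concave after [e]. The slope bound [e - x0] is what makes the drift
    negligible when the window is short compared with its position. *)
Lemma test_fun_taylor y : 0 < y -> exists2 dy, 0 <= dy <= e - x0 &
  forall z, 0 < z -> test_fun z - test_fun y <= dy * (z - y) + (z - y) ^+ 2 / 2.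
Proof.
move=> y0; have l0 := l_ge0.
case: (leP y x0) => yx0.
  exists 0 => [|z z0]; first by rewrite lexx.
  rewrite (test_fun0 yx0) subr0 mul0r add0r.
  case: (leP x0 z) => [x0z|zx0]; last first.
    by rewrite (test_fun0 (ltW zx0)); have := sqr_ge0 (z - y); lra.
  apply: (le_trans (test_fun_quad z0 x0z)).
  have : (z - x0) ^+ 2 <= (z - y) ^+ 2 by rewrite ler_sqr ?nnegrE; lra.
  lra.
case: (leP y e) => [ye|ey].
  exists (y - x0) => [|z z0]; first lra.
  rewrite (test_fun_core (ltW yx0) ye).
  case: (leP x0 z) => [x0z|zx0]; last first.
    by rewrite (test_fun0 (ltW zx0)); have := sqr_ge0 (z - x0); lra.
  by have := test_fun_quad z0 x0z; lra.
have k0 : 0 < y `^ (a + 1) by exact: powR_gt0.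
(* The derivative of the tail at [y], in the form that makes its [slope_weight] equal to that of the
   tail. *)
set dy := slope_weight e (e - x0) * a / y `^ (a + 1).
have sE : slope_weight y dy = slope_weight e (e - x0).
  by rewrite /slope_weight /dy divfK ?mulfK ?gt_eqF.
have dyl : 0 <= dy <= e - x0.
  apply/andP; split.
    by apply: divr_ge0; [apply: mulr_ge0; [exact: we_ge0|exact: ltW]|exact: ltW].
  rewrite /dy ler_pdivrMr// /slope_weight divfK ?gt_eqF// ler_wpM2l//.
  have a1 : 0 <= a + 1 by have := a_gt0; lra.
  by apply: (ge0_ler_powR a1); rewrite ?nnegrE ?(ltW e_gt0) ?(ltW y0) ?(ltW ey).
exists dy => // z z0; case/andP: dyl => dy0 dyl.
rewrite (test_fun_tail (ltW ey)).
case: (leP e z) => [ez|ze].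
  rewrite (test_fun_tail ez).
  have := slope_weight_tangent y0 z0 dy0; rewrite sE.
  by have := sqr_ge0 (z - y); set sw := slope_weight _ _; lra.
have := slope_weight_tangent y0 e_gt0 dy0; rewrite sE.
have fz : test_fun z <= (e - x0) ^+ 2 / 2 + (e - x0) * (z - e) + (z - e) ^+ 2 / 2.
  case: (leP x0 z) => [x0z|zx0]; last first.
    by rewrite (test_fun0 (ltW zx0)); have := sqr_ge0 (z - x0); lra.
  by have := test_fun_quad z0 x0z; lra.
have : 0 <= (e - x0 - dy) * (e - z) by apply: mulr_ge0; lra.
have : 0 <= (y - e) * (e - z) by apply: mulr_ge0; lra.
have := sqr_ge0 (y - e).
set sw := slope_weight e (e - x0).
have -> : sw * (e `^ (- a) - y `^ (- a)) = - (sw * (y `^ (- a) - e `^ (- a))).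
  by ring.
set t := sw * _; lra.
Qed.

(** Past the core both functions agree up to a constant until the jump lands below [e]. There the
    power goes on decreasing, with slope at most [(e - x0) * 2 ^ (a + 1)] because [z] is at least
    [e / 2], whereas [test_fun] stays nonnegative and below its value at [e]; the difference is
    charged to the depth [e - z]. *)
Lemma test_fun_super y z : e < y -> e <= 2 * z ->
  test_fun z - test_fun y <= test_weight y * (y `^ (- a) - z `^ (- a)) +
    (e - x0) * 2 `^ (a + 1) * Num.max 0 (e - z).
Proof.
move=> ey ez2; have z0 : 0 < z by have := e_gt0; lra.
have -> : test_weight y = slope_weight e (e - x0).
  by rewrite /test_weight !leNgt (lt_trans x0e ey) ey.
rewrite (test_fun_tail (ltW ey)).
case: (leP e z) => [ez|ze].
  rewrite (test_fun_tail ez) max_l ?subr_le0// mulr0 addr0; lra.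
rewrite max_r; last by rewrite subr_ge0 ltW.
have : test_fun z <= (e - x0) ^+ 2 / 2.
  have := test_fun_homo (ltW ze).
  by rewrite (@test_fun_core e) ?lexx// ltW.
have sle : slope_weight e (e - x0) <= slope_weight z ((e - x0) * 2 `^ (a + 1)).
  rewrite /slope_weight ler_pM2r ?invr_gt0// -mulrA ler_wpM2l//.
  rewrite -powRM ?(ltW z0)//.
  have a1 : 0 <= a + 1 by have := a_gt0; lra.
  by apply: (ge0_ler_powR a1); rewrite ?nnegrE ?(ltW e_gt0)// mulr_ge0// ltW.
have m0 : 0 <= (e - x0) * 2 `^ (a + 1) by rewrite mulr_ge0// powR_ge0.
have := slope_weight_tangent z0 e_gt0 m0.
have pz : 0 <= z `^ (- a) - e `^ (- a) by rewrite subr_ge0 powRN_le// ltW.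
have := ler_wpM2r pz sle.
set t1 := slope_weight e _ * (z `^ (- a) - e `^ (- a)).
set t2 := slope_weight z _ * _ => t12 t2le fz.
set sw := slope_weight e (e - x0).
have -> : sw * (e `^ (- a) - y `^ (- a)) = sw * (z `^ (- a) - y `^ (- a)) - t1.
  by rewrite /t1 /sw; ring.
have -> : sw * (y `^ (- a) - z `^ (- a)) = - (sw * (z `^ (- a) - y `^ (- a))).
  by ring.
set t3 := sw * _; lra.
Qed.

End test_function.

(** * Expectations of bounded measurable functions as real numbers *)

Section bounded_measurable.
Variables (d : measure_display) (T : measurableType d) (R : realType).
Implicit Types (f g : T -> R) (c : T -> bool).

(** Such functions are integrable under every probability, so expectations are finite and linear
    with no further side condition. *)
Definition bmeas f := measurable_fun setT f /\ exists M : R, forall x, `|f x| <= M.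

Lemma bmeas_cst (k : R) : bmeas (fun _ => k).
Proof. by split; [exact: measurable_cst|exists `|k|]. Qed.

Lemma bmeasD f g : bmeas f -> bmeas g -> bmeas (fun x => f x + g x).
Proof.
move=> [mf [M Mf]] [mg [N Ng]]; split; first exact: measurable_funD.
by exists (M + N) => x; rewrite (le_trans (ler_normD _ _))// lerD.
Qed.

Lemma bmeasM f g : bmeas f -> bmeas g -> bmeas (fun x => f x * g x).
Proof.
move=> [mf [M Mf]] [mg [N Ng]]; split; first exact: measurable_funM.
by exists (M * N) => x; rewrite normrM ler_pM.
Qed.

Lemma bmeasZ (k : R) f : bmeas f -> bmeas (fun x => k * f x).
Proof. by apply: bmeasM; exact: bmeas_cst. Qed.

Lemma bmeasN f : bmeas f -> bmeas (fun x => - f x).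
Proof.
move=> [mf [M Mf]]; split; last by exists M => x; rewrite normrN.
exact: measurableT_comp.
Qed.

Lemma bmeasB f g : bmeas f -> bmeas g -> bmeas (fun x => f x - g x).
Proof. by move=> bf bg; apply: bmeasD => //; exact: bmeasN. Qed.

Lemma bmeas_sum (I : Type) (r : seq I) (P : pred I) (F : I -> T -> R) :
  (forall i, P i -> bmeas (F i)) -> bmeas (fun x => \sum_(i <- r | P i) F i x).
Proof.
move=> bF; elim: r => [|i r IH].
  by rewrite (_ : (fun _ => _) = fun _ => 0); [exact: bmeas_cst|apply/funext => x; rewrite big_nil].
case Pi: (P i).
  rewrite (_ : (fun _ => _) = fun x => F i x + \sum_(j <- r | P j) F j x).
    by apply: bmeasD => //; exact: bF.
  by apply/funext => x; rewrite big_cons Pi.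
rewrite (_ : (fun _ => _) = fun x => \sum_(j <- r | P j) F j x)//.
by apply/funext => x; rewrite big_cons Pi.
Qed.

Lemma bmeas_indic (A : set T) : measurable A -> bmeas \1_A.
Proof.
move=> mA; split; first exact: measurable_indic.
by exists 1 => x; rewrite indicE ger0_norm// lern1 leq_b1.
Qed.

Lemma bool_indicE c : (fun x => (c x)%:R : R) = \1_[set x | c x].
Proof. by apply/funext => x; rewrite indicE mem_setE. Qed.

Lemma measurable_setb c : measurable_fun setT c -> measurable [set x | c x].
Proof.
move=> mc; have := mc measurableT [set true] I; rewrite setTI.
by congr (measurable _); apply/seteqP; split.
Qed.

Lemma bmeas_bool c : measurable_fun setT c -> bmeas (fun x => (c x)%:R).
Proof.
by move=> mc; rewrite bool_indicE; apply: bmeas_indic; exact: measurable_setb.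
Qed.

End bounded_measurable.

Section expectation.
Variables (d : measure_display) (T : measurableType d) (R : realType).
Variable P : probability T R.
Implicit Types (f g : T -> R) (c : T -> bool).

Definition Ex f : R := \int[P]_x f x.

Lemma bmeas_integrable f : bmeas f -> P.-integrable setT (EFin \o f).
Proof.
move=> [mf [M Mf]]; apply: measurable_bounded_integrable => //.
  by apply: (le_lt_trans (probability_le1 P _)); rewrite ?ltry.
exists M; split; first exact: num_real.
by move=> x Mx y _; apply: (le_trans (Mf y)); exact: ltW.
Qed.

Lemma Ex_cst (k : R) : Ex (fun _ => k) = k.
Proof.
rewrite /Ex Rintegral_cst// -[RHS]mulr1; congr (_ * _).
exact: (congr1 fine (probability_setT P)).
Qed.

Lemma ExD f g : bmeas f -> bmeas g -> Ex (fun x => f x + g x) = Ex f + Ex g.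
Proof. by move=> bf bg; rewrite /Ex RintegralD//; exact: bmeas_integrable. Qed.

Lemma ExZ (k : R) f : bmeas f -> Ex (fun x => k * f x) = k * Ex f.
Proof. by move=> bf; rewrite /Ex RintegralZl//; exact: bmeas_integrable. Qed.

Lemma ExB f g : bmeas f -> bmeas g -> Ex (fun x => f x - g x) = Ex f - Ex g.
Proof. by move=> bf bg; rewrite /Ex RintegralB//; exact: bmeas_integrable. Qed.

Lemma le_Ex f g : bmeas f -> bmeas g -> (forall x, f x <= g x) -> Ex f <= Ex g.
Proof.
by move=> bf bg fg; apply: le_Rintegral => //; exact: bmeas_integrable.
Qed.

Lemma Ex_ge0 f : (forall x, 0 <= f x) -> 0 <= Ex f.
Proof. by move=> f0; apply: Rintegral_ge0. Qed.

Lemma Ex_le f (k : R) : bmeas f -> (forall x, f x <= k) -> Ex f <= k.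
Proof.
move=> bf fk; rewrite -[leRHS]Ex_cst; apply: le_Ex => //; exact: bmeas_cst.
Qed.

Lemma norm_Ex f (k : R) : bmeas f -> (forall x, `|f x| <= k) -> `|Ex f| <= k.
Proof.
move=> bf fk; rewrite ler_norml Ex_le// ?andbT; last first.
  by move=> x; rewrite (le_trans (ler_norm _)).
rewrite -[leLHS]Ex_cst; apply: le_Ex => //; first exact: bmeas_cst.
by move=> x; have := fk x; rewrite ler_norml => /andP[].
Qed.

Lemma Ex_sum (I : Type) (r : seq I) (Q : pred I) (F : I -> T -> R) :
  (forall i, Q i -> bmeas (F i)) ->
  Ex (fun x => \sum_(i <- r | Q i) F i x) = \sum_(i <- r | Q i) Ex (F i).
Proof.
move=> bF; elim: r => [|i r IH].
  rewrite big_nil -[RHS](Ex_cst 0); congr Ex.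
  by apply/funext => x; rewrite big_nil.
rewrite big_cons; case: ifPn => Qi.
  rewrite -IH -ExD; [|exact: bF|exact: bmeas_sum].
  by congr Ex; apply/funext => x; rewrite big_cons Qi.
by rewrite -IH; congr Ex; apply/funext => x; rewrite big_cons (negbTE Qi).
Qed.

Lemma Ex_indic (A : set T) : measurable A -> Ex \1_A = fine (P A).
Proof. by move=> mA; rewrite /Ex /Rintegral integral_indic// setIT. Qed.

Lemma Ex_bool c : measurable_fun setT c ->
  Ex (fun x => (c x)%:R) = fine (P [set x | c x]).
Proof.
by move=> mc; rewrite bool_indicE Ex_indic//; exact: measurable_setb.
Qed.

End expectation.

(** * Integer parts as sums of indicators, and an induction principle for bounded functions *)

Section counting.
Variable R : realType.
Implicit Types (m : nat) (u v : R).

(** For [m] at least [u] the sum is the integer part of [u]; hence the bounds by [u] here and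
    [u - 1] in [count_ge]. *)
Lemma count_le u m : 0 <= u -> \sum_(k < m) (k%:R + 1 <= u)%R%:R <= u.
Proof.
move=> u0; elim: m => [|m IH]; first by rewrite big_ord0.
rewrite big_ord_recr/=; case: (leP (m%:R + 1) u) => mu; last by rewrite addr0.
apply: le_trans mu; rewrite lerD2r.
rewrite -[leRHS]mulr1 mulr_natl -[m in leRHS]card_ord -sumr_const.
by apply: ler_sum => i _; rewrite lern1 leq_b1.
Qed.

Lemma count_ge u m : u <= m%:R -> u - 1 <= \sum_(k < m) (k%:R + 1 <= u)%R%:R.
Proof.
elim: m => [|m IH] um; first by rewrite big_ord0; lra.
rewrite big_ord_recr/=; case: (leP u m%:R) => um'.
  by rewrite (le_trans (IH um'))// lerDl.
apply: le_trans (_ : m%:R <= _); first by move: um; rewrite -natr1; lra.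
rewrite -[leLHS]addr0 lerD//.
rewrite -[leLHS]mulr1 mulr_natl -[m in leLHS]card_ord -sumr_const.
apply: ler_sum => i _; rewrite (_ : (_ <= u))//.
by rewrite natr1 (le_trans _ (ltW um'))// ler_nat.
Qed.

Lemma count_lt_ge v m : v <= m%:R -> v <= \sum_(k < m) (k%:R < v)%R%:R.
Proof.
elim: m => [|m IH] vm; first by rewrite big_ord0.
rewrite big_ord_recr/=; case: (leP v m%:R) => vm'.
  by rewrite (le_trans (IH vm'))// lerDl.
apply: le_trans vm _; rewrite -natr1 lerD2r.
rewrite -[leLHS]mulr1 mulr_natl -[m in leLHS]card_ord -sumr_const.
apply: ler_sum => i _; rewrite (_ : (_ < v))//.
by rewrite (le_lt_trans _ vm')// ler_nat ltnW.
Qed.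

End counting.

Section induction.
Variables (d : measure_display) (T : measurableType d) (R : realType).

(** A bounded function is uniformly approximated by finite combinations of indicators of its level
    sets, so linear combinations and uniform limits reach all of them. *)
Lemma bmeas_ind (H : (T -> R) -> Prop) :
  (forall A, measurable A -> H \1_A) ->
  (forall k f g, bmeas f -> bmeas g -> H f -> H g -> H (fun x => k * f x + g x)) ->
  (forall f (F : nat -> T -> R), bmeas f -> (forall n, bmeas (F n)) ->
     (forall n, H (F n)) -> (forall n x, `|f x - F n x| <= n.+1%:R^-1) -> H f) ->
  forall f, bmeas f -> H f.
Proof.
move=> H1 Hlin Hlim f bf; have [mf [M Mf]] := bf.
pose q (n : nat) x := (f x + M) * n.+1%:R.
have q0 n x : 0 <= q n x.
  by rewrite mulr_ge0//; have := Mf x; rewrite ler_norml; lra.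
pose m n := (Num.truncn (M * 2 * n.+1%:R)).+1.
have qm n x : q n x <= (m n)%:R.
  apply: (@le_trans _ _ (M * 2 * n.+1%:R)).
    by rewrite ler_wpM2r//; have := Mf x; rewrite ler_norml; lra.
  exact/ltW/truncnS_gt.
(* Rounds [(f x + M) * n.+1] down to an integer, then undoes the scaling and the shift. The shift is
   an indicator of the whole space so that linearity applies to it as well. *)
pose F n x := \sum_(k < m n) n.+1%:R^-1 * (k%:R + 1 <= q n x)%R%:R + (- M) * \1_setT x.
have mq n : measurable_fun setT (q n).
  by apply: measurable_funM => //; apply: measurable_funD.
have mc n k : measurable_fun setT (fun x => k%:R + 1 <= q n x).
  exact: measurable_fun_ler.
have bH n k : bmeas (fun x => (k%:R + 1 <= q n x)%R%:R : R) /\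
    H (fun x => (k%:R + 1 <= q n x)%R%:R).
  split; first exact: bmeas_bool.
  by rewrite bool_indicE; apply: H1; exact: measurable_setb.
have bone : bmeas (\1_setT : T -> R) by exact: bmeas_indic.
have F12 n : bmeas (F n) /\ H (F n).
  rewrite /F; move: (m n) => p; elim: p => [|p [IH1 IH2]].
    rewrite (_ : (fun _ => _) = (fun x : T => (- M - 1) * \1_setT x + \1_setT x)).
      split; first by apply: bmeasD => //; exact: bmeasZ.
      by apply: Hlin => //; exact: H1.
    by apply/funext => x; rewrite big_ord0; ring.
  rewrite (_ : (fun _ => _) = (fun x => n.+1%:R^-1 * (p%:R + 1 <= q n x)%R%:R +
     (\sum_(k < p) n.+1%:R^-1 * (k%:R + 1 <= q n x)%R%:R + (- M) * \1_setT x))).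
    have [b1 h1] := bH n p.
    split; last exact: Hlin.
    by apply: bmeasD => //; exact: bmeasZ.
  by apply/funext => x; rewrite big_ord_recr/=; ring.
apply: (Hlim f F) => //; try by move=> n; have [] := F12 n.
move=> n x; rewrite /F indicE in_setT mulr1 -mulr_sumr.
have := count_le (m n) (q0 n x); have := count_ge (qm n x).
set S := \sum_(k < _) _ => S1 S2.
have n0 : 0 < (n.+1%:R : R) by [].
have -> : f x - (n.+1%:R^-1 * S + - M) = n.+1%:R^-1 * (q n x - S).
  by rewrite /q; field; rewrite gt_eqF.
rewrite normrM ger0_norm ?invr_ge0// -[leRHS]mulr1 ler_wpM2l ?invr_ge0//.
by rewrite ger0_norm; lra.
Qed.

End induction.

(** * The Markov property for bounded functions and Dynkin inequalities *)

Section chain.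
Variables (R : realType) (d : measure_display) (T : measurableType d).
Variables (Pr : probability T R) (S : set R) (K : R -> probability R R).
Variable X : nat -> {RV Pr >-> R}.
Hypothesis measurable_K :
  forall B, measurable B -> measurable_fun setT (fun x => K x B).
Hypothesis XS : forall n w, S (X n w).
Hypothesis markovX : forall n (A : set T) (B : set R),
  history X n A -> measurable B ->
  (Pr (A `&` X n.+1 @^-1` B) = \int[Pr]_(w in A) K (X n w) B)%E.

Implicit Types (f g F : R -> R).

Lemma history_measurable n A : history X n A -> measurable A.
Proof.
rewrite /history; apply: smallest_sub; first exact: sigma_algebra_measurable.
move=> B [i _ [C mC <-]]; rewrite setTI.
exact: measurable_funPTI.
Qed.

Lemma bmeas_comp_RV n f : bmeas f -> bmeas (fun w => f (X n w)).
Proof.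
move=> [mf [M Mf]]; split; last by exists M.
exact: measurableT_comp.
Qed.

(** Measurability of the kernel expectation and the Markov identity go through the induction
    together: linearity and passage to the limit in the identity require its right-hand side to be
    bounded measurable. *)
Lemma markov_bmeas f : bmeas f -> measurable_fun setT (fun y => Ex (K y) f) /\
  forall n A, history X n A ->
    Ex Pr (fun w => \1_A w * f (X n.+1 w)) =
    Ex Pr (fun w => \1_A w * Ex (K (X n w)) f).
Proof.
pose H f := measurable_fun setT (fun y => Ex (K y) f) /\
  forall n A, history X n A ->
    Ex Pr (fun w => \1_A w * f (X n.+1 w)) =
    Ex Pr (fun w => \1_A w * Ex (K (X n w)) f).
have bK g : bmeas g -> H g -> bmeas (fun y => Ex (K y) g).
  move=> bg [mK _]; have [mg [M Mg]] := bg; split => //.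
  by exists M => y; exact: norm_Ex.
apply: (@bmeas_ind _ _ _ H).
- move=> B mB; have EK y : Ex (K y) \1_B = fine (K y B) by rewrite Ex_indic.
  have mK : measurable_fun setT (fun y => Ex (K y) \1_B).
    under eq_fun do rewrite EK.
    by apply: measurableT_comp => //; exact: measurable_K.
  split=> // n A hA; have mA := history_measurable hA.
  transitivity (fine (Pr (A `&` X n.+1 @^-1` B))).
    rewrite -Ex_indic; last by apply: measurableI => //; exact: measurable_funPTI.
    by congr Ex; apply/funext => w; rewrite !indicE in_setI -mulnb natrM.
  rewrite markovX// /Ex /Rintegral; congr fine.
  rewrite [LHS]integral_mkcond; apply: eq_integral => w _.
  rewrite patchE indicE; case: ifPn => wA; last by rewrite mul0r.
  by rewrite mul1r -[X in _ = X%:E]/(Ex _ _) EK fineK// fin_num_measure.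
- move=> k f1 f2 bf1 bf2 H1 H2.
  have EK y : Ex (K y) (fun x => k * f1 x + f2 x) = k * Ex (K y) f1 + Ex (K y) f2.
    by rewrite ExD ?ExZ//; exact: bmeasZ.
  split.
    under eq_fun do rewrite EK.
    by apply: measurable_funD; [apply: measurable_funM => //; exact: H1.1|exact: H2.1].
  move=> n A hA; have bA := @bmeas_indic _ _ R _ (history_measurable hA).
  have split_lin (u v : T -> R) : bmeas u -> bmeas v ->
      Ex Pr (fun w => \1_A w * (k * u w + v w)) =
      k * Ex Pr (fun w => \1_A w * u w) + Ex Pr (fun w => \1_A w * v w).
    move=> bu bv; rewrite -ExZ; last exact: bmeasM.
    rewrite -ExD; [|by apply: bmeasZ; exact: bmeasM|exact: bmeasM].
    by congr Ex; apply/funext => w; ring.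
  rewrite split_lin; [|exact: bmeas_comp_RV|exact: bmeas_comp_RV].
  rewrite H1.2// H2.2// -split_lin.
  + by congr Ex; apply/funext => w; rewrite EK.
  + by apply: (@bmeas_comp_RV n (fun y => Ex (K y) f1)); exact: bK.
  + by apply: (@bmeas_comp_RV n (fun y => Ex (K y) f2)); exact: bK.
- move=> f1 F bf bF HF fF.
  have dist_Ex (d' : measure_display) (T' : measurableType d') (P : probability T' R)
      (u v : T' -> R) m : bmeas u -> bmeas v ->
      (forall x, `|u x - v x| <= m.+1%:R^-1) -> `|Ex P u - Ex P v| <= m.+1%:R^-1.
    by move=> bu bv uv; rewrite -ExB//; apply: norm_Ex => //; exact: bmeasB.
  have mK : measurable_fun setT (fun y => Ex (K y) f1).
    apply: (@measurable_fun_cvg _ _ _ _ (fun m y => Ex (K y) (F m))).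
      by move=> m; exact: (HF m).1.
    move=> y _; apply/cvgrPdist_le => e e0.
    near=> m; apply: (@le_trans _ _ m.+1%:R^-1); first by apply: dist_Ex.
    by apply/ltW; near: m; exact: (near_infty_natSinv_lt (PosNum e0)).
  split=> // n A hA; have bA := @bmeas_indic _ _ R _ (history_measurable hA).
  have bKf : bmeas (fun y => Ex (K y) f1).
    have [mf [M Mf]] := bf; split=> //; exists M => y; exact: norm_Ex.
  have A1 w : `|\1_A w : R| <= 1 by rewrite indicE ger0_norm// lern1 leq_b1.
  apply/eqP; rewrite -subr_eq0 -normr_le0; apply/ler_addgt0Pl => e e0; rewrite addr0.
  have [m me] : exists m : nat, m.+1%:R^-1 <= e / 2.
    have e2 : 0 < e / 2 by rewrite divr_gt0.
    by have [m _ /(_ m (leqnn m)) /= /ltW] := near_infty_natSinv_lt (PosNum e2); exists m.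
  have b1 : bmeas (fun w => \1_A w * f1 (X n.+1 w)).
    by apply: bmeasM => //; exact: bmeas_comp_RV.
  have b2 : bmeas (fun w => \1_A w * F m (X n.+1 w)).
    by apply: bmeasM => //; exact: bmeas_comp_RV.
  have b3 : bmeas (fun w => \1_A w * Ex (K (X n w)) f1).
    by apply: bmeasM => //; exact: (@bmeas_comp_RV n (fun y => Ex (K y) f1)).
  have b4 : bmeas (fun w => \1_A w * Ex (K (X n w)) (F m)).
    apply: bmeasM => //; apply: (@bmeas_comp_RV n (fun y => Ex (K y) (F m))).
    exact: bK.
  have E1 : `|Ex Pr (fun w => \1_A w * f1 (X n.+1 w)) -
              Ex Pr (fun w => \1_A w * F m (X n.+1 w))| <= m.+1%:R^-1.
    apply: dist_Ex => // w; rewrite -mulrBr normrM -[leRHS]mul1r.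
    by apply: ler_pM.
  have E2 : `|Ex Pr (fun w => \1_A w * Ex (K (X n w)) f1) -
              Ex Pr (fun w => \1_A w * Ex (K (X n w)) (F m))| <= m.+1%:R^-1.
    apply: (dist_Ex _ _ Pr) => // w; rewrite -mulrBr normrM -[leRHS]mul1r.
    by apply: ler_pM => //; exact: dist_Ex.
  move: E1 E2; rewrite (HF m).2//.
  move: me; set r := m.+1%:R^-1; set x1 := Ex _ _; set x2 := Ex _ _; set x3 := Ex _ _.
  move=> me /ler_normlP[] ? ? /ler_normlP[] ? ?; apply/ler_normlP; split; lra.
Unshelve. all: by end_near.
Qed.

Lemma bmeas_ExK f : bmeas f -> bmeas (fun y => Ex (K y) f).
Proof.
move=> bf; have [mf [M Mf]] := bf; split; first by have [] := markov_bmeas bf.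
by exists M => y; exact: norm_Ex.
Qed.

Definition EX n (f : R -> R) := Ex Pr (fun w => f (X n w)).

Lemma le_EX n f g : bmeas f -> bmeas g -> (forall y, S y -> f y <= g y) ->
  EX n f <= EX n g.
Proof.
move=> bf bg fg; apply: le_Ex; [exact: bmeas_comp_RV|exact: bmeas_comp_RV|].
by move=> w; apply: fg.
Qed.

Lemma EX_D n f g : bmeas f -> bmeas g -> EX n (fun y => f y + g y) = EX n f + EX n g.
Proof. by move=> bf bg; rewrite /EX ExD//; exact: bmeas_comp_RV. Qed.

Lemma EX_Z n k f : bmeas f -> EX n (fun y => k * f y) = k * EX n f.
Proof. by move=> bf; rewrite /EX ExZ//; exact: bmeas_comp_RV. Qed.

Lemma EX_S n f : bmeas f -> EX n.+1 f = EX n (fun y => Ex (K y) f).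
Proof.
move=> bf; have [_ /(_ n setT)] := markov_bmeas bf.
have hT : history X n setT.
  by apply: sub_sigma_algebra; exists 0%N => //; exists setT => //; rewrite setTI preimage_setT.
move=> /(_ hT); rewrite /EX => E.
transitivity (Ex Pr (fun w => \1_setT w * f (X n.+1 w))).
  by congr Ex; apply/funext => w; rewrite indicE in_setT mul1r.
by rewrite E; congr Ex; apply/funext => w; rewrite indicE in_setT mul1r.
Qed.

Definition occ N (f : R -> R) := \sum_(n < N) EX n f.

Lemma occ_D N f g : bmeas f -> bmeas g ->
  occ N (fun y => f y + g y) = occ N f + occ N g.
Proof.
by move=> bf bg; rewrite /occ -big_split/=; apply: eq_bigr => n _; rewrite EX_D.
Qed.

Lemma occ_Z N k f : bmeas f -> occ N (fun y => k * f y) = k * occ N f.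
Proof.
by move=> bf; rewrite /occ mulr_sumr; apply: eq_bigr => n _; rewrite EX_Z.
Qed.

Lemma occ_sum N (I : Type) (r : seq I) (Q : pred I) (F : I -> R -> R) :
  (forall i, bmeas (F i)) ->
  occ N (fun y => \sum_(i <- r | Q i) F i y) = \sum_(i <- r | Q i) occ N (F i).
Proof.
move=> bF; rewrite /occ exchange_big; apply: eq_bigr => n _.
by rewrite /EX Ex_sum// => i _; exact: bmeas_comp_RV.
Qed.

Lemma dynkin_ge F f N : bmeas F -> bmeas f ->
  (forall y, S y -> F y + f y <= Ex (K y) F) -> EX 0 F + occ N f <= EX N F.
Proof.
move=> bF bf Ff; elim: N => [|N IH]; first by rewrite /occ big_ord0 addr0.
rewrite /occ big_ord_recr/= addrA; apply: (le_trans (lerD IH (lexx _))).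
rewrite EX_S// -EX_D//; apply: le_EX => //; first exact: bmeasD.
exact: bmeas_ExK.
Qed.

Lemma dynkin_le F f N : bmeas F -> bmeas f ->
  (forall y, S y -> Ex (K y) F <= F y + f y) -> EX N F <= EX 0 F + occ N f.
Proof.
move=> bF bf Ff; elim: N => [|N IH]; first by rewrite /occ big_ord0 addr0.
rewrite /occ big_ord_recr/= addrA; apply: le_trans (lerD IH (lexx _)).
rewrite EX_S// -EX_D//; apply: le_EX => //; last exact: bmeasD.
exact: bmeas_ExK.
Qed.

(** Telescoping leaves only the oscillation of [F], whatever [N]. The upper bounds on occupations
    come from here, by a suitable choice of [F]. *)
Lemma occ_le F f N M : bmeas F -> bmeas f -> (forall y, 0 <= F y <= M) ->
  (forall y, S y -> F y + f y <= Ex (K y) F) -> occ N f <= M.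
Proof.
move=> bF bf FM Ff; have := dynkin_ge N bF bf Ff.
have : EX N F <= M.
  by apply: Ex_le => [|w]; [exact: bmeas_comp_RV|case/andP: (FM (X N w))].
have : 0 <= EX 0 F by apply: Ex_ge0 => w; case/andP: (FM (X 0 w)).
lra.
Qed.

End chain.

(** * Layer-cake bounds with integer levels *)

Section tail_counting.
Variable R : realType.
Implicit Types (m N M I : nat) (u v : R).

Lemma sum_odd m : \sum_(k < m) (2 * k%:R + 1) = m%:R ^+ 2 :> R.
Proof.
elim: m => [|m IH]; first by rewrite big_ord0 expr0n.
by rewrite big_ord_recr/= IH -natr1; ring.
Qed.

Lemma count_sq_ge v m : 0 <= v -> v <= m%:R ->
  v ^+ 2 <= \sum_(k < m) (2 * k%:R + 1) * (k%:R < v)%R%:R.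
Proof.
move=> v0; elim: m => [|m IH] vm.
  by have -> : v = 0 by [apply/le_anti; rewrite vm]; rewrite big_ord0 expr0n.
rewrite big_ord_recr/=; case: (leP v m%:R) => vm'.
  by rewrite (le_trans (IH vm'))// lerDl mulr_ge0// addr_ge0// mulr_ge0.
apply: (@le_trans _ _ (m.+1%:R ^+ 2)).
  by rewrite ler_sqr// nnegrE (le_trans v0).
rewrite mulr1 -sum_odd big_ord_recr/= lerD2r.
apply: ler_sum => i _; rewrite (_ : (_ < v)) ?mulr1//.
by rewrite (le_lt_trans _ vm')// ler_nat ltnW.
Qed.

(** The levels below [N] contribute at most [N ^ 2], less than a quarter of [v ^ 2]; the factor 2
    more than pays for dropping them. *)
Lemma tail_sq v N M : 2 * N%:R < v -> v <= M%:R ->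
  v ^+ 2 <= 2 * \sum_(N <= k < M) (2 * k%:R + 1) * (k%:R < v)%R%:R.
Proof.
move=> Nv vM; have N0 : 0 <= N%:R :> R by [].
have v0 : 0 <= v by lra.
have NM : (N <= M)%N by rewrite -(ler_nat R); lra.
have := count_sq_ge v0 vM.
rewrite -(big_mkord xpredT (fun k => (2 * k%:R + 1) * (k%:R < v)%R%:R)).
rewrite (@big_cat_nat _ _ _ N)//= big_mkord.
have : \sum_(i < N) (2 * i%:R + 1) * (i%:R < v)%R%:R <= N%:R ^+ 2 :> R.
  rewrite -sum_odd; apply: ler_sum => i _.
  by apply: ler_piMr; [rewrite addr_ge0// mulr_ge0|rewrite lern1 leq_b1].
set s1 := \sum_(i < N) _; set s2 := \sum_(N <= i < M) _ => h1 h2.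
have : N%:R ^+ 2 <= (v / 2) ^+ 2 by rewrite ler_sqr ?nnegrE; lra.
have -> : (v / 2) ^+ 2 = v ^+ 2 / 4 by field.
have := sqr_ge0 v; lra.
Qed.

(** The sum counts the unit intervals [[k, k + 1]] that meet the open interval from [u] to [v], and
    these cover it. *)
Lemma tail_lin u v I M : I%:R <= u -> v <= M%:R ->
  v - u <= \sum_(I <= k < M) (k%:R < v)%R%:R * (u < k%:R + 1)%R%:R.
Proof.
move=> Iu vM; have I0 : 0 <= I%:R :> R by [].
case: (leqP I M) => IM; last first.
  have MI : M%:R < I%:R :> R by rewrite ltr_nat.
  rewrite big_geq ?(ltnW IM)//; lra.
have u0 : 0 <= u by lra.
have := count_lt_ge vM; have := count_le M u0.
rewrite -(big_mkord xpredT (fun k => (k%:R < v)%R%:R)).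
rewrite -(big_mkord xpredT (fun k => (k%:R + 1 <= u)%R%:R)).
set s1 := \sum_(0 <= _ < M) _; set s2 := \sum_(0 <= _ < M) _ => h1 h2.
apply: (@le_trans _ _ (s2 - s1)); first lra.
rewrite /s1 /s2 -sumrB (@big_cat_nat _ _ _ I)//= -[leRHS]add0r lerD//.
  rewrite big_mkord; apply: sumr_le0 => i _.
  have -> : i%:R + 1 <= u by rewrite (le_trans _ Iu)// natr1 ler_nat.
  by rewrite subr_le0 lern1 leq_b1.
apply: ler_sum => i _; rewrite [u < _]ltNge.
by case: (i%:R < v); case: (i%:R + 1 <= u); rewrite /= ?mulr0n ?mulr1n; lra.
Qed.

Lemma bounded_tail_small (c : nat -> R) (B : R) : (forall k, 0 <= c k) ->
  (forall n, \sum_(k < n) c k <= B) ->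
  forall e, 0 < e -> exists I, forall n, \sum_(I <= k < n) c k <= e.
Proof.
move=> c0 cB e e0.
pose u n := \sum_(k < n) c k.
have hu : has_sup (range u).
  by split; [exists (u 0%N), 0%N|exists B => _ [n _ <-]; exact: cB].
have [_ [I _ <-] hI] := sup_adherent e0 hu.
exists I => n; case: (leqP I n) => In; last by rewrite big_geq ?ltW// ltnW.
have : u n <= sup (range u) by apply: ub_le_sup; [exact: hu.2|exists n].
rewrite /u -(big_mkord xpredT c) (@big_cat_nat _ _ _ I)//= big_mkord.
by move: hI; rewrite /u; set s := \sum_(i < I) _; lra.
Qed.

End tail_counting.

(** * Truncated jumps and the hypotheses in real-valued form *)

Definition small (R : realType) (s : R -> R) (y z : R) := `|z - y| <= s y.

Definition tmom (R : realType) (K : R -> probability R R) (s : R -> R) (k : nat)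
    (y : R) : R := Ex (K y) (fun z => (z - y) ^+ k * (small s y z)%:R).

Definition pbig (R : realType) (K : R -> probability R R) (s : R -> R) (y : R) : R :=
  Ex (K y) (fun z => (~~ small s y z)%:R).

Definition evS (R : realType) (S : set R) (P : R -> Prop) :=
  exists2 A, 0 < A & forall y, A <= y -> S y -> P y.

(* Real-valued form of the hypotheses of the theorem; [Tl j] is the tail
   [P(xihat > j)]. *)
Record regime (R : realType) (S : set R) (K : R -> probability R R)
    (s p : R -> R) (b mu : R) (Tl : nat -> R) : Prop := Regime {
  regime_b : 0 < b;
  regime_mu : b / 2 < mu;
  regime_s0 : forall y, 0 <= y -> 0 < s y;
  regime_s_homo : forall y z, 0 <= y -> y <= z -> s y <= s z;
  regime_s : forall e, 0 < e -> exists2 A, 0 < A & forall y, A <= y -> s y <= e * y;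
  regime_m1 : forall e, 0 < e -> evS S (fun y => `|y * tmom K s 1 y - mu| <= e);
  regime_m2 : forall e, 0 < e -> evS S (fun y => `|tmom K s 2 y - b| <= e);
  regime_big : forall y, S y -> 0 < y -> pbig K s y <= p y / y;
  regime_p0 : forall y, 0 < y -> 0 < p y;
  regime_p_homo : forall y z, 0 < y -> y <= z -> p z <= p y;
  regime_p_sum : forall e, 0 < e ->
    exists J, forall n, \sum_(J <= j < n) 2 ^+ j * p (2 ^+ j) <= e;
  regime_T0 : forall j, 0 <= Tl j;
  regime_dom : forall y, S y -> 0 <= y -> forall j : nat,
    Ex (K y) (fun z => ((j%:R < `|z - y|) && small s y z)%:R) <= Tl j;
  regime_T_sum : forall e, 0 < e ->
    exists I, forall n, \sum_(I <= j < n) (2 * j%:R + 1) * Tl j <= e }.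

Section small_jumps.
Variables (R : realType) (K : R -> probability R R) (s : R -> R).
Implicit Types (y z W al c M : R) (f F g : R -> R).

Lemma measurable_small y : measurable_fun setT (small s y).
Proof.
apply: measurable_fun_ler => //; apply: measurableT_comp => //.
exact: measurable_funB.
Qed.

Lemma bmeas_small y : bmeas (fun z => (small s y z)%:R : R).
Proof. by apply: bmeas_bool; exact: measurable_small. Qed.

Lemma bmeas_big y : bmeas (fun z => (~~ small s y z)%:R : R).
Proof. by apply: bmeas_bool; apply: measurable_neg; exact: measurable_small. Qed.

Lemma bmeas_cut y f : measurable_fun setT f ->
  (exists M, forall z, small s y z -> `|f z| <= M) ->
  bmeas (fun z => f z * (small s y z)%:R).
Proof.
move=> mf [M Mf]; split.
  by apply: measurable_funM => //; have [] := bmeas_small y.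
exists `|M| => z; case: (boolP (small s y z)) => [yz|_]; last by rewrite mulr0 normr0.
by rewrite mulr1 (le_trans (Mf z yz))// ler_norm.
Qed.

Lemma bmeas_jump_pow y k : bmeas (fun z => (z - y) ^+ k * (small s y z)%:R).
Proof.
apply: bmeas_cut.
  by apply: measurable_funX; exact: measurable_funB.
by exists (s y ^+ k) => z yz; rewrite normrX lerXn2r ?nnegrE// (le_trans _ yz).
Qed.

Let Ex_quad y W al c g : bmeas g ->
  let h z := W * (al * ((z - y) ^+ 1 * (small s y z)%:R) -
                  c * ((z - y) ^+ 2 * (small s y z)%:R)) + g z * (small s y z)%:R in
  bmeas h /\
  Ex (K y) h = W * (al * tmom K s 1 y - c * tmom K s 2 y) +
               Ex (K y) (fun z => g z * (small s y z)%:R).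
Proof.
move=> bg h; have b1 := bmeas_jump_pow y 1; have b2 := bmeas_jump_pow y 2.
have b3 : bmeas (fun z => g z * (small s y z)%:R).
  by apply: bmeasM => //; exact: bmeas_small.
have b12 : bmeas (fun z => al * ((z - y) ^+ 1 * (small s y z)%:R) -
                  c * ((z - y) ^+ 2 * (small s y z)%:R)).
  by apply: bmeasB; exact: bmeasZ.
split; first by apply: bmeasD => //; exact: bmeasZ.
rewrite /h ExD//; last exact: bmeasZ.
by rewrite ExZ// ExB ?ExZ//; exact: bmeasZ.
Qed.

(** The pointwise bound is integrated over small jumps only; a large jump loses at most [F y]
    because [F] is nonnegative. In [Ex_upper], likewise, a large jump gains at most the bound [M] of
    [F]. *)
Lemma Ex_lower y F W al c g : bmeas F -> bmeas g -> (forall z, 0 <= F z) ->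
  (forall z, small s y z ->
     W * (al * (z - y) - c * (z - y) ^+ 2) + g z <= F z - F y) ->
  W * (al * tmom K s 1 y - c * tmom K s 2 y) +
    Ex (K y) (fun z => g z * (small s y z)%:R) - F y * pbig K s y
  <= Ex (K y) F - F y.
Proof.
move=> bF bg F0 H; have [bh <-] := Ex_quad y W al c bg.
set h := (fun z => _) in bh *.
have bb := bmeas_big y.
rewrite -[X in _ <= _ - X](Ex_cst (K y) (F y)) -(ExB _ bF (bmeas_cst _ _)).
rewrite -ExZ// -ExB//; last exact: bmeasZ.
apply: le_Ex; [by apply: bmeasB => //; exact: bmeasZ|by apply: bmeasB => //; exact: bmeas_cst|].
move=> z; rewrite /h; case: (boolP (small s y z)) => [yz|_] /=.
  by have := H z yz; rewrite expr1 !mulr1 mulr0n mulr0 subr0.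
by have := F0 z; rewrite mulr0n !mulr0 mulr1; lra.
Qed.

Lemma Ex_upper y F W al c g M : bmeas F -> bmeas g -> (forall z, F z <= M) -> 0 <= F y ->
  (forall z, small s y z ->
     F z - F y <= W * (al * (z - y) - c * (z - y) ^+ 2) + g z) ->
  Ex (K y) F - F y <=
  W * (al * tmom K s 1 y - c * tmom K s 2 y) +
    Ex (K y) (fun z => g z * (small s y z)%:R) + M * pbig K s y.
Proof.
move=> bF bg FM F0 H; have [bh <-] := Ex_quad y W al c bg.
set h := (fun z => _) in bh *.
have bb := bmeas_big y.
rewrite -[X in _ - X <= _](Ex_cst (K y) (F y)) -(ExB _ bF (bmeas_cst _ _)).
rewrite -ExZ// -ExD//; last exact: bmeasZ.
apply: le_Ex; [by apply: bmeasB => //; exact: bmeas_cst|by apply: bmeasD => //; exact: bmeasZ|].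
move=> z; rewrite /h; case: (boolP (small s y z)) => [yz|_] /=.
  by have := H z yz; rewrite expr1 !mulr1 mulr0n mulr0 addr0.
by have := FM z; rewrite mulr0n !mulr0 mulr1; lra.
Qed.

Lemma pbig_ge0 y : 0 <= pbig K s y. Proof. exact: Ex_ge0. Qed.

End small_jumps.

(** * Sign of the drift of powers far to the right *)

Section drift.
Variables (R : realType) (S : set R) (K : R -> probability R R).
Variables (s p : R -> R) (b mu : R) (Tl : nat -> R).
Hypothesis Hr : regime S K s p b mu Tl.
Implicit Types (y z a c e : R).

Let b0 : 0 < b. Proof. exact: regime_b Hr. Qed.
Let a0 := 2 * mu / b - 1.

Lemma evS_and (P Q : R -> Prop) : evS S P -> evS S Q -> evS S (fun y => P y /\ Q y).
Proof.
move=> [A A0 HA] [B B0 HB]; exists (Num.max A B); first by rewrite lt_max A0.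
by move=> y; rewrite ge_max => /andP[Ay By] Sy; split; [exact: HA|exact: HB].
Qed.

Lemma index_gt0 : 0 < a0.
Proof.
have := regime_mu Hr; have := b0 => ? ?.
by rewrite /a0 subr_gt0 ltr_pdivlMr// mul1r; lra.
Qed.

Lemma drift_lin a c e : 0 < e -> 0 <= a -> 0 <= c ->
  evS S (fun y => `|a * (y * tmom K s 1 y) - c * tmom K s 2 y - (a * mu - c * b)| <= e).
Proof.
move=> e0 ha hc; pose e' := e / (a + c + 1).
have ac : 0 < a + c + 1 by lra.
have e'0 : 0 < e' by rewrite divr_gt0.
have [A A0 HA] := evS_and (regime_m1 Hr e'0) (regime_m2 Hr e'0).
exists A => // y Ay Sy; have [] := HA y Ay Sy.
set u := y * _; set v := tmom _ _ _ _ => hu hv.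
have -> : a * u - c * v - (a * mu - c * b) = a * (u - mu) - c * (v - b) by ring.
apply: (le_trans (ler_normB _ _)); rewrite !normrM (ger0_norm ha) (ger0_norm hc).
apply: (@le_trans _ _ (a * e' + c * e')).
  by rewrite lerD// ler_wpM2l.
rewrite -mulrDl /e' mulrCA ler_piMr ?(ltW e0)// ler_pdivrMr// mul1r; lra.
Qed.

(** [k = 1] with [a < a0] gives the submartingale direction and [k = -1] with [a > a0] the
    supermartingale one. The coefficient [c] of the comparison parabola keeps a margin on both
    sides: one absorbs the Taylor remainder, the other the error in the limits of the truncated
    moments. *)
Lemma drift_scale (a k : R) : 0 < a -> 0 < k * (a0 - a) ->
  exists c eta, 0 < eta /\ evS S (fun y =>
    [/\ forall z, small s y z -> `|z - y| <= y / 2,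
        eta <= k * (a * y * tmom K s 1 y - c * tmom K s 2 y) &
        forall z, small s y z ->
        0 <= k * (y `^ (- a) - z `^ (- a)
             - y `^ (- a - 2) * (a * y * (z - y) - c * (z - y) ^+ 2))]).
Proof.
move=> a_gt0 ka.
(* midpoint between the curvature of the scale function and the drift ratio *)
pose c := (a * (a + 1) / 2 + a * mu / b) / 2.
have E : a * mu - c * b = a * b / 4 * (a0 - a).
  by rewrite /c /a0; field; rewrite gt_eqF.
have c0 : 0 <= c.
  have := regime_mu Hr; have := b0 => ? ?.
  rewrite /c !(mulr_ge0, addr_ge0, invr_ge0)//; lra.
have kc : 0 < k * (2 * c - a * (a + 1)).
  have -> : k * (2 * c - a * (a + 1)) = k * (a0 - a) * (a / 2).
    by rewrite /c /a0; field; rewrite gt_eqF.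
  by rewrite mulr_gt0// divr_gt0.
have [dl /andP[dl0 dl2] Hdl] := powRN_scale_taylor a_gt0 kc.
have kE : 0 < k * (a * mu - c * b).
  have -> : k * (a * mu - c * b) = k * (a0 - a) * (a * b / 4) by rewrite E; ring.
  by rewrite mulr_gt0// divr_gt0// mulr_gt0.
exists c, (k * (a * mu - c * b) / 2); split; first by rewrite divr_gt0.
have k0 : 0 < `|k|.
  by rewrite normr_gt0; apply/eqP => k_0; move: ka; rewrite k_0 mul0r ltxx.
pose e := k * (a * mu - c * b) / (2 * `|k|).
have e0 : 0 < e by rewrite divr_gt0// mulr_gt0.
have [A A0 HA] := drift_lin e0 (ltW a_gt0) c0.
have dl20 : 0 < dl / 2 by lra.
have [B B0 HB] := regime_s Hr dl20.
exists (Num.max A B); first by rewrite lt_max A0.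
move=> y; rewrite ge_max => /andP[Ay By] Sy.
have y0 : 0 < y := lt_le_trans A0 Ay.
have sdl z : small s y z -> `|z - y| < dl * y.
  move=> yz; apply: (le_lt_trans yz); apply: (le_lt_trans (HB _ _)) => //.
  by rewrite ltr_pM2r//; lra.
split.
- by move=> z /sdl /ltW zy; apply: (le_trans zy); nra.
- have := HA y Ay Sy; rewrite (mulrA a y); set D := _ - _.
  rewrite -(ler_pM2l k0) -normrM.
  have -> : `|k| * e = k * (a * mu - c * b) / 2 by rewrite /e; field; rewrite gt_eqF.
  by move=> /ler_normlP[]; rewrite /D; lra.
- by move=> z /sdl zy; exact: Hdl.
Qed.

End drift.

(** * Powers cut off at a level *)

Section kink.
Variables (R : realType) (a : R).
Hypothesis a_gt0 : 0 < a.
Implicit Types (v y z : R).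

Definition kink v y := if y <= v then 0 else 1 - v `^ a * y `^ (- a).

Let pow_ge v y : 0 < v -> v <= y -> 0 <= 1 - v `^ a * y `^ (- a).
Proof.
move=> v0 vy; have y0 := lt_le_trans v0 vy.
rewrite subr_ge0 powRN ler_pdivrMr ?powR_gt0// mul1r.
by apply: ge0_ler_powR; rewrite ?nnegrE ?(ltW a_gt0) ?(ltW v0) ?(ltW y0).
Qed.

Lemma kink0 v y : y <= v -> kink v y = 0. Proof. by rewrite /kink => ->. Qed.

Lemma kink_gt v y : v < y -> kink v y = 1 - v `^ a * y `^ (- a).
Proof. by rewrite /kink leNgt => ->. Qed.

Lemma kink_bounds v y : 0 < v -> 0 <= kink v y <= 1.
Proof.
move=> v0; case: (leP y v) => [yv|vy]; first by rewrite kink0// lexx ler01.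
rewrite kink_gt// pow_ge//= ?(ltW vy)//.
by rewrite gerDl oppr_le0 mulr_ge0// powR_ge0.
Qed.

Lemma kink_homo v : 0 < v -> {homo kink v : y z / y <= z}.
Proof.
move=> v0 y z yz; case: (leP y v) => [yv|vy].
  by rewrite kink0//; case/andP: (kink_bounds z v0).
rewrite !kink_gt ?(lt_le_trans vy yz)// lerD2l lerN2 ler_wpM2l ?powR_ge0//.
by apply: powRN_le => //; exact: lt_trans vy.
Qed.

Lemma kink_lt v y z : 0 < v -> v < y -> y < z -> kink v y < kink v z.
Proof.
move=> v0 vy yz; rewrite !kink_gt ?(lt_trans vy yz)//.
rewrite ltrD2l ltrN2 ltr_pM2l ?powR_gt0//.
by apply: powRN_lt => //; exact: lt_trans vy.
Qed.

(** The cut at 0 can only raise the value at [z], while at [y] it has no effect; so the drift of the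
    power from below survives the cut. *)
Lemma kink_sub v y z : 0 < v -> v < y -> 0 < z ->
  v `^ a * (y `^ (- a) - z `^ (- a)) <= kink v z - kink v y.
Proof.
move=> v0 vy z0; rewrite (kink_gt vy).
suff : 1 - v `^ a * z `^ (- a) <= kink v z by set X := v `^ a; lra.
case: (leP z v) => [zv|vz]; last by rewrite kink_gt.
rewrite kink0// subr_le0 powRN ler_pdivlMr ?powR_gt0// mul1r.
by apply: ge0_ler_powR; rewrite ?nnegrE ?(ltW a_gt0) ?(ltW v0) ?(ltW z0).
Qed.

Lemma bmeas_homo (f : R -> R) M : {homo f : y z / y <= z} ->
  (forall y, `|f y| <= M) -> bmeas f.
Proof.
by move=> fh fM; split; [exact: nondecreasing_measurable|exists M].
Qed.

Lemma bmeas_kink v : 0 < v -> bmeas (kink v).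
Proof.
move=> v0; apply: (@bmeas_homo _ 1); first exact: kink_homo.
by move=> y; case/andP: (kink_bounds y v0) => k0 k1; rewrite ger0_norm.
Qed.

End kink.

(** * The bounded Lyapunov function that pays for large jumps *)

Section lyapunov.
Variables (R : realType) (S : set R) (K : R -> probability R R).
Variables (s p : R -> R) (b mu : R) (Tl : nat -> R).
Hypothesis Hr : regime S K s p b mu Tl.
Implicit Types (y z a c e : R).

Lemma Ex_cut0 y : Ex (K y) (fun z => 0 * (small s y z)%:R) = 0.
Proof.
by rewrite (_ : (fun _ => _) = fun _ => 0) ?Ex_cst//; apply/funext => z; rewrite mul0r.
Qed.

Lemma kink_drift : exists a eta, [/\ 0 < a, 0 < eta & evS S (fun y =>
  forall v, 0 < v -> v < y ->
    v `^ a * y `^ (- a - 2) * eta - p y / y <= Ex (K y) (kink a v) - kink a v y)].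
Proof.
have A0 := index_gt0 Hr; set a0 := 2 * mu / b - 1 in A0.
have a_gt0 : 0 < a0 / 2 by lra.
have ka : 0 < 1 * (a0 - a0 / 2) by lra.
have [c [eta [eta0 [A A_gt0 HA]]]] := drift_scale Hr a_gt0 ka.
exists (a0 / 2), eta; split => //; exists A => // y Ay Sy v v0 vy.
have y0 := lt_trans v0 vy.
have [hs hd ht] := HA y Ay Sy.
have := @Ex_lower R K s y (kink (a0 / 2) v) (v `^ (a0 / 2) * y `^ (- (a0 / 2) - 2))
   (a0 / 2 * y) c (fun _ => 0) (bmeas_kink a_gt0 v0) (bmeas_cst _ _) _ _.
rewrite Ex_cut0 addr0 => H; apply: le_trans (H _ _); first last.
- move=> z yz; rewrite addr0.
  have z0 : 0 < z by have := hs z yz; move=> /ler_normlP[]; lra.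
  apply: le_trans (kink_sub a_gt0 v0 vy z0).
  rewrite -mulrA ler_wpM2l ?powR_ge0//.
  by have := ht z yz; rewrite mul1r; lra.
- by move=> z; case/andP: (kink_bounds a_gt0 z v0).
have := regime_big Hr Sy y0; have := pbig_ge0 K s y.
have /andP[k0 k1] := kink_bounds a_gt0 y v0.
move=> q0 q1; apply: lerB.
  rewrite ler_wpM2l ?mulr_ge0 ?powR_ge0//; move: hd; rewrite mul1r; lra.
apply: le_trans q1; rewrite -[leRHS]mul1r; exact: ler_wpM2r.
Qed.

Lemma dyadic_bracket J y : 2 ^+ J < y -> exists2 j, (J <= j)%N & 2 ^+ j < y <= 2 ^+ j.+1.
Proof.
move=> Jy; have y0 : 0 < y by apply: lt_trans Jy; rewrite exprn_gt0.
have ex : exists n, y <= 2 ^+ n.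
  exists (Num.truncn y).+1; apply: (le_trans (ltW (truncnS_gt y))).
  by rewrite -natrX ler_nat ltnW// ltn_expl.
have := ex_minnP ex; case=> -[|n] yn nmin.
  have : 1 <= 2 ^+ J :> R by rewrite exprn_ege1// ler1n.
  by move: yn; rewrite expr0; lra.
have ny : 2 ^+ n < y.
  by rewrite ltNge; apply/negP => /nmin; rewrite ltnn.
exists n; last by rewrite ny.
have : 2 ^+ J < 2 ^+ n.+1 :> R by exact: lt_le_trans yn.
by rewrite ltr_eXn2l ?ltr1n// ltnS.
Qed.

(** For [y] between [v i = 2 ^+ i] and [2 * v i] the copy [i] alone gains at least [2 * (p y / y)]:
    its drift is of order [v i ^ a * y ^ (- a - 2)], which is why its weight is a multiple of
    [v i * p (v i)]. Large jumps cost each copy at most its weight times [p y / y], and the weights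
    sum to at most 1, so [p y / y] remains. Starting the sum at a large [J] makes [U] as small as
    [th] and moves its support beyond [B]. *)
Lemma lyapunov_exists (th B : R) : 0 < th -> exists2 A, 0 < A & B <= A /\
  exists U : R -> R, [/\ bmeas U, forall y, 0 <= U y <= th,
     forall y, y <= A -> U y = 0, {homo U : y z / y <= z} &
     (forall y z, A < y -> y < z -> U y < U z) /\
     (forall y, S y -> A < y -> U y + p y / y <= Ex (K y) U)].
Proof.
move=> th0; have [a [eta [a_gt0 eta0 [A1 A10 HA1]]]] := kink_drift.
(* The power of 2 compensates [y <= 2 * v i]; the other factor 2 leaves a surplus once the losses
   are paid. *)
pose C := 2 `^ (a + 1) * 2 / eta.
have C0 : 0 < C by rewrite divr_gt0// mulr_gt0// powR_gt0.
pose th1 := Num.min th 1.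
have th10 : 0 < th1 by rewrite lt_min th0 ltr01.
have [J1 HJ1] := regime_p_sum Hr (divr_gt0 th10 C0).
pose J := maxn J1 (Num.truncn (Num.max A1 B)).+1.
pose A : R := 2 ^+ J.
have A_gt0 : 0 < A by rewrite exprn_gt0.
have pow_lt n : n%:R < 2 ^+ n :> R by rewrite -natrX ltr_nat ltn_expl.
have AM : Num.max A1 B <= A.
  apply/ltW/(lt_trans (truncnS_gt _))/(le_lt_trans _ (pow_lt J)).
  by rewrite ler_nat leq_maxr.
pose v j : R := 2 ^+ j.
have v0 j : 0 < v j by rewrite exprn_gt0.
pose be j := C * (v j * p (v j)).
have be0 j : 0 < be j.
  by apply: mulr_gt0 => //; apply: mulr_gt0 => //; exact: (regime_p0 Hr (v0 j)).
pose Un n y := \sum_(J <= j < n) be j * kink a (v j) y.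
have kb j y := kink_bounds a_gt0 y (v0 j).
have be_sum n : \sum_(J <= j < n) be j <= th1.
  rewrite -mulr_sumr mulrC -ler_pdivlMr//; apply: le_trans (HJ1 n).
  case: (leqP J n) => Jn; last first.
    rewrite big_geq ?(ltnW Jn)//; apply: sumr_ge0 => j _.
    by apply: mulr_ge0; apply: ltW; [exact: v0|exact: (regime_p0 Hr (v0 j))].
  rewrite [leRHS](@big_cat_nat _ _ _ J)//= ?leq_maxl// lerDr.
  apply: sumr_ge0 => j _.
  by apply: mulr_ge0; apply: ltW; [exact: v0|exact: (regime_p0 Hr (v0 j))].
have Un0 n y : 0 <= Un n y.
  by rewrite sumr_ge0// => j _; rewrite mulr_ge0 ?(ltW (be0 j))//; case/andP: (kb j y).
have Unth n y : Un n y <= th1.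
  apply: le_trans (be_sum n); apply: ler_sum => j _.
  by rewrite ler_piMr ?(ltW (be0 j))//; case/andP: (kb j y).
have Un_homo n : {homo Un n : y z / y <= z}.
  move=> y z yz; apply: ler_sum => j _; rewrite ler_wpM2l ?(ltW (be0 j))//.
  exact: kink_homo.
have Un_mono m n y : (m <= n)%N -> Un m y <= Un n y.
  move=> mn; case: (leqP J m) => Jm.
    rewrite /Un [leRHS](@big_cat_nat _ _ _ m)//= lerDl sumr_ge0// => j _.
    by rewrite mulr_ge0 ?(ltW (be0 j))//; case/andP: (kb j y).
  by rewrite {1}/Un big_geq ?(ltnW Jm).
(* Copies at levels beyond [y] vanish at [y], so the infinite sum is a finite one at each point and
   no limit is taken. *)
pose U y := Un (Num.truncn y).+1 y.
have U_stable n y : (Num.truncn y < n)%N -> Un n y = U y.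
  move=> /subnKC <-; elim: (n - _)%N => [|k IH]; first by rewrite addn0.
  rewrite -IH addnS /Un; set m := (_ + k)%N.
  case: (leqP J m) => Jm; last by rewrite !big_geq// ltnW.
  rewrite big_nat_recr//= kink0 ?mulr0 ?addr0//.
  apply: (le_trans (ltW (truncnS_gt y))); apply: le_trans (ltW (pow_lt m)).
  by rewrite ler_nat leq_addr.
have UnE n y : Un n y = \sum_(J <= j < n) be j * kink a (v j) y by [].
have UE y : U y = Un (Num.truncn y).+1 y by [].
clearbody U Un.
have Un_le n y : Un n y <= U y.
  rewrite -(U_stable (maxn n (Num.truncn y).+1)) ?leq_maxr//.
  by apply: Un_mono; rewrite leq_maxl.
have U_homo : {homo U : y z / y <= z}.
  by move=> y z yz; apply: le_trans (Un_le (Num.truncn y).+1 z); rewrite UE Un_homo.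
have U_bounds y : 0 <= U y <= th1 by rewrite UE Un0 Unth.
exists A => //; split; first by rewrite (le_trans _ AM)// le_max lexx orbT.
have bU : bmeas U.
  apply: (@bmeas_homo _ _ th1) => // y.
  by have /andP[u0 u1] := U_bounds y; rewrite ger0_norm.
have A_le j : (J <= j)%N -> A <= v j.
  by move=> Jj; rewrite /A /v ler_weXn2l// ler1n.
exists U; split => //.
- move=> y; have /andP[u0 u1] := U_bounds y; rewrite u0 (le_trans u1)//.
  by rewrite ge_min lexx.
- move=> y yA; rewrite UE UnE big_nat_cond big1// => j /andP[/andP[Jj _] _].
  by rewrite kink0 ?mulr0// (le_trans yA)// A_le.
split.
  move=> y z Ay yz.
  pose n := maxn J.+1 (maxn (Num.truncn y).+1 (Num.truncn z).+1).
  have ny : (Num.truncn y < n)%N by rewrite !leq_max ltnSn !orbT.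
  have nz : (Num.truncn z < n)%N by rewrite !leq_max ltnSn !orbT.
  have Jn : (J < n)%N by rewrite !leq_max ltnSn.
  have <- := U_stable _ _ ny; have <- := U_stable _ _ nz.
  rewrite !UnE !(big_ltn Jn).
  apply: ltr_leD; first by rewrite (ltr_pM2l (be0 J)); exact: kink_lt.
  apply: ler_sum => j _; rewrite ler_wpM2l ?(ltW (be0 j))//.
  by apply: kink_homo => //; exact: ltW.
move=> y Sy Ay.
have y0 : 0 < y by exact: lt_trans Ay.
have A1y : A1 <= y.
  by apply: (le_trans _ (ltW Ay)); apply: le_trans AM; rewrite le_max lexx.
have py0 := regime_p0 Hr y0.
have [i Ji /andP[iy yi]] := dyadic_bracket Ay.
pose n := (maxn i (Num.truncn y)).+1.
have ny : (Num.truncn y < n)%N by rewrite ltnS leq_maxr.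
have i_n : (i < n)%N by rewrite ltnS leq_maxl.
have bk j := bmeas_kink a_gt0 (v0 j).
have bUn : bmeas (Un n).
  have -> : Un n = fun y => \sum_(J <= j < n) be j * kink a (v j) y.
    by apply/funext => z; rewrite UnE.
  by apply: bmeas_sum => j _; exact: bmeasZ.
have EUn : Ex (K y) (Un n) <= Ex (K y) U by exact: le_Ex.
have <- := U_stable _ _ ny.
apply: le_trans EUn; rewrite addrC -lerBrDr.
have -> : Ex (K y) (Un n) - Un n y =
    \sum_(J <= j < n) be j * (Ex (K y) (kink a (v j)) - kink a (v j) y).
  have -> : Ex (K y) (Un n) = Ex (K y) (fun z => \sum_(J <= j < n) be j * kink a (v j) z).
    by congr Ex; apply/funext => z; rewrite UnE.
  rewrite UnE Ex_sum; last by move=> j _; exact: bmeasZ.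
  by rewrite -sumrB; apply: eq_bigr => j _; rewrite ExZ// mulrBr.
pose gain := be i * (v i `^ a * y `^ (- a - 2) * eta).
have term j : (j == i)%:R * gain - be j * (p y / y) <=
    be j * (Ex (K y) (kink a (v j)) - kink a (v j) y).
  have pe0 : 0 <= v j `^ a * y `^ (- a - 2) * eta.
    by rewrite !mulr_ge0 ?powR_ge0 ?(ltW eta0).
  case: (ltP (v j) y) => [vy|yv].
    have := HA1 y A1y Sy (v j) (v0 j) vy.
    move=> /(ler_wpM2l (ltW (be0 j))); apply: le_trans.
    rewrite mulrBr lerB//; case: eqP => [->|_]; first by rewrite mul1r.
    by rewrite mul0r mulr_ge0 ?(ltW (be0 j)).
  have -> : (j == i) = false.
    by apply/eqP => ji; move: yv; rewrite ji leNgt iy.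
  rewrite mul0r sub0r (kink0 _ yv) subr0.
  apply: (@le_trans _ _ 0).
    by rewrite oppr_le0 mulr_ge0 ?(ltW (be0 j))// divr_ge0// ltW.
  rewrite mulr_ge0 ?(ltW (be0 j))//; apply: Ex_ge0 => z; by case/andP: (kb j z).
have sum_term : gain - th1 * (p y / y) <=
    \sum_(J <= j < n) ((j == i)%:R * gain - be j * (p y / y)).
  rewrite sumrB -!mulr_suml; apply: lerB.
    rewrite (bigD1_seq i)/= ?mem_index_iota ?Ji ?i_n ?iota_uniq// eqxx.
    rewrite mulrDl mul1r lerDl mulr_ge0//; first exact: sumr_ge0.
    by rewrite mulr_ge0 ?(ltW (be0 i))// !mulr_ge0 ?powR_ge0 ?(ltW eta0).
  by rewrite ler_wpM2r// divr_ge0// ltW.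
apply: (le_trans _ (ler_sum _ (fun j _ => term j))).
apply: le_trans sum_term.
have th1le : th1 * (p y / y) <= p y / y.
  by rewrite ler_piMl ?divr_ge0 ?(ltW py0) ?(ltW y0)// ge_min lexx orbT.
suff : 2 * (p y / y) <= gain by lra.
have pvi : p y <= p (v i) by apply: (regime_p_homo Hr) => //; exact: ltW.
have yv : y <= 2 * v i by rewrite /v -exprS.
have powy : (y / 2) `^ (a + 1) <= v i `^ (a + 1).
  have a1 : 0 <= a + 1 by lra.
  by apply: (ge0_ler_powR a1); rewrite ?nnegrE; lra.
have Ey : y `^ (- a - 2) = (y `^ (a + 1) * y)^-1.
  rewrite -[y in _ * y]powRr1 ?(ltW y0)// -powRD ?(gt_eqF y0) ?implybT//.
  by rewrite -powRN; congr (_ `^ _); ring.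
have Ev : v i `^ (a + 1) = v i `^ a * v i.
  by rewrite powRD ?(gt_eqF (v0 i)) ?implybT// powRr1// ltW.
have Ey2 : y `^ (a + 1) = 2 `^ (a + 1) * (y / 2) `^ (a + 1).
  by rewrite -powRM; [congr (_ `^ _); field|lra|lra].
have q0 : 0 < (y / 2) `^ (a + 1) by rewrite powR_gt0// divr_gt0.
have t0 : 0 < (2 : R) `^ (a + 1) by rewrite powR_gt0.
have -> : gain = 2 * (p (v i) * (v i `^ (a + 1) / (y / 2) `^ (a + 1)) / y).
  rewrite /gain /be /C Ey Ey2 Ev; field; rewrite !gt_eqF//.
rewrite ler_pM2l// ler_pM2r ?invr_gt0//.
apply: (le_trans pvi); rewrite ler_peMr ?(ltW (regime_p0 Hr (v0 i)))//.
by rewrite ler_pdivlMr// mul1r.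
Qed.

End lyapunov.

(** * Second moment of short jumps, and the drift of the test function from below *)

Section core_variance.
Variables (R : realType) (S : set R) (K : R -> probability R R).
Variables (s p : R -> R) (b mu : R) (Tl : nat -> R).
Hypothesis Hr : regime S K s p b mu Tl.
Implicit Types (x y z r e : R) (N M : nat).

Lemma bmeas_itv x y : bmeas (fun z : R => (x < z <= y)%R%:R : R).
Proof.
apply: bmeas_bool; apply: measurable_and.
  by apply: measurable_fun_ltr.
by apply: measurable_fun_ler.
Qed.

Lemma measurable_dist y : measurable_fun setT (fun z : R => `|z - y|).
Proof. by apply: measurableT_comp => //; exact: measurable_funB. Qed.

Lemma bmeas_far (u y : R) :
  bmeas (fun z => ((u < `|z - y|) && small s y z)%:R : R).
Proof.
apply: bmeas_bool; apply: measurable_and; last exact: measurable_small.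
by apply: measurable_fun_ltr => //; exact: measurable_dist.
Qed.

Lemma variance_tail y N M : S y -> 0 <= y -> s y <= M%:R ->
  Ex (K y) (fun z => (2 * N%:R < `|z - y|)%R%:R * ((z - y) ^+ 2 * (small s y z)%:R)) <=
  2 * \sum_(N <= j < M) (2 * j%:R + 1) * Tl j.
Proof.
move=> Sy y0 sM.
have bf j := bmeas_far j%:R y.
have c0 (j : nat) : 0 <= 2 * (2 * j%:R + 1) :> R.
  by apply: mulr_ge0 => //; apply: addr_ge0 => //; exact: mulr_ge0.
apply: (@le_trans _ _ (Ex (K y) (fun z => \sum_(N <= j < M)
    2 * (2 * j%:R + 1) * ((j%:R < `|z - y|) && small s y z)%:R))).
  apply: le_Ex.
  - apply: bmeasM; last exact: bmeas_jump_pow.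
    by apply: bmeas_bool; apply: measurable_fun_ltr => //; exact: measurable_dist.
  - by apply: bmeas_sum => j _; exact: bmeasZ.
  move=> z; case: (boolP (small s y z)) => yz; last first.
    by rewrite !mulr0; apply: sumr_ge0 => j _; exact: mulr_ge0.
  rewrite mulr1; case: (ltP (2 * N%:R) `|z - y|) => Nz; last first.
    by rewrite mul0r; apply: sumr_ge0 => j _; exact: mulr_ge0.
  rewrite mul1r; have := tail_sq Nz (le_trans yz sM).
  rewrite mulr_sumr real_normK ?num_real// => /le_trans; apply.
  apply: ler_sum => j _.
  by rewrite andbT mulrA.
rewrite Ex_sum; last by move=> j _; exact: bmeasZ.
rewrite mulr_sumr; apply: ler_sum => j _.
rewrite ExZ// mulrA ler_wpM2l//.
exact: (regime_dom Hr).
Qed.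

(** Domination by [xihat] makes the squared truncated jumps uniformly integrable, so a length [L]
    independent of [y] already captures nearly all of [b]. *)
Lemma core_variance e : 0 < e -> exists2 L, 0 < L &
  evS S (fun y => forall r, L <= r -> b - e <=
    Ex (K y) (fun z => (`|z - y| <= r)%R%:R * ((z - y) ^+ 2 * (small s y z)%:R))).
Proof.
move=> e0; have e2 : 0 < e / 2 by lra.
have e4 : 0 < e / 4 by lra.
have [I HI] := regime_T_sum Hr e4.
(* [variance_tail] controls jumps longer than twice its first level; the added 1 only makes the
   length positive. *)
exists (2 * I%:R + 1); first by rewrite ltr_wpDl// mulr_ge0.
have [A A0 HA] := regime_m2 Hr e2.
exists A => // y Ay Sy r Lr; have y0 := lt_le_trans A0 Ay.
have := HA y Ay Sy => /ler_normlP[h1 h2].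
have := @variance_tail y I (Num.truncn (s y)).+1 Sy (ltW y0) (ltW (truncnS_gt _)).
have := HI (Num.truncn (s y)).+1.
set far := Ex _ _ => h3 h4.
have bc u (c : R -> bool) : measurable_fun setT c ->
    bmeas (fun z => (c z)%:R * ((z - u) ^+ 2 * (small s u z)%:R)).
  by move=> mc; apply: bmeasM; [exact: bmeas_bool|exact: bmeas_jump_pow].
have b1 : bmeas (fun z => (`|z - y| <= r)%R%:R * ((z - y) ^+ 2 * (small s y z)%:R)).
  by apply: bc; apply: measurable_fun_ler => //; exact: measurable_dist.
have b2 : bmeas (fun z => (2 * I%:R < `|z - y|)%R%:R * ((z - y) ^+ 2 * (small s y z)%:R)).
  by apply: bc; apply: measurable_fun_ltr => //; exact: measurable_dist.
suff : tmom K s 2 y <=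
    Ex (K y) (fun z => (`|z - y| <= r)%R%:R * ((z - y) ^+ 2 * (small s y z)%:R)) + far.
  by set near := Ex _ _; lra.
rewrite /far -ExD//; apply: le_Ex => //; first exact: bmeas_jump_pow.
  exact: bmeasD.
move=> z; rewrite -mulrDl.
have q0 : 0 <= (z - y) ^+ 2 * (small s y z)%:R by rewrite mulr_ge0// sqr_ge0.
apply: ler_peMl => //.
case: (leP `|z - y| r) => zr /=; first by rewrite lerDl.
by rewrite (_ : (_ < _)) ?add0r//; lra.
Qed.

Lemma core_mem x y z r (t : R) : 0 < r -> 0 < t * r -> x < y -> y <= x + r ->
  `|z - y| <= t * r ->
  (x - t * r <= y <= x + r + t * r) && (x - t * r <= z <= x + r + t * r).
Proof. by move=> ? ? ? ? /ler_normlP[? ?]; apply/andP; split; apply/andP; split; lra. Qed.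

Lemma half_pos y z : 0 < y -> `|z - y| <= y / 2 -> 0 < z.
Proof. by move=> ? /ler_normlP[? ?]; lra. Qed.

(** From a point of [(x, x + r]], jumps shorter than the margin [t * r] stay in the core and gain
    half their square; by [core_variance] they carry at least [b / (1 + t)] of the second moment.
    The exponent is below [a0], so the power part has nonnegative drift and is discarded. *)
Lemma test_fun_drift (t : R) (a0 := 2 * mu / b - 1) : 0 < t ->
  exists A L : R, [/\ 0 < A, 0 < L & forall x r, A <= x - t * r -> 0 < r -> L <= t * r ->
  forall y, S y -> x - t * r < y ->
  let f := test_fun (x - t * r) (x + r + t * r) (a0 / (1 + t)) in
  let sup := test_sup (x - t * r) (x + r + t * r) (a0 / (1 + t)) in
  (x < y <= x + r)%R%:R <=
  2 / b * (1 + t) * (Ex (K y) f - f y + sup * (p y / y))].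
Proof.
move=> t0; have b0 := regime_b Hr; have a00 := index_gt0 Hr.
have t1 : 0 < 1 + t by rewrite addr_gt0.
pose a := a0 / (1 + t); have a_gt0 : 0 < a by rewrite divr_gt0.
have aa0 : a < a0 by rewrite ltr_pdivrMr// mulrDr mulr1 ltrDl mulr_gt0.
have ka : 0 < 1 * (a0 - a) by rewrite mul1r subr_gt0.
have [c [eta [eta0 [A1 A10 HA1]]]] := drift_scale Hr a_gt0 ka.
have be0 : 0 < b - b / (1 + t).
  by rewrite subr_gt0 ltr_pdivrMr// mulrDr mulr1 ltrDl mulr_gt0.
have [L1 L10 [A3 A30 HA3]] := core_variance be0.
exists (A1 + A3), L1; split => //; first by rewrite addr_gt0.
move=> x r Ax r0 trL y Sy x0y /=.
have tr0 : 0 < t * r by rewrite mulr_gt0.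
set x0 := x - t * r in Ax x0y *; set e1 := x + r + t * r.
set f := test_fun _ _ _; set sup := test_sup _ _ _.
have yA1 : A1 <= y.
  by apply/ltW/(le_lt_trans _ x0y); apply: le_trans Ax; rewrite lerDl ltW.
have yA3 : A3 <= y.
  by apply/ltW/(le_lt_trans _ x0y); apply: le_trans Ax; rewrite lerDr ltW.
have x0_gt0 : 0 < x0 by apply: lt_le_trans Ax; rewrite addr_gt0.
have y0 : 0 < y := lt_le_trans A10 yA1.
have x0e : x0 < e1.
  by rewrite /x0 /e1 -addrA ltrD2l (lt_trans (_ : _ < 0)) ?oppr_lt0// addr_gt0.
have f0 z : 0 <= f z by exact: test_fun_ge0.
have fsup z : f z <= sup by exact: test_fun_le_sup.
have bf : bmeas f.
  apply: (@bmeas_homo _ _ sup); first exact: test_fun_homo.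
  by move=> z; rewrite ger0_norm.
pose kk := 2 / b * (1 + t); have kk0 : 0 < kk by rewrite mulr_gt0// divr_gt0.
pose phi : R := (x < y <= x + r)%R%:R.
have [hs hd ht] := HA1 y yA1 Sy.
pose g z : R := phi / 2 * ((`|z - y| <= t * r)%R%:R * (z - y) ^+ 2).
have mc : measurable_fun setT (fun z : R => `|z - y| <= t * r).
  by apply: measurable_fun_ler => //; exact: measurable_dist.
have bg : bmeas g.
  apply: bmeasZ; split.
    apply: measurable_funM; first by case: (bmeas_bool R mc).
    by apply: measurable_funX; exact: measurable_funB.
  exists ((t * r) ^+ 2) => z; case: (leP `|z - y| (t * r)) => zy; last first.
    by rewrite mul0r normr0 sqr_ge0.
  by rewrite mul1r normrX lerXn2r ?nnegrE// ltW.
have := @Ex_lower R K s y f (test_weight x0 e1 a y * y `^ (- a - 2))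
   (a * y) c g bf bg f0 _.
have pt z : small s y z ->
  test_weight x0 e1 a y * y `^ (- a - 2) * (a * y * (z - y) - c * (z - y) ^+ 2)
    + g z <= f z - f y.
  move=> yz; have z0 := half_pos y0 (hs z yz).
  have := test_fun_sub x0_gt0 x0e a_gt0 y0 z0; apply: le_trans; apply: lerD.
    rewrite -mulrA ler_wpM2l ?test_weight_ge0//.
    by have := ht z yz; rewrite mul1r subr_ge0.
  rewrite /g /phi; case: (leP `|z - y| (t * r)) => zy; last first.
    by rewrite mul0r mulr0 mulr_ge0// divr_ge0// sqr_ge0.
  case: (boolP (x < y <= x + r)) => [/andP[xy yxr]|_]; last first.
    by rewrite mul0r mul0r mulr_ge0// divr_ge0// sqr_ge0.
  by rewrite (core_mem r0 tr0 xy yxr zy) !mul1r mulrC.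
move=> /(_ pt) H.
have Eg : phi / kk <= Ex (K y) (fun z => g z * (small s y z)%:R).
  have := HA3 y yA3 Sy (t * r) trL.
  have -> : b - (b - b / (1 + t)) = b / (1 + t) by ring.
  have -> : Ex (K y) (fun z => g z * (small s y z)%:R) = phi / 2 *
     Ex (K y) (fun z => (`|z - y| <= t * r)%R%:R * ((z - y) ^+ 2 * (small s y z)%:R)).
    rewrite -ExZ; last by apply: bmeasM; [exact: bmeas_bool|exact: bmeas_jump_pow].
    by congr Ex; apply/funext => z; rewrite /g; ring.
  have -> : phi / kk = phi / 2 * (b / (1 + t)).
    by rewrite /kk; field; rewrite !gt_eqF.
  by move=> h; rewrite ler_wpM2l// /phi mulr_ge0.
have W0 : 0 <= test_weight x0 e1 a y * y `^ (- a - 2) *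
    (a * y * tmom K s 1 y - c * tmom K s 2 y).
  apply: mulr_ge0; first by rewrite mulr_ge0 ?test_weight_ge0 ?powR_ge0.
  by move: hd; rewrite mul1r; apply: le_trans; exact: ltW.
have pb := regime_big Hr Sy y0; have pb0 := pbig_ge0 K s y.
have fp : f y * pbig K s y <= sup * (p y / y) by apply: ler_pM.
rewrite -ler_pdivrMl// mulrC; move: H Eg W0 fp.
rewrite -/phi -/kk; set w := _ * (_ - _); set eg := Ex _ _; set fy := _ * pbig _ _ _.
set ef := Ex _ _; set q := sup * _; set ph := phi / kk.
by clear; lra.
Qed.

End core_variance.

(** * Upper bound on the occupation of a window *)

Section upper_bound.
Variables (R : realType) (d : measure_display) (T : measurableType d).
Variables (Pr : probability T R) (S : set R) (K : R -> probability R R).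
Variable X : nat -> {RV Pr >-> R}.
Hypothesis measurable_K :
  forall B, measurable B -> measurable_fun setT (fun x => K x B).
Hypothesis XS : forall n w, S (X n w).
Hypothesis markovX : forall n (A : set T) (B : set R),
  history X n A -> measurable B ->
  (Pr (A `&` X n.+1 @^-1` B) = \int[Pr]_(w in A) K (X n w) B)%E.
Variables (s p : R -> R) (b mu : R) (Tl : nat -> R).
Hypothesis Hr : regime S K s p b mu Tl.
Implicit Types (x y z r e t : R).

(** The left side collects the losses of [occ_upper] (margins, exponent, Lyapunov term) and tends to
    [a0^-1] with [t]. The numerical constants in the proof are crude majorants for [t <= 1 / 4]. *)
Lemma small_parameter a0 e : 0 < a0 -> 0 < e -> exists2 t, 0 < t <= 1 / 4 &
  (1 + t) ^+ 2 * (1 + 2 * t) *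
    ((1 + 2 * t) * t / 2 + (1 + t * (1 + t)) * ((1 + t) / a0)) <= a0^-1 + e.
Proof.
move=> ha he; set i := a0^-1; have i0 : 0 < i by rewrite invr_gt0.
have D0 : 0 < 18 + 71 * i by lra.
pose t := Num.min (1 / 4) (e / (18 + 71 * i)).
have t0 : 0 < t by rewrite lt_min !divr_gt0.
have t4 : t <= 1 / 4 by rewrite ge_min lexx.
have te : t * (18 + 71 * i) <= e by rewrite -ler_pdivlMr// ge_min lexx orbT.
exists t; first by rewrite t0.
have tt : t ^+ 2 <= t / 4 by rewrite expr2; nra.
have t2 : 0 <= t ^+ 2 by rewrite sqr_ge0.
have h1 : (1 + t) ^+ 2 * (1 + 2 * t) <= 1 + 11 * t.
  have -> : (1 + t) ^+ 2 * (1 + 2 * t) = 1 + 4 * t + 5 * t ^+ 2 + 2 * t * t ^+ 2 by ring.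
  have : 2 * t * t ^+ 2 <= t ^+ 2 by nra.
  lra.
have h2 : (1 + 2 * t) * t / 2 <= 3 * t / 2 by nra.
have h3 : (1 + t * (1 + t)) * (1 + t) <= 1 + 5 * t.
  have -> : (1 + t * (1 + t)) * (1 + t) = 1 + 2 * t + 2 * t ^+ 2 + t * t ^+ 2 by ring.
  have : t * t ^+ 2 <= t ^+ 2 by nra.
  lra.
apply: (@le_trans _ _ ((1 + 11 * t) * (3 * t / 2 + (1 + 5 * t) * i))).
  have hh : 0 <= (1 + t * (1 + t)) * (1 + t) * i.
    by rewrite !mulr_ge0// ?addr_ge0 ?mulr_ge0 ?addr_ge0// ltW.
  apply: ler_pM => //.
  - by rewrite mulr_ge0 ?sqr_ge0//; lra.
  - apply: addr_ge0; first by apply: divr_ge0 => //; apply: mulr_ge0; lra.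
    by move: hh; rewrite -mulrA.
  - by apply: lerD => //; rewrite mulrA ler_pM2r.
have : t * t * i <= t * i by rewrite ler_pM2r//; lra.
nra.
Qed.

Lemma core_start x r t B : 0 < t -> t <= 1 / 4 -> 0 < x -> r <= t * x ->
  2 * B <= x -> B <= x - t * r.
Proof.
move=> t0 t4 x0 rx Bx.
have : t * r <= t * (t * x) by rewrite ler_pM2l.
have : t * (t * x) <= 1 / 16 * x by rewrite mulrA ler_pM2r//; nra.
lra.
Qed.

(** The error [sup * (p y / y)] of the test function is exactly what [sup] times the Lyapunov
    function returns, and as the latter is at most [t] the total bound grows only by the factor
    [1 + t]. Left of the core the test function and the indicator both vanish at the starting point,
    and the submartingale property suffices. *)
Lemma occ_upper e : 0 < e -> exists A L dl : R, [/\ 0 < A, 0 < L, 0 < dl &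
  forall x r N, A <= x -> L <= r -> r <= dl * x ->
    occ X N (fun z => (x < z <= x + r)%R%:R) <= (2 / (2 * mu - b) + e) * (x * r)].
Proof.
move=> e0; have b0 := regime_b Hr; have hmu := regime_mu Hr.
have := index_gt0 Hr; set a0 := 2 * mu / b - 1 => a00.
have eb : 0 < e * b / 2 by rewrite divr_gt0// mulr_gt0.
have [t /andP[t0 t4] Ht] := small_parameter a00 eb.
have t1 : 0 < 1 + t by rewrite addr_gt0.
have [A1 [L1 [A10 L10 Hdrift]]] := test_fun_drift Hr t0.
have [A2 A20 [_ [U [bU U01 U0 _ [_ HU]]]]] := lyapunov_exists Hr 1 t0.
exists (2 * (A1 + A2)), (L1 / t), t.
split => //; [by rewrite mulr_gt0// !addr_gt0|by rewrite divr_gt0|].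
move=> x r N Ax Lr rx.
have x_gt0 : 0 < x by apply: lt_le_trans Ax; rewrite mulr_gt0// !addr_gt0.
have r0 : 0 < r by apply: lt_le_trans Lr; rewrite divr_gt0.
have tr0 : 0 < t * r by rewrite mulr_gt0.
have trL : L1 <= t * r by rewrite mulrC -ler_pdivrMr.
pose x0 := x - t * r; pose e1 := x + r + t * r.
have x0A : A1 + A2 <= x0 by exact: core_start.
have x0A1 : A1 <= x0 by apply: le_trans x0A; rewrite lerDl ltW.
have x0A2 : A2 <= x0 by apply: le_trans x0A; rewrite lerDr ltW.
have x0_gt0 : 0 < x0 by exact: lt_le_trans x0A1.
have x0e : x0 < e1.
  by rewrite /x0 /e1 -addrA ltrD2l (lt_trans (_ : _ < 0)) ?oppr_lt0// addr_gt0.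
pose a := a0 / (1 + t); have a_gt0 : 0 < a by rewrite divr_gt0.
pose f := test_fun x0 e1 a; pose sup := test_sup x0 e1 a.
have f0 z : 0 <= f z by exact: test_fun_ge0.
have fsup z : f z <= sup by exact: test_fun_le_sup.
have bf : bmeas f.
  apply: (@bmeas_homo _ _ sup); first exact: test_fun_homo.
  by move=> z; rewrite ger0_norm.
have sup0 : 0 <= sup := le_trans (f0 0) (fsup 0).
pose kk := 2 / b * (1 + t); have kk0 : 0 < kk by rewrite mulr_gt0// divr_gt0.
pose F z := kk * f z + kk * sup * U z.
pose phi z : R := (x < z <= x + r)%R%:R.
have bphi : bmeas phi by exact: bmeas_itv.
have bF : bmeas F by apply: bmeasD; exact: bmeasZ.
have kk0' := ltW kk0.
have ks0 : 0 <= kk * sup by exact: mulr_ge0.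
have EF y : Ex (K y) F = kk * Ex (K y) f + kk * sup * Ex (K y) U.
  by rewrite /F ExD ?ExZ//; exact: bmeasZ.
have H1 : occ X N phi <= kk * sup * (1 + t).
  apply: (occ_le measurable_K XS markovX N bF bphi).
    move=> y; have /andP[u0 u1] := U01 y; apply/andP; split.
      by apply: addr_ge0; exact: mulr_ge0.
    rewrite mulrDr mulr1; apply: lerD; first by rewrite ler_pM2l.
    exact: ler_wpM2l.
  move=> y Sy; rewrite EF /F.
  case: (leP y x0) => yx0.
    have -> : phi y = 0.
      by rewrite /phi ltNge (le_trans yx0)// lerBlDr lerDl ltW.
    have -> : f y = 0 by exact: test_fun0.
    rewrite mulr0 add0r addr0; apply: ler_wpDl.
      by apply: mulr_ge0 => //; exact: Ex_ge0.
    apply: ler_wpM2l => //; case: (leP y A2) => yA2.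
      by rewrite U0//; apply: Ex_ge0 => z; case/andP: (U01 z).
    have y0 := lt_trans A20 yA2.
    apply: le_trans (HU y Sy yA2); rewrite lerDl; apply: divr_ge0; last exact: ltW.
    exact/ltW/(regime_p0 Hr).
  have := Hdrift x r x0A1 r0 trL y Sy yx0.
  have := ler_wpM2l ks0 (HU y Sy (le_lt_trans x0A2 yx0)).
  rewrite -/x0 -/e1 -/a -/f -/sup -/kk -/(phi y) /=.
  set Q := p y / y; set EU := Ex _ U; set Ef := Ex _ f => h1 h2.
  move: h1 h2; move: (f y) (U y) (phi y) (kk) (sup) Q EU Ef => *; lra.
apply: (le_trans H1).
have b2 : 0 < 2 * mu - b by lra.
have Esup : sup <= r * x * ((1 + 2 * t) * ((1 + 2 * t) * t / 2 +
     (1 + t * (1 + t)) * ((1 + t) / a0))).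
  have -> : sup = (r * (1 + 2 * t)) ^+ 2 / 2 + r * (1 + 2 * t) * e1 * ((1 + t) / a0).
    rewrite /sup /test_sup /a /x0 /e1; field; rewrite !gt_eqF//.
  rewrite (mulrDr (1 + 2 * t)) (mulrDr (r * x)); apply: lerD.
    have -> : (r * (1 + 2 * t)) ^+ 2 / 2 = (1 + 2 * t) ^+ 2 / 2 * r * r by ring.
    have -> : r * x * ((1 + 2 * t) * ((1 + 2 * t) * t / 2)) =
              (1 + 2 * t) ^+ 2 / 2 * r * (t * x) by ring.
    by rewrite ler_wpM2l// mulr_ge0 ?(ltW r0)// divr_ge0// sqr_ge0.
  have -> : r * x * ((1 + 2 * t) * ((1 + t * (1 + t)) * ((1 + t) / a0))) =
     r * (1 + 2 * t) * (x * (1 + t * (1 + t))) * ((1 + t) / a0) by ring.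
  apply: ler_wpM2r; first by apply: divr_ge0; exact: ltW.
  apply: ler_wpM2l; first by apply: mulr_ge0; [exact: ltW|lra].
  have : r * (1 + t) <= t * x * (1 + t) by rewrite ler_pM2r.
  rewrite /e1; lra.
have := ler_wpM2l (_ : 0 <= kk * (1 + t)) Esup.
rewrite mulr_ge0 ?(ltW kk0) ?(ltW t1)// => /(_ isT) => H2.
have -> : kk * sup * (1 + t) = kk * (1 + t) * sup by ring.
apply: (le_trans H2).
have E0 : 2 / (2 * mu - b) = 2 / b * a0^-1.
  by rewrite /a0; field; rewrite !gt_eqF//; lra.
rewrite E0.
have := ler_wpM2l (_ : 0 <= 2 / b * (r * x)) Ht.
rewrite !mulr_ge0 ?invr_ge0 ?(ltW b0) ?(ltW r0) ?(ltW x_gt0)// => /(_ isT) => H3.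
have -> : (2 / b * a0^-1 + e) * (x * r) = 2 / b * (r * x) * (a0^-1 + e * b / 2).
  by field; rewrite !gt_eqF.
by apply: le_trans H3; rewrite /kk; lra.
Qed.

End upper_bound.

(** * Escape to infinity and rare jumps from bounded states *)

Section transience.
Variables (R : realType) (d : measure_display) (T : measurableType d).
Variables (Pr : probability T R) (S : set R) (K : R -> probability R R).
Variable X : nat -> {RV Pr >-> R}.
Hypothesis measurable_K :
  forall B, measurable B -> measurable_fun setT (fun x => K x B).
Hypothesis XS : forall n w, S (X n w).
Hypothesis markovX : forall n (A : set T) (B : set R),
  history X n A -> measurable B ->
  (Pr (A `&` X n.+1 @^-1` B) = \int[Pr]_(w in A) K (X n w) B)%E.
Variables (s p : R -> R) (b mu : R) (Tl : nat -> R).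
Hypothesis Hr : regime S K s p b mu Tl.
Implicit Types (x y z e M A B : R) (n N : nat).

Lemma bmeas_gt x : bmeas (fun z : R => (x < z)%R%:R : R).
Proof. by apply: bmeas_bool; apply: measurable_fun_ltr. Qed.

Lemma bmeas_le x : bmeas (fun z : R => (z <= x)%R%:R : R).
Proof. by apply: bmeas_bool; apply: measurable_fun_ler. Qed.

Lemma rv_tail n e : 0 < e ->
  exists x1, forall x, x1 <= x -> EX X n (fun z => (x < z)%R%:R) <= e.
Proof.
move=> e0.
pose D (k : nat) := X n @^-1` `]k%:R, +oo[%classic.
have mD k : measurable (D k) by exact: measurable_funPTI.
have D0 : \bigcap_k D k = set0.
  apply/seteqP; split=> // w /(_ (Num.truncn (X n w)).+1 I).
  by rewrite /D/= in_itv/= andbT ltNge (ltW (truncnS_gt _)).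
have : Pr (D k) @[k --> \oo] --> Pr (\bigcap_k D k).
  apply: nonincreasing_cvg_mu => //.
  - by rewrite (le_lt_trans (probability_le1 Pr _))// ltry.
  - by rewrite D0.
  - move=> i j ij; apply/subsetPset => w; rewrite /D/= !in_itv/= !andbT.
    by apply: le_lt_trans; rewrite ler_nat.
rewrite D0 measure0 => /fine_cvg /cvgrPdist_le /(_ _ e0)[k _ /(_ k (leqnn k))] /=.
rewrite sub0r normrN ger0_norm ?fine_ge0// => Dk.
exists k%:R => x kx; apply: le_trans Dk.
rewrite -Ex_indic//; apply: le_Ex.
- exact: (bmeas_comp_RV X n (bmeas_gt x)).
- exact: bmeas_indic.
- move=> w; rewrite indicE; case: ltP => // xw.
  by rewrite mem_set ?lexx// /D/= in_itv/= andbT (le_lt_trans kx).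
Qed.

Fixpoint passed M N : set T := X N @^-1` `]M, +oo[%classic `|`
  (if N is N'.+1 then passed M N' else set0).

Lemma history_passed M N m : (N <= m)%N -> history X m (passed M N).
Proof.
elim: N m => [|N IH] m Nm /=.
  rewrite setU0; apply: sub_sigma_algebra; exists 0%N => //.
  by exists `]M, +oo[%classic => //; rewrite setTI.
apply: (@measurableU _ (g_sigma_algebraType _)); last by apply: IH; exact: ltnW.
apply: sub_sigma_algebra; exists N.+1 => //.
by exists `]M, +oo[%classic => //; rewrite setTI.
Qed.

Lemma passed_sub M N N' : (N <= N')%N -> passed M N `<=` passed M N'.
Proof.
move=> /subnKC <-; elim: (_ - _)%N => [|k IH]; rewrite ?addn0// addnS.
by move=> w /IH ?; right.
Qed.

(* A nondecreasing submartingale function dominates its value at [M] on the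
   event that the chain has already passed [M]. *)
Lemma submartingale_passed (U : R -> R) M N : bmeas U -> (forall y, 0 <= U y) ->
  {homo U : y z / y <= z} -> (forall y, S y -> U y <= Ex (K y) U) ->
  U M * fine (Pr (passed M N)) <= EX X N U.
Proof.
move=> bU U0 Uh HU.
have mp n : measurable (passed M n).
  exact: (history_measurable (history_passed M (leqnn n))).
have bp n : bmeas (\1_(passed M n) : T -> R) by exact: bmeas_indic.
have bUX n := bmeas_comp_RV X n bU.
have H n : U M * Ex Pr \1_(passed M n) <= Ex Pr (fun w => \1_(passed M n) w * U (X n w)).
  elim: n => [|n IH].
    rewrite -ExZ//; apply: le_Ex; [exact: bmeasZ|exact: bmeasM|].
    move=> w; rewrite indicE; case: (boolP (w \in _)); last by rewrite mul0r mulr0.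
    rewrite inE mul1r mulr1 => -[|//]; rewrite /= in_itv/= andbT => Mw.
    by apply: Uh; exact: ltW.
  have := markov_bmeas measurable_K markovX bU => -[_ /(_ n _ (history_passed M (leqnn n)))] E.
  have step : Ex Pr (fun w => \1_(passed M n) w * U (X n w)) <=
              Ex Pr (fun w => \1_(passed M n) w * U (X n.+1 w)).
    rewrite E; apply: le_Ex; [exact: bmeasM| |].
      apply: bmeasM => //; apply: (@bmeas_comp_RV _ _ _ _ X n (fun y => Ex (K y) U)).
      exact: (bmeas_ExK measurable_K markovX bU).
    by move=> w; apply: ler_wpM2l; [rewrite indicE|exact: HU].
  have dp : U M * (Ex Pr \1_(passed M n.+1) - Ex Pr \1_(passed M n)) <=
     Ex Pr (fun w => \1_(passed M n.+1) w * U (X n.+1 w)) -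
     Ex Pr (fun w => \1_(passed M n) w * U (X n.+1 w)).
    rewrite -!ExB//; [|exact: bmeasM|exact: bmeasM].
    rewrite -ExZ; last exact: bmeasB.
    apply: le_Ex; [by apply: bmeasZ; exact: bmeasB|by apply: bmeasB; exact: bmeasM|].
    move=> w; rewrite -mulrBl !indicE.
    case: (boolP (w \in passed M n)) => [|wn].
      by rewrite !inE => wn; rewrite mem_set ?subrr ?mulr0 ?mul0r//; right.
    rewrite subr0; case: (boolP (w \in passed M n.+1)); last by rewrite mul0r mulr0.
    rewrite inE /= => -[|/mem_set]; last by rewrite (negbTE wn).
    by rewrite in_itv/= andbT mulr1 mul1r => Mw; apply: Uh; exact: ltW.
  move: dp step IH; rewrite mulrBr.
  set v1 := Ex _ _; set v2 := U M * v1; set v3 := Ex _ _; set v4 := U M * v3.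
  lra.
rewrite -Ex_indic//; apply: (le_trans (H N)).
apply: le_Ex => //; first exact: bmeasM.
by move=> w; rewrite indicE ler_piMl// lern1 leq_b1.
Qed.

Lemma lyapunov_submartingale (U : R -> R) A : 0 < A -> (forall y, 0 <= U y) ->
  (forall y, y <= A -> U y = 0) ->
  (forall y, S y -> A < y -> U y + p y / y <= Ex (K y) U) ->
  forall y, S y -> U y <= Ex (K y) U.
Proof.
move=> A0 U0 UA HU y Sy; case: (leP y A) => yA; first by rewrite UA//; exact: Ex_ge0.
have y0 := lt_trans A0 yA.
apply: le_trans (HU y Sy yA); rewrite lerDl; apply: divr_ge0; last exact: ltW.
exact/ltW/(regime_p0 Hr).
Qed.

(** Once the chain has very likely passed a level where [U] is close to its supremum, the mean of
    [U] stays close to that supremum. Each state below [B] falls short of it by at least a fixed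
    gap, so such states have small probability at all later times. *)
Lemma transient (unbounded : forall M e, 0 < e ->
    exists N, 1 - e <= fine (Pr (passed M N))) B e : 0 < e ->
  exists N0, forall N, (N0 <= N)%N -> EX X N (fun z => (z <= B)%R%:R) <= e.
Proof.
move=> e0.
have [A A0 [BA [U [bU U01 UA Uh [Ult HU]]]]] := lyapunov_exists Hr B (@ltr01 R).
have U0 y : 0 <= U y by case/andP: (U01 y).
have U1 y : U y <= 1 by case/andP: (U01 y).
have hs : has_sup (range U).
  by split; [exists (U 0), 0|exists 1 => _ [y _ <-]].
set u := sup (range U).
have Uu y : U y <= u by apply: ub_le_sup; [exact: hs.2|exists y].
have u1 : u <= 1.
  by apply: ge_sup; [exact: hs.1|move=> _ [y _ <-]].
(* [U] increases strictly only beyond [A], which is at least [B]; a positive gap needs a point past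
   [A]. *)
pose B' := A + 1.
have gap0 : 0 < u - U B'.
  rewrite subr_gt0 (lt_le_trans _ (Uu (B' + 1)))// Ult//; rewrite /B'; lra.
set gap := u - U B' in gap0.
have eta0 : 0 < gap * e / 2 by rewrite divr_gt0// mulr_gt0.
have [_ [M _ <-] UM] := sup_adherent eta0 hs.
have [N0 HN0] := unbounded M _ eta0.
exists N0 => N NN.
have := submartingale_passed M N bU U0 Uh (lyapunov_submartingale A0 U0 UA HU).
have PN : 1 - gap * e / 2 <= fine (Pr (passed M N)).
  apply: (le_trans HN0).
  have mp n : measurable (passed M n).
    exact: (history_measurable (history_passed M (leqnn n))).
  by rewrite fine_le ?fin_num_measure// le_measure ?inE//; exact: passed_sub.
have H2 : EX X N U + gap * EX X N (fun z => (z <= B)%R%:R) <= u.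
  have bB := bmeas_le B.
  rewrite -EX_Z// -EX_D//; last exact: bmeasZ.
  apply: Ex_le.
    by apply: (@bmeas_comp_RV _ _ _ _ X N (fun y => U y + gap * (y <= B)%R%:R));
      apply: bmeasD => //; exact: bmeasZ.
  move=> w; case: (leP (X N w) B) => wB; last by rewrite mulr0 addr0.
  have : U (X N w) <= U B' by apply: Uh; rewrite /B'; lra.
  by rewrite mulr1 /gap addrCA gerDl subr_le0.
move=> H1; have : gap * EX X N (fun z => (z <= B)%R%:R) <= gap * e.
  move: H1 H2 PN UM eta0; rewrite -/u; set q := gap * e / 2.
  have -> : gap * e = 2 * q by rewrite /q; field.
  set v := gap * _; set P := fine _ => H1 H2 PN UM q0.
  have : U M * (1 - P) <= U M * q by rewrite ler_wpM2l//; lra.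
  have : U M * q <= q by rewrite ler_piMl// ltW.
  lra.
by rewrite ler_pM2l.
Qed.

(** Below [A] nothing is known about the drift. A jump from there above a fixed [B] raises the
    bounded submartingale function from 0 to at least [U B], so the expected number of such jumps is
    finite. Late times are then negligible uniformly in [x], and the finitely many early ones are
    handled by letting [x] grow. *)
Lemma upcross A e : 0 < e -> exists x1, forall x N, x1 <= x ->
  occ X N (fun y => (y <= A)%R%:R * Ex (K y) (fun z => (x < z)%R%:R)) <= e.
Proof.
move=> e0.
have [A2 A20 [AA [U [bU U01 UA Uh [Ult HU]]]]] := lyapunov_exists Hr A (@ltr01 R).
have U0 y : 0 <= U y by case/andP: (U01 y).
pose B := A2 + 2.
have UB : 0 < U B by apply: (@le_lt_trans _ _ (U (A2 + 1))) => //; apply: Ult; rewrite /B; lra.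
pose phi x y := (y <= A)%R%:R * Ex (K y) (fun z : R => (x < z)%R%:R).
have bE x : bmeas (fun y => Ex (K y) (fun z : R => (x < z)%R%:R)).
  by apply: (bmeas_ExK measurable_K markovX); exact: bmeas_gt.
have bphi x : bmeas (phi x) by apply: bmeasM; [exact: bmeas_le|exact: bE].
have phi0 x y : 0 <= phi x y by rewrite mulr_ge0//; exact: Ex_ge0.
have HB N : occ X N (phi B) <= (U B)^-1.
  rewrite -[leRHS]mul1r ler_pdivlMr// mulrC -occ_Z//.
  apply: (occ_le measurable_K XS markovX N bU _ U01); first exact: bmeasZ.
  move=> y Sy; have HUy := lyapunov_submartingale A20 U0 UA HU Sy.
  rewrite /phi; case: (leP y A) => yA; last by rewrite mul0r mulr0 addr0.
  rewrite UA ?(le_trans yA)// add0r mul1r -ExZ; last exact: bmeas_gt.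
  apply: le_Ex => //; first by apply: bmeasZ; exact: bmeas_gt.
  move=> z; case: (ltP B z) => Bz; last by rewrite mulr0.
  by rewrite mulr1; apply: Uh; exact: ltW.
have e2 : 0 < e / 2 by rewrite divr_gt0.
have g0 n : 0 <= EX X n (phi B) by apply: Ex_ge0.
have [I HI] := bounded_tail_small g0 HB e2.
have eI : 0 < e / 2 / I.+1%:R by rewrite divr_gt0.
have small_x n : exists x1, forall x, x1 <= x -> EX X n (phi x) <= e / 2 / I.+1%:R.
  have [x1 Hx1] := rv_tail n.+1 eI; exists x1 => x xx1; apply: le_trans (Hx1 x xx1).
  rewrite (EX_S measurable_K markovX); last exact: bmeas_gt.
  apply: (le_EX XS) => // y Sy; rewrite /phi ler_piMl//; first exact: Ex_ge0.
  by rewrite lern1 leq_b1.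
set eps := e / 2 / I.+1%:R in eI small_x.
have [x1 Hx1] : exists x1, forall x n, (n < I)%N -> x1 <= x -> EX X n (phi x) <= eps.
  clear - small_x; elim: (I) => [|m [x1 Hx1]]; first by exists 0.
  have [x2 Hx2] := small_x m; exists (Num.max x1 x2) => x n.
  rewrite ge_max ltnS leq_eqVlt => /orP[/eqP ->|nm] /andP[? ?]; first exact: Hx2.
  exact: Hx1.
exists (Num.max x1 B) => x N; rewrite ge_max => /andP[xx1 xB].
apply: (@le_trans _ _ (\sum_(n < I + N) EX X n (phi x))).
  rewrite /occ addnC big_split_ord/= lerDl sumr_ge0// => n _; exact: Ex_ge0.
rewrite -(big_mkord xpredT (fun n => EX X n (phi x))) (@big_cat_nat _ _ _ I)//= ?leq_addr//.
have -> : e = e / 2 + e / 2 by field.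
apply: lerD; last first.
  apply: le_trans (HI (I + N)%N); apply: ler_sum => n _; apply: (le_EX XS) => // y Sy.
  rewrite /phi ler_wpM2l//; apply: le_Ex; [exact: bmeas_gt|exact: bmeas_gt|].
  by move=> z; case: (ltP x z) => // xz; rewrite (le_lt_trans xB).
rewrite big_mkord; apply: (@le_trans _ _ (\sum_(i < I) eps)).
  by apply: ler_sum => n _; exact: Hx1.
rewrite sumr_const card_ord -[eps *+ I]mulr_natr /eps -(mulrA (e / 2)).
by rewrite ler_piMr ?(ltW e2)// ler_pdivrMl// mulr1 ler_nat.
Qed.

End transience.

(** * Drift of the test function from above, according to the starting point *)

Section lower_drift.
Variables (R : realType) (S : set R) (K : R -> probability R R).
Variables (s p : R -> R) (b mu : R) (Tl : nat -> R).
Hypothesis Hr : regime S K s p b mu Tl.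
Implicit Types (x y z h u t a e : R) (I M : nat).

Definition excess u y z : R := Num.max 0 (`|z - y| - u) * (small s y z)%:R.

Lemma excess_ge0 u y z : 0 <= excess u y z.
Proof. by rewrite mulr_ge0// le_max lexx. Qed.

Lemma excess_small u y z : excess u y z * (small s y z)%:R = excess u y z.
Proof. by rewrite /excess; case: (small s y z); rewrite ?mulr1 ?mulr0. Qed.

Lemma bmeas_excess u y : bmeas (excess u y).
Proof.
apply: bmeas_cut.
  by apply: measurable_maxr => //; apply: measurable_funB => //; exact: measurable_dist.
exists (s y + `|u|) => z yz; rewrite ger0_norm ?le_max ?lexx// ge_max.
have su : 0 <= s y by apply: le_trans yz.
by rewrite addr_ge0//= lerD// -normrN ler_norm.
Qed.

(** The dependence on [u] is kept as indicators: when [u] is the distance from [y] to the core, each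
    is dominated by the indicator of a set of [y] of width [j + 1] adjacent to the core, whose
    occupation [occ_upper] controls. *)
Lemma excess_tail u y I M : S y -> 0 <= y -> s y <= M%:R -> I%:R <= u ->
  Ex (K y) (excess u y) <= \sum_(I <= j < M) Tl j * (u < j%:R + 1)%R%:R.
Proof.
move=> Sy y0 sM Iu; have bf j := bmeas_far s j%:R y.
apply: (@le_trans _ _ (Ex (K y) (fun z => \sum_(I <= j < M)
    (u < j%:R + 1)%R%:R * ((j%:R < `|z - y|) && small s y z)%:R))).
  apply: le_Ex; [exact: bmeas_excess|by apply: bmeas_sum => j _; exact: bmeasZ|].
  move=> z; rewrite /excess; case: (boolP (small s y z)) => yz; last first.
    by rewrite mulr0; apply: sumr_ge0 => j _; exact: mulr_ge0.
  rewrite mulr1 ge_max; apply/andP; split.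
    by apply: sumr_ge0 => j _; exact: mulr_ge0.
  apply: (le_trans (tail_lin Iu (le_trans yz sM))).
  by apply: ler_sum => j _; rewrite andbT mulrC.
rewrite Ex_sum; last by move=> j _; exact: bmeasZ.
apply: ler_sum => j _; rewrite ExZ// mulrC ler_wpM2r//.
exact: (regime_dom Hr).
Qed.

Lemma excess0 u y z : s y <= u -> excess u y z = 0.
Proof.
move=> su; rewrite /excess; case: (boolP (small s y z)) => yz; last by rewrite mulr0.
by rewrite mulr1 max_l// subr_le0 (le_trans yz).
Qed.

(** The test function vanishes at [y] and grows at slope at most [e - x0] past [x0], so the gain is
    that slope times the overshoot. *)
Lemma test_fun_drift_low x0 e a y I M : 0 < a -> 0 < x0 -> x0 < e ->
  S y -> 0 < y -> s y <= M%:R -> I%:R <= x0 - y ->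
  Ex (K y) (test_fun x0 e a) - test_fun x0 e a y <=
  (e - x0) * (\sum_(I <= j < M) Tl j * (x0 - y < j%:R + 1)%R%:R)
  + test_sup x0 e a * (p y / y).
Proof.
move=> a0 x00 x0e Sy y0 sM Iu; set f := test_fun x0 e a; set sup := test_sup x0 e a.
have l0 : 0 <= e - x0 by rewrite subr_ge0 ltW.
have f0 z : 0 <= f z by exact: test_fun_ge0.
have fsup z : f z <= sup by exact: test_fun_le_sup.
have bf : bmeas f.
  apply: (@bmeas_homo _ _ sup); first exact: test_fun_homo.
  by move=> z; rewrite ger0_norm.
have sup0 : 0 <= sup := le_trans (f0 0) (fsup 0).
have yx0 : y <= x0 by rewrite -subr_ge0 (le_trans _ Iu).
have be := bmeas_excess (x0 - y) y.
have pt z : small s y z -> f z - f y <=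
    0 * (0 * (z - y) - 0 * (z - y) ^+ 2) + (e - x0) * excess (x0 - y) y z.
  move=> yz; rewrite mul0r add0r {2}/f test_fun0// subr0.
  case: (leP z x0) => zx0; first by rewrite /f test_fun0// mulr_ge0// excess_ge0.
  have z0 := lt_trans x00 zx0.
  apply: (le_trans (test_fun_lip x00 x0e a0 z0 (ltW zx0))).
  rewrite ler_wpM2l// /excess yz mulr1 le_max; apply/orP; right.
  by have := ler_norm (z - y); lra.
have := @Ex_upper R K s y f 0 0 0 (fun z => (e - x0) * excess (x0 - y) y z) sup bf
   (bmeasZ _ be) fsup (f0 y) pt.
rewrite mul0r add0r => /le_trans; apply; apply: lerD; last first.
  by apply: ler_wpM2l => //; exact: (regime_big Hr).
have -> : (fun z => (e - x0) * excess (x0 - y) y z * (small s y z)%:R) =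
          (fun z => (e - x0) * excess (x0 - y) y z).
  by apply/funext => z; rewrite -mulrA excess_small.
by rewrite ExZ// ler_wpM2l//; apply: excess_tail => //; exact: ltW.
Qed.

Let a0 := 2 * mu / b - 1.

(** With [a > a0] the power part has nonpositive drift and only jumps landing below [e] count.
    Beyond [2 * x] truncated jumps, at most [y / 4] long, cannot return to [e]; hence the levels
    need only reach [s (2 * x)]. *)
Lemma test_fun_drift_high a : a0 < a -> exists2 A, 0 < A &
  forall x h t I M y, 0 < x -> 0 < t -> t < 1 / 2 -> 0 < h -> h <= x / 2 ->
  A <= y -> S y -> x + h < y -> s (2 * x) <= M%:R -> I%:R <= t * h ->
  let x0 := x + t * h in let e := x + h - t * h in
  Ex (K y) (test_fun x0 e a) - test_fun x0 e a y <=
  (e - x0) * 2 `^ (a + 1) * (\sum_(I <= j < M) Tl j * (y - e < j%:R + 1)%R%:R)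
  + test_sup x0 e a * (p y / y).
Proof.
move=> aa; have a_gt0 : 0 < a by apply: lt_trans aa; exact: (index_gt0 Hr).
have ka : 0 < (-1) * (a0 - a) by rewrite mulN1r oppr_gt0 subr_lt0.
have [c [eta [eta0 [A1 A10 HA1]]]] := drift_scale Hr a_gt0 ka.
have q4 : 0 < 1 / 4 :> R by rewrite divr_gt0.
have [A2 A20 HA2] := regime_s Hr q4.
exists (Num.max A1 A2); first by rewrite lt_max A10.
move=> x h t I M y x_gt0 t0 t2 h0 hx; rewrite ge_max => /andP[yA1 yA2] Sy xhy sM Ith /=.
set x0 := x + t * h; set e := x + h - t * h.
set f := test_fun _ _ _; set sup := test_sup _ _ _.
have th0 : 0 < t * h by rewrite mulr_gt0.
have th2 : t * h < h / 2 by rewrite mulrC ltr_pM2l// -[ltRHS]mul1r.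
have y0 := lt_le_trans A10 yA1.
have [x00 x0e ey] : [/\ 0 < x0, x0 < e & e < y].
  by rewrite /x0 /e; split; move: x_gt0 th0 th2 h0 xhy; move: (t * h) => *; lra.
have l0 : 0 <= e - x0 by rewrite subr_ge0 ltW.
have C0 : 0 <= (e - x0) * 2 `^ (a + 1) by rewrite mulr_ge0// powR_ge0.
have f0 z : 0 <= f z by exact: test_fun_ge0.
have fsup z : f z <= sup by exact: test_fun_le_sup.
have bf : bmeas f.
  apply: (@bmeas_homo _ _ sup); first exact: test_fun_homo.
  by move=> z; rewrite ger0_norm.
have sup0 : 0 <= sup := le_trans (f0 0) (fsup 0).
have [hs hd ht] := HA1 y yA1 Sy.
have be := bmeas_excess (y - e) y.
pose g z := (e - x0) * 2 `^ (a + 1) * excess (y - e) y z.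
have pt z : small s y z -> f z - f y <=
    test_weight x0 e a y * y `^ (- a - 2) * (a * y * (z - y) - c * (z - y) ^+ 2) + g z.
  move=> yz; have /ler_normlP[z1 z2] := hs z yz.
  have ez : e <= 2 * z by move: z1 ey; move: (e) => *; lra.
  apply: (le_trans (test_fun_super x00 x0e a_gt0 ey ez)); apply: lerD.
    rewrite -mulrA ler_wpM2l ?test_weight_ge0//.
    by have := ht z yz; rewrite mulN1r oppr_ge0 subr_le0.
  apply: ler_wpM2l => //; rewrite /excess yz mulr1 ge_max le_max lexx/=.
  rewrite le_max; apply/orP; right.
  by have := ler_norm (y - z); rewrite distrC; move: (`|z - y|) => *; lra.
have bg : bmeas g by exact: bmeasZ.
have := @Ex_upper R K s y f (test_weight x0 e a y * y `^ (- a - 2)) (a * y) c g sup bf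
   bg fsup (f0 y) pt.
move=> /le_trans; apply; apply: lerD; last first.
  by apply: ler_wpM2l => //; exact: (regime_big Hr).
rewrite -[leRHS]add0r; apply: lerD.
  have w0 : 0 <= test_weight x0 e a y * y `^ (- a - 2).
    by rewrite mulr_ge0 ?test_weight_ge0 ?powR_ge0.
  apply: mulr_ge0_le0 => //; rewrite -oppr_ge0 -mulN1r.
  by apply: le_trans hd; exact: ltW.
have -> : (fun z => g z * (small s y z)%:R) = g.
  by apply/funext => z; rewrite /g -mulrA excess_small.
rewrite /g ExZ// ler_wpM2l//.
have Iye : I%:R <= y - e.
  by apply: (le_trans Ith); move: xhy; rewrite /e; move: (t * h) => *; lra.
case: (leP y (2 * x)) => y2x.
  apply: excess_tail => //; first exact: ltW.
  by apply: le_trans sM; apply: (regime_s_homo Hr) => //; exact: ltW.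
have -> : excess (y - e) y = fun _ => 0.
  apply/funext => z; apply: excess0; apply: (le_trans (HA2 y yA2)).
  by move: y2x hx th0; rewrite /e; move: (t * h) => *; lra.
rewrite Ex_cst; apply: sumr_ge0 => j _; apply: mulr_ge0 => //.
exact: (regime_T0 Hr).
Qed.

Lemma test_fun_drift_mid a t : 0 < a -> 0 < t -> t < 1 / 2 ->
  exists A dl : R, [/\ 0 < A, 0 < dl &
  forall x h y, A <= x -> 0 < h -> h <= dl * x -> S y -> x < y ->
  let x0 := x + t * h in let e := x + h - t * h in
  Ex (K y) (test_fun x0 e a) - test_fun x0 e a y <=
  b / 2 * (1 + t) + test_sup x0 e a * (p y / y)].
Proof.
move=> a_gt0 t0 t2; have b0 := regime_b Hr.
have mu0 : 0 < mu by apply: lt_trans (regime_mu Hr); rewrite divr_gt0.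
have bt : 0 < b * t / 2 by rewrite divr_gt0// mulr_gt0.
have [A1 A10 HA1] := evS_and (regime_m1 Hr mu0) (regime_m2 Hr bt).
have h2 : 0 < 1 / 2 :> R by rewrite divr_gt0.
have [A2 A20 HA2] := regime_s Hr h2.
(* Slope times drift is then at most [dl * x * (2 * mu / x) = b * t / 4]; half the error [b * t / 2]
   of the second moment gives as much, and the sum is [b / 2 * t]. *)
pose dl := b * t / (8 * mu).
exists (Num.max A1 A2), dl; split; first by rewrite lt_max A10.
  by rewrite divr_gt0// mulr_gt0.
move=> x h y; rewrite ge_max => /andP[xA1 xA2] h0 hx Sy xy /=.
set x0 := x + t * h; set e := x + h - t * h.
set f := test_fun _ _ _; set sup := test_sup _ _ _.
have x_gt0 := lt_le_trans A10 xA1; have y0 := lt_trans x_gt0 xy.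
have th0 : 0 < t * h by rewrite mulr_gt0.
have th2 : t * h < h / 2 by rewrite mulrC ltr_pM2l// -[ltRHS]mul1r.
have [x00 x0e lh] : [/\ 0 < x0, x0 < e & e - x0 <= h].
  by rewrite /x0 /e; split; move: x_gt0 th0 th2 h0; move: (t * h) => *; lra.
have f0 z : 0 <= f z by exact: test_fun_ge0.
have fsup z : f z <= sup by exact: test_fun_le_sup.
have bf : bmeas f.
  apply: (@bmeas_homo _ _ sup); first exact: test_fun_homo.
  by move=> z; rewrite ger0_norm.
have sup0 : 0 <= sup := le_trans (f0 0) (fsup 0).
have [M1 M2] := HA1 y (le_trans xA1 (ltW xy)) Sy.
have [dy /andP[dy0 dyl] Hdy] := test_fun_taylor x00 x0e a_gt0 y0.
have pt z : small s y z -> f z - f y <=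
    1 * (dy * (z - y) - (- (1 / 2)) * (z - y) ^+ 2) + 0.
  move=> yz; have z0 : 0 < z.
    apply: (half_pos y0); apply: (le_trans yz).
    by have := HA2 y (le_trans xA2 (ltW xy)); move: (s y) => *; lra.
  by have := Hdy z z0; rewrite -/f; move: (f z) (f y) => *; lra.
have := @Ex_upper R K s y f 1 dy (- (1 / 2)) (fun _ => 0) sup bf (bmeas_cst _ _) fsup (f0 y) pt.
rewrite Ex_cut0 addr0 mul1r => /le_trans; apply; apply: lerD; last first.
  by apply: ler_wpM2l => //; exact: (regime_big Hr).
move: M1 M2 => /ler_normlP[_ M1] /ler_normlP[_ M2].
have m1 : tmom K s 1 y <= 2 * mu / y.
  by rewrite ler_pdivlMr// mulrC; move: M1; move: (y * _) => *; lra.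
have m1' : dy * tmom K s 1 y <= b * t / 4.
  case: (leP 0 (tmom K s 1 y)) => m10; last first.
    apply: (@le_trans _ _ 0); first by rewrite mulr_ge0_le0// ltW.
    by rewrite divr_ge0// ltW// mulr_gt0.
  apply: (@le_trans _ _ (dl * x * (2 * mu / x))).
    apply: ler_pM => //; first by rewrite (le_trans dyl)// (le_trans lh).
    apply: (le_trans m1); rewrite ler_pM2l ?mulr_gt0//.
    by rewrite lef_pV2 ?posrE//; exact: ltW.
  rewrite /dl le_eqVlt; apply/orP; left; apply/eqP.
  by field; rewrite !gt_eqF.
by move: M2 m1'; move: (tmom K s 2 y) (dy * _) => *; lra.
Qed.

End lower_drift.

(** * The three error terms gathered over all starting points *)

Section lower_generator.
Variables (R : realType) (S : set R) (K : R -> probability R R).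
Variables (s p : R -> R) (b mu : R) (Tl : nat -> R).
Hypothesis Hr : regime S K s p b mu Tl.
Implicit Types (x y z h u t a e : R) (I M : nat).

(** The losses of [occ_lower]: [1 - 2 * t] for the narrowed window, [a0 * (1 + t)] for the exponent,
    [5 * t] for the final, initial, Lyapunov and low-start terms, the subtracted [t] for overshoots,
    the last [1 + t] for the curvature bound. *)
Lemma lower_parameter a0 e : 0 < a0 -> 0 < e -> exists2 t, 0 < t <= 1 / 8 &
  a0^-1 - e <= ((1 - 5 * t) * ((1 - 2 * t) / (a0 * (1 + t))) - t) / (1 + t).
Proof.
move=> ha he; set i := a0^-1; have i0 : 0 < i by rewrite invr_gt0.
have D0 : 0 < 9 * i + 1 by lra.
pose t := Num.min (1 / 8) (e / (9 * i + 1)).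
have t0 : 0 < t by rewrite lt_min !divr_gt0.
have t8 : t <= 1 / 8 by rewrite ge_min lexx.
have te : t * (9 * i + 1) <= e by rewrite -ler_pdivlMr// ge_min lexx orbT.
exists t; first by rewrite t0.
have t1 : 0 < 1 + t by lra.
have inv1t : 1 - t <= (1 + t)^-1.
  by rewrite -[leRHS]mul1r ler_pdivlMr//; nra.
have invt1 : (1 + t)^-1 <= 1 by rewrite invf_le1//; lra.
have -> : (1 - 2 * t) / (a0 * (1 + t)) = (1 - 2 * t) * ((1 + t)^-1 * i).
  by rewrite /i; field; rewrite !gt_eqF.
move: inv1t invt1; set v := (1 + t)^-1 => v1 v2.
have q : (1 - 7 * t) * i <= (1 - 5 * t) * ((1 - 2 * t) * i) by nra.
have q1 : 0 <= (1 - 7 * t) * i by rewrite mulr_ge0//; lra.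
have h1 : (1 - t) * ((1 - 7 * t) * i) <= v * ((1 - 7 * t) * i) by exact: ler_wpM2r.
have v0 : 0 <= v by lra.
have h2 : (1 - 8 * t) * i <= (1 - 5 * t) * ((1 - 2 * t) * (v * i)).
  have -> : (1 - 5 * t) * ((1 - 2 * t) * (v * i)) = v * ((1 - 5 * t) * ((1 - 2 * t) * i)) by ring.
  apply: (le_trans _ (ler_wpM2l v0 q)); apply: le_trans h1; nra.
have q2 : 0 <= (1 - 8 * t) * i by rewrite mulr_ge0//; lra.
have h3 : (1 - t) * ((1 - 8 * t) * i) <= v * ((1 - 8 * t) * i) by exact: ler_wpM2r.
rewrite mulrC mulrBr.
have h4 : v * ((1 - 8 * t) * i) <= v * ((1 - 5 * t) * ((1 - 2 * t) * (v * i))) by exact: ler_wpM2l.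
have h5 : v * t <= t by rewrite ler_piMl// ltW.
have h6 : (1 - 9 * t) * i <= (1 - t) * ((1 - 8 * t) * i) by nra.
by move: te h3 h4 h5 h6; set w := v * (_ * _); set w' := v * (_ * _); lra.
Qed.

Let a0 := 2 * mu / b - 1.

(* The three last terms come from the overshoot of truncated jumps into the
   core [[x0, e]], from large jumps, and from jumps made from below [B]. *)
Definition generator_error x h t B I M y : R :=
  let a := a0 * (1 + t) in
  let x0 := x + t * h in let e := x + h - t * h in
  b / 2 * (1 + t) * (x < y <= x + h)%R%:R +
  h * 2 `^ (a + 1) * (\sum_(I <= j < M) Tl j *
     ((x0 - (j%:R + 1) < y <= x0 - (j%:R + 1) + (j%:R + 1))%R%:R +
      (e < y <= e + (j%:R + 1))%R%:R)) +
  test_sup x0 e a * ((y <= B)%R%:R * Ex (K y) (fun z => (x < z)%R%:R)).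

(** Each position of [y] (up to [B], left of the window, inside, right of it) uses one of the
    nonnegative terms and ignores the others. Up to [B], where the Lyapunov function gives no
    compensation, the crude bound [sup] times the probability of landing beyond [x] covers jumps of
    any size. *)
Lemma generator_le t B : 0 < t -> t <= 1 / 8 -> 0 < B ->
  exists A dl : R, [/\ 0 < A, 0 < dl &
  forall x h I M y, A <= x -> 0 < h -> h <= dl * x -> s (2 * x) <= M%:R -> I%:R <= t * h ->
  S y ->
  let a := a0 * (1 + t) in let x0 := x + t * h in let e := x + h - t * h in
  Ex (K y) (test_fun x0 e a) - test_fun x0 e a y <=
  generator_error x h t B I M y + test_sup x0 e a * ((B < y)%R%:R * (p y / y))].
Proof.
move=> t0 t8 B0; have a00 := index_gt0 Hr.
have t2 : t < 1 / 2 by lra.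
have t1 : 0 < 1 + t by lra.
set a := a0 * (1 + t).
have a_gt0 : 0 < a by rewrite mulr_gt0.
have aa : a0 < a by rewrite /a mulrDr mulr1 ltrDl mulr_gt0.
have [A1 A10 Hhigh] := test_fun_drift_high Hr aa.
have [A2 [dl [A20 dl0 Hmid]]] := test_fun_drift_mid Hr a_gt0 t0 t2.
exists (Num.max (Num.max A1 A2) B), (Num.min dl (1 / 2)); split.
- by rewrite !lt_max A10.
- by rewrite lt_min dl0 divr_gt0.
move=> x h I M y; rewrite !ge_max => /andP[/andP[xA1 xA2] xB] h0 hx sM Ith Sy /=.
rewrite /generator_error -/a.
set x0 := x + t * h; set e := x + h - t * h.
set f := test_fun _ _ _; set sup := test_sup _ _ _.
set err := \sum_(_ <= _ < _) _.
have x_gt0 := lt_le_trans A10 xA1.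
have hdl : h <= dl * x by apply: (le_trans hx); rewrite ler_pM2r// ge_min lexx.
have hx2 : h <= x / 2.
  by apply: (le_trans hx); rewrite [leRHS]mulrC ler_pM2r// ge_min mul1r lexx orbT.
have th0 : 0 < t * h by rewrite mulr_gt0.
have th2 : t * h < h / 2 by rewrite mulrC ltr_pM2l// -[ltRHS]mul1r.
have [xx0 x0e eh lh] : [/\ x < x0, x0 < e, e <= x + h & e - x0 <= h].
  by rewrite /x0 /e; split; move: x_gt0 th0 th2 h0; move: (t * h) => *; lra.
have x00 := lt_trans x_gt0 xx0.
have l0 : 0 <= e - x0 by rewrite subr_ge0 ltW.
have f0 z : 0 <= f z by exact: test_fun_ge0.
have fsup z : f z <= sup by exact: test_fun_le_sup.
have bf : bmeas f.
  apply: (@bmeas_homo _ _ sup); first exact: test_fun_homo.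
  by move=> z; rewrite ger0_norm.
have sup0 : 0 <= sup := le_trans (f0 0) (fsup 0).
have C1 : 1 <= (2 : R) `^ (a + 1).
  rewrite -[leLHS](powRr0 2); apply: ler_powR; first by rewrite ler1n.
  by rewrite addr_ge0// ltW.
have term0 j : 0 <= Tl j * ((x0 - (j%:R + 1) < y <= x0 - (j%:R + 1) + (j%:R + 1))%R%:R +
      (e < y <= e + (j%:R + 1))%R%:R).
  by apply: mulr_ge0; [exact: (regime_T0 Hr)|exact: addr_ge0].
have err0 : 0 <= err by apply: sumr_ge0 => j _; exact: term0.
have P1 (c : bool) : 0 <= b / 2 * (1 + t) * c%:R.
  by rewrite mulr_ge0// mulr_ge0 ?(ltW t1)// divr_ge0// ltW// (regime_b Hr).
have P2 : 0 <= h * 2 `^ (a + 1) * err.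
  by rewrite mulr_ge0// mulr_ge0 ?(ltW h0)// powR_ge0.
have b3 : bmeas (fun z : R => (x < z)%R%:R : R) by exact: bmeas_gt.
have P3 : 0 <= sup * ((y <= B)%R%:R * Ex (K y) (fun z => (x < z)%R%:R)).
  by rewrite mulr_ge0// mulr_ge0//; exact: Ex_ge0.
case: (leP y B) => yB in P3 *.
  have yx0 : y <= x0 by rewrite (le_trans yB)// (le_trans xB)// ltW.
  rewrite {2}/f (test_fun0 _ _ yx0) subr0 mul0r mulr0 addr0.
  apply: le_trans (_ : sup * Ex (K y) (fun z => (x < z)%R%:R) <= _); last first.
    by rewrite mul1r lerDr; apply: addr_ge0.
  rewrite -ExZ//; apply: le_Ex => //; first exact: bmeasZ.
  move=> z; case: (ltP x z) => xz; first by rewrite mulr1.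
  by rewrite mulr0 /f test_fun0// (le_trans xz)// ltW.
have y0 := lt_trans B0 yB.
rewrite mul0r mulr0 addr0 mul1r.
have errC u v : 0 <= u -> u <= h * 2 `^ (a + 1) -> 0 <= v -> v <= err ->
    u * v <= h * 2 `^ (a + 1) * err.
  by move=> *; exact: ler_pM.
case: (leP y x) => yx.
  have sy : s y <= M%:R.
    apply: le_trans sM; apply: (regime_s_homo Hr); first exact: ltW.
    by rewrite (le_trans yx)// ler_peMl ?(ltW x_gt0)// ler1n.
  have Iu : I%:R <= x0 - y by rewrite (le_trans Ith)// /x0 lerBrDr addrC lerD2r.
  have := test_fun_drift_low Hr a_gt0 x00 x0e Sy y0 sy Iu.
  move=> /le_trans; apply; rewrite lerD2r; apply: ler_wpDl => //.
  apply: errC => //.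
  - apply: (le_trans lh); rewrite ler_peMr// ltW//.
  - apply: sumr_ge0 => j _; apply: mulr_ge0 => //; exact: (regime_T0 Hr).
  apply: ler_sum => j _; apply: ler_wpM2l; first exact: (regime_T0 Hr).
  apply: ler_wpDr => //; rewrite subrK (le_trans yx (ltW xx0)) andbT.
  by rewrite ltrBlDr [_ + 1 + y]addrC -ltrBlDr.
case: (leP y (x + h)) => yxh.
  have := Hmid x h y xA2 h0 hdl Sy yx; rewrite /= -/x0 -/e -/f -/sup.
  move=> /le_trans; apply; rewrite lerD2r mulr1.
  by rewrite lerDl.
have := Hhigh x h t I M y x_gt0 t0 t2 h0 hx2 (le_trans xA1 (ltW yx)) Sy yxh sM Ith.
rewrite /= -/x0 -/e -/f -/sup => /le_trans; apply; rewrite lerD2r.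
apply: ler_wpDl; first by rewrite mulr0.
apply: errC => //.
- by rewrite mulr_ge0// powR_ge0.
- by rewrite ler_wpM2r// powR_ge0.
- apply: sumr_ge0 => j _; apply: mulr_ge0 => //; exact: (regime_T0 Hr).
apply: ler_sum => j _; apply: ler_wpM2l; first exact: (regime_T0 Hr).
apply: ler_wpDl => //; rewrite (le_lt_trans eh yxh)/= ltrBlDr [_ + e]addrC.
by case: ltP => // /ltW ->.
Qed.

Lemma powRN_small a e : 0 < a -> 0 < e -> exists2 B, 0 < B &
  forall z, B <= z -> z `^ (- a) <= e.
Proof.
move=> a_gt0 e0; exists (e `^ (- a^-1)); first exact: powR_gt0.
move=> z Bz; apply: (le_trans (powRN_le a_gt0 _ Bz)); first exact: powR_gt0.
by rewrite -powRrM mulrNN mulVf ?gt_eqF// powRr1// ltW.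
Qed.

End lower_generator.

(** * Lower bound on the occupation of a window *)

Section lower_bound.
Variables (R : realType) (d : measure_display) (T : measurableType d).
Variables (Pr : probability T R) (S : set R) (K : R -> probability R R).
Variable X : nat -> {RV Pr >-> R}.
Hypothesis measurable_K :
  forall B, measurable B -> measurable_fun setT (fun x => K x B).
Hypothesis XS : forall n w, S (X n w).
Hypothesis markovX : forall n (A : set T) (B : set R),
  history X n A -> measurable B ->
  (Pr (A `&` X n.+1 @^-1` B) = \int[Pr]_(w in A) K (X n w) B)%E.
Variables (s p : R -> R) (b mu : R) (Tl : nat -> R).
Hypothesis Hr : regime S K s p b mu Tl.
Hypothesis unbounded : forall M e : R, 0 < e ->
  exists N, 1 - e <= fine (Pr (passed X M N)).
Implicit Types (x y z h t a e : R) (N M I : nat).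

Let a0 := 2 * mu / b - 1.

Lemma sum_tail_le (c : nat -> R) I J n : (forall j, 0 <= c j) -> (I <= J)%N ->
  \sum_(J <= j < n) c j <= \sum_(I <= j < n) c j.
Proof.
move=> c0 IJ; case: (leqP J n) => Jn.
  by rewrite [leRHS](@big_cat_nat _ _ _ J)//= lerDr sumr_ge0.
by rewrite big_geq ?sumr_ge0// ltnW.
Qed.

Lemma bmeas_generator_error x h t B I M : bmeas (generator_error K b mu Tl x h t B I M).
Proof.
apply: bmeasD.
  apply: bmeasD; first by apply: bmeasZ; exact: bmeas_itv.
  apply: bmeasZ; apply: bmeas_sum => j _; apply: bmeasZ; apply: bmeasD; exact: bmeas_itv.
apply: bmeasZ; apply: bmeasM; first exact: bmeas_le.
by apply: (bmeas_ExK measurable_K markovX); exact: bmeas_gt.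
Qed.

(** The overshoot windows start between [x / 2] and [2 * x] and are written in the form
    [x' < z <= x' + (j + 1)] of [occ_upper]. Two windows of occupation at most [2 * C * x * (j + 1)]
    each give the factor 4, and summation against [Tl j] leaves a tail of the second moment of
    [xihat]. *)
Lemma occ_generator_error x h t B I M N (C : R) :
  0 < h -> 0 < t -> t < 1 / 2 -> 0 < x -> 0 <= C -> h <= x / 2 -> M%:R <= x / 2 ->
  (forall x' j, (I <= j)%N -> (j < M)%N -> x / 2 <= x' ->
     occ X N (fun z => (x' < z <= x' + (j%:R + 1))%R%:R) <= C * (x' * (j%:R + 1))) ->
  occ X N (generator_error K b mu Tl x h t B I M) <=
  b / 2 * (1 + t) * occ X N (fun z => (x < z <= x + h)%R%:R) +
  h * 2 `^ (a0 * (1 + t) + 1) * (4 * C * x * \sum_(I <= j < M) (2 * j%:R + 1) * Tl j) +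
  test_sup (x + t * h) (x + h - t * h) (a0 * (1 + t)) *
    occ X N (fun y => (y <= B)%R%:R * Ex (K y) (fun z => (x < z)%R%:R)).
Proof.
move=> h0 t0 t2 x0 C0 hx Mx Hocc; rewrite /generator_error -/a0.
set e := x + h - t * h.
have th0 : 0 < t * h by rewrite mulr_gt0.
have th2 : t * h < h / 2 by rewrite mulrC ltr_pM2l// -[ltRHS]mul1r.
have bi x' y' : bmeas (fun z : R => (x' < z <= y')%R%:R : R) by exact: bmeas_itv.
have bup : bmeas (fun y => (y <= B)%R%:R * Ex (K y) (fun z => (x < z)%R%:R)).
  by apply: bmeasM; [exact: bmeas_le|apply: (bmeas_ExK measurable_K markovX); exact: bmeas_gt].
have bj (j : nat) x1 x2 : bmeas (fun y => Tl j *
    ((x1 < y <= x1 + (j%:R + 1))%R%:R + (x2 < y <= x2 + (j%:R + 1))%R%:R)).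
  by apply: bmeasZ; apply: bmeasD.
have bs (F : nat -> R -> R) : (forall j, bmeas (F j)) ->
    bmeas (fun y => \sum_(I <= j < M) F j y).
  by move=> bF; apply: bmeas_sum.
rewrite occ_D; [|by apply: bmeasD; apply: bmeasZ => //; exact: bs|exact: bmeasZ].
rewrite occ_D; [|exact: bmeasZ|by apply: bmeasZ; exact: bs].
rewrite !occ_Z//; last by apply: bs.
rewrite lerD2r lerD2l; apply: ler_wpM2l.
  by rewrite mulr_ge0 ?(ltW h0)// powR_ge0.
have -> : occ X N (fun y => \sum_(I <= j < M) Tl j *
    ((x + t * h - (j%:R + 1) < y <= x + t * h - (j%:R + 1) + (j%:R + 1))%R%:R +
      (e < y <= e + (j%:R + 1))%R%:R)) =
  \sum_(I <= j < M) Tl j *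
   (occ X N (fun y => (x + t * h - (j%:R + 1) < y <= x + t * h - (j%:R + 1) + (j%:R + 1))%R%:R) +
     occ X N (fun y => (e < y <= e + (j%:R + 1))%R%:R)).
  by rewrite occ_sum//; apply: eq_bigr => j _; rewrite occ_Z ?occ_D//; exact: bmeasD.
rewrite mulr_sumr !big_nat; apply: ler_sum => j /andP[Ij jM].
have jx : j%:R + 1 <= x / 2 by apply: le_trans Mx; rewrite natr1 ler_nat.
have j1 : 0 <= j%:R + 1 :> R by rewrite addr_ge0.
have := Hocc (x + t * h - (j%:R + 1)) j Ij jM _.
have -> : x / 2 <= x + t * h - (j%:R + 1).
  by move: th0 jx; move: (t * h) (j%:R + 1) => *; lra.
move=> /(_ isT) h1.
have := Hocc e j Ij jM _.
have -> : x / 2 <= e by rewrite /e; move: th2; move: (t * h) => *; lra.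
move=> /(_ isT) h2.
have [l1 l2] : x + t * h - (j%:R + 1) <= 2 * x /\ e <= 2 * x.
  by rewrite /e; split; move: th0 th2 j1; move: (t * h) (j%:R + 1) => *; lra.
have m1 (x' : R) : x' <= 2 * x -> C * (x' * (j%:R + 1)) <= C * (2 * x * (j%:R + 1)).
  by move=> xx; apply: ler_wpM2l => //; exact: ler_wpM2r.
have := lerD (le_trans h1 (m1 _ l1)) (le_trans h2 (m1 _ l2)).
move=> /(ler_wpM2l (regime_T0 Hr j)) /le_trans; apply.
have -> : Tl j * (C * (2 * x * (j%:R + 1)) + C * (2 * x * (j%:R + 1))) =
          4 * C * x * ((j%:R + 1) * Tl j) by ring.
apply: ler_wpM2l; first by rewrite !mulr_ge0// ltW.
apply: ler_wpM2r; first exact: (regime_T0 Hr).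
by rewrite lerD2r ler_peMl// ler1n.
Qed.

(** One factor [1 - t] is the value of the test function far out relative to its supremum, the other
    the probability that the chain is there at late times. *)
Lemma EX_test_fun_ge x0 e a t : 0 < x0 -> x0 < e -> 0 < a -> 0 < t -> t <= 1 ->
  exists N0, forall N, (N0 <= N)%N ->
    test_sup x0 e a * (1 - t) * (1 - t) <= EX X N (test_fun x0 e a).
Proof.
move=> x00 x0e a_gt0 t0 t1; set sup := test_sup x0 e a; set f := test_fun x0 e a.
have e0 := lt_trans x00 x0e.
have l0 : 0 < e - x0 by rewrite subr_gt0.
have sup0 : 0 < sup.
  apply: addr_gt0; first by rewrite divr_gt0// exprn_gt0.
  by rewrite divr_gt0// mulr_gt0.
have f0 z : 0 <= f z by exact: test_fun_ge0.
have fsup z : f z <= sup by exact: test_fun_le_sup.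
have bf : bmeas f.
  apply: (@bmeas_homo _ _ sup); first exact: test_fun_homo.
  by move=> z; rewrite ger0_norm.
set k := slope_weight a e (e - x0).
have k0 : 0 <= k by apply: slope_weight_ge0 => //; exact: ltW.
have st0 : 0 < sup * t / (k + 1) by rewrite divr_gt0 ?mulr_gt0// ltr_wpDl.
have [B B0 HB] := powRN_small a_gt0 st0.
have [N0 HN0] := transient measurable_K XS markovX Hr unbounded (Num.max B e) t0.
exists N0 => N /HN0; set q := EX _ _ _ => qt.
have q0 : 0 <= q by apply: Ex_ge0.
have bB := bmeas_le (Num.max B e).
have H : sup * (1 - t) * (1 - q) <= EX X N f.
  have -> : sup * (1 - t) * (1 - q) = sup * (1 - t) + - (sup * (1 - t)) * q by ring.
  rewrite -EX_Z// -[X in X + _](Ex_cst Pr) -[Ex Pr _]/(EX X N (fun _ => sup * (1 - t))).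
  rewrite -EX_D; [|exact: bmeas_cst|exact: bmeasZ].
  apply: (le_EX XS) => //.
    by apply: bmeasD; [exact: bmeas_cst|exact: bmeasZ].
  move=> y _; case: (leP y (Num.max B e)) => yB.
    by rewrite mulr1 subrr.
  rewrite mulr0 addr0; move: yB; rewrite gt_max => /andP[/ltW By /ltW ey].
  apply: le_trans (test_fun_ge_tail x00 x0e a_gt0 ey).
  rewrite mulrBr mulr1 lerD2l lerN2 -/k.
  apply: (@le_trans _ _ (k * (sup * t / (k + 1)))); first by apply: ler_wpM2l => //; exact: HB.
  rewrite mulrCA ler_piMr ?(mulr_ge0 (ltW sup0) (ltW t0))//.
  by rewrite ler_pdivrMr ?ltr_wpDl// mul1r lerDl.
apply: le_trans H; apply: ler_wpM2l; last by rewrite lerD2l lerN2.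
by apply: mulr_ge0; [exact: ltW|rewrite subr_ge0].
Qed.

(** Dynkin's inequality is applied to [f - sup * U]: the drift of [U] cancels the large-jump error.
    The initial mean is small because the law of [X 0] puts little mass beyond [x], the final one is
    close to [sup], and the difference is due to the window up to small errors. [N0] depends on [x]
    and [h], which is harmless since the Green function dominates its partial sums. *)
Lemma occ_lower e : 0 < e -> exists A L dl : R, [/\ 0 < A, 0 < L, 0 < dl &
  forall x h, A <= x -> L <= h -> h <= dl * x -> exists N0, forall N, (N0 <= N)%N ->
    (2 / (2 * mu - b) - e) * (x * h) <= occ X N (fun z => (x < z <= x + h)%R%:R)].
Proof.
move=> e0; have b0 := regime_b Hr; have hmu := regime_mu Hr.
have a00 : 0 < a0 by exact: (index_gt0 Hr).
have b2 : 0 < 2 * mu - b by lra.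
have eb : 0 < e * b / 2 by rewrite divr_gt0// mulr_gt0.
have [t /andP[t0 t8] Ht] := lower_parameter a00 eb.
have t2 : t < 1 / 2 by lra.
have tle1 : t <= 1 by lra.
have t1 : 0 < 1 + t by lra.
pose a := a0 * (1 + t); have a_gt0 : 0 < a by rewrite mulr_gt0.
pose C : R := 2 `^ (a + 1); have C0 : 0 < C by rewrite powR_gt0.
have [Au [Lu [du [Au0 Lu0 du0 Hup]]]] := occ_upper measurable_K XS markovX Hr (@ltr01 R).
pose C1 := 2 / (2 * mu - b) + 1.
have C10 : 0 < C1 by rewrite addr_gt0// divr_gt0.
have [B B0 [_ [U [bU U01 UB _ [_ HU]]]]] := lyapunov_exists Hr 1 t0.
have [Ag [dg [Ag0 dg0 Hgen]]] := generator_le Hr t0 t8 B0.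
have eta0 : 0 < t / (4 * C * C1) by rewrite divr_gt0// !mulr_gt0.
have [I0 HI0] := regime_T_sum Hr eta0.
(* Besides making the tail of [xihat] small, [I] exceeds [Lu], so that every overshoot window is
   wide enough for [occ_upper]. *)
pose I := maxn I0 (Num.truncn Lu).+1.
have LuI : Lu <= I%:R.
  by apply: (le_trans (ltW (truncnS_gt Lu))); rewrite ler_nat leq_maxr.
have HI n : \sum_(I <= j < n) (2 * j%:R + 1) * Tl j <= t / (4 * C * C1).
  apply: le_trans (HI0 n); apply: sum_tail_le; last exact: leq_maxl.
  move=> j; apply: mulr_ge0; last exact: (regime_T0 Hr).
  by apply: addr_ge0 => //; exact: mulr_ge0.
(* The bound [M <= rho * x / 2] gives both [M <= x / 2] and [M <= du * x'] for every [x'] at least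
   [x / 2]. *)
pose rho := Num.min 1 du; have rho0 : 0 < rho by rewrite lt_min ltr01 du0.
have rho8 : 0 < rho / 8 by rewrite divr_gt0.
have [As As0 HAs] := regime_s Hr rho8.
have [x1 Hx1] := upcross measurable_K XS markovX Hr B t0.
have [x2 Hx2] := rv_tail X 0 t0.
exists (Num.max (Num.max (Num.max (2 * Au) Ag) (Num.max As (4 / rho)))
                (Num.max (Num.max x1 x2) B)).
exists (I%:R / t), (Num.min dg (1 / 2)); split.
- by rewrite !lt_max Ag0 orbT.
- by rewrite divr_gt0// (lt_le_trans Lu0).
- by rewrite lt_min dg0 divr_gt0.
move=> x h; rewrite !ge_max.
move=> /andP[/andP[/andP[xAu xAg] /andP[xAs xrho]] /andP[/andP[xx1 xx2] xB]] Ih hx.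
have x0 := lt_le_trans Ag0 xAg.
have Ith : I%:R <= t * h by rewrite mulrC -ler_pdivrMr.
have h0 : 0 < h by apply: lt_le_trans Ih; rewrite divr_gt0// (lt_le_trans Lu0).
have hdg : h <= dg * x by apply: (le_trans hx); rewrite ler_pM2r// ge_min lexx.
have hx2 : h <= x / 2.
  by apply: (le_trans hx); rewrite [leRHS]mulrC ler_pM2r// ge_min mul1r lexx orbT.
have th0 : 0 < t * h by rewrite mulr_gt0.
have th2 : t * h < h / 2 by rewrite mulrC ltr_pM2l// -[ltRHS]mul1r.
pose M := (Num.truncn (s (2 * x))).+1.
have sM : s (2 * x) <= M%:R by exact/ltW/truncnS_gt.
have Mrho : M%:R <= rho * x / 2.
  have s0 : 0 <= s (2 * x) by apply/ltW/(regime_s0 Hr); rewrite mulr_ge0// ltW.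
  have : M%:R <= s (2 * x) + 1 by rewrite /M -natr1 lerD2r truncn_le.
  have : s (2 * x) <= rho / 8 * (2 * x).
    by apply: HAs; rewrite (le_trans xAs)// ler_peMl ?(ltW x0)// ler1n.
  have : 4 <= rho * x by rewrite mulrC -ler_pdivrMr.
  have -> : rho / 8 * (2 * x) = rho * x / 4 by field.
  by move: (rho * x) => *; lra.
have rho1 : rho <= 1 by rewrite ge_min lexx.
have rhodu : rho <= du by rewrite ge_min lexx orbT.
have Mx : M%:R <= x / 2.
  by apply: (le_trans Mrho); rewrite ler_pM2r ?invr_gt0// ler_piMl// ltW.
have Hocc N x' j : (I <= j)%N -> (j < M)%N -> x / 2 <= x' ->
    occ X N (fun z => (x' < z <= x' + (j%:R + 1))%R%:R) <= C1 * (x' * (j%:R + 1)).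
  move=> Ij jM xx'; apply: Hup.
  - by apply: le_trans xx'; rewrite ler_pdivlMr// mulrC.
  - apply: (le_trans LuI); apply: (@le_trans _ _ j%:R); first by rewrite ler_nat.
    by rewrite lerDl.
  apply: (@le_trans _ _ M%:R); first by rewrite natr1 ler_nat.
  apply: (le_trans Mrho); rewrite -mulrA; apply: ler_pM => //.
  - exact: ltW.
  - by rewrite divr_ge0// ltW.
pose y0 := x + t * h; pose y1 := x + h - t * h.
have [xy0 y01 xy1 lE] : [/\ x < y0, y0 < y1, x <= y1 & y1 - y0 = h * (1 - 2 * t)].
  have lE : y1 - y0 = h * (1 - 2 * t) by rewrite /y1 /y0; ring.
  by split => //; rewrite /y0 /y1; move: th0 th2; move: (t * h) => *; lra.
have y00 := lt_trans x0 xy0.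
have l0 : 0 < y1 - y0 by rewrite subr_gt0.
pose f := test_fun y0 y1 a; pose sup := test_sup y0 y1 a.
have f0 z : 0 <= f z by exact: test_fun_ge0.
have fsup z : f z <= sup by exact: test_fun_le_sup.
have bf : bmeas f.
  apply: (@bmeas_homo _ _ sup); first exact: test_fun_homo.
  by move=> z; rewrite ger0_norm.
have sup0 : 0 <= sup := le_trans (f0 0) (fsup 0).
have [N0 HN0] := EX_test_fun_ge y00 y01 a_gt0 t0 tle1.
exists N0 => N /HN0; rewrite -/f -/sup => fN.
pose F y := f y + (- sup) * U y.
have bF : bmeas F by apply: bmeasD => //; exact: bmeasZ.
pose phi := generator_error K b mu Tl x h t B I M.
have U0 y : 0 <= U y by case/andP: (U01 y).
have drift y : S y -> Ex (K y) F <= F y + phi y.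
  move=> Sy; have := Hgen x h I M y xAg h0 hdg sM Ith Sy.
  rewrite /= -/a0 -/a -/y0 -/y1 -/f -/sup -/phi => H.
  rewrite /F ExD//; last exact: bmeasZ.
  rewrite ExZ//.
  have : U y + (B < y)%R%:R * (p y / y) <= Ex (K y) U.
    case: (ltP B y) => By; first by rewrite mul1r; exact: HU.
    by rewrite mul0r addr0 UB//; exact: Ex_ge0.
  move=> /(ler_wpM2l sup0); rewrite mulrDr.
  move: H; set q := sup * (_ * _); move: (Ex _ _) (Ex _ _) => *; lra.
have := dynkin_le measurable_K XS markovX N bF (bmeas_generator_error _ _ _ _ _ _) drift.
have Herr := @occ_generator_error x h t B I M N C1 h0 t0 t2 x0 (ltW C10) hx2 Mx (Hocc N).
move: Herr; rewrite -/phi -/a -/y0 -/y1 -/sup -/C.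
set oc := occ X N (fun z => (x < z <= x + h)%R%:R).
set up := occ X N (fun y => _ * _); set sm := \sum_(_ <= _ < _) _ => Herr.
have upt : sup * up <= sup * t by apply: ler_wpM2l => //; exact: Hx1.
have smt : h * C * (4 * C1 * x * sm) <= t * (h * x).
  have -> : h * C * (4 * C1 * x * sm) = (h * x) * (4 * C * C1) * sm by ring.
  have -> : t * (h * x) = (h * x) * (4 * C * C1) * (t / (4 * C * C1)).
    by field; rewrite !gt_eqF.
  by apply: (ler_wpM2l _ (HI M)); rewrite !mulr_ge0// ltW.
have F0 : EX X 0 F <= sup * t.
  apply: (@le_trans _ _ (EX X 0 (fun z => sup * (x < z)%R%:R))).
    apply: (le_EX XS) => //; first by apply: bmeasZ; exact: bmeas_gt.
    move=> y _; rewrite /F; case: (ltP x y) => xy.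
      rewrite mulr1; have := fsup y; have : 0 <= sup * U y by rewrite mulr_ge0.
      by move: (f y) (sup) (U y) => *; lra.
    rewrite mulr0 /f test_fun0 ?add0r ?(le_trans xy) ?(ltW xy0)//.
    by rewrite mulNr oppr_le0 mulr_ge0.
  rewrite EX_Z; last exact: bmeas_gt.
  by apply: ler_wpM2l => //; exact: Hx2.
have FN : EX X N f - sup * t <= EX X N F.
  rewrite /F EX_D//; last exact: bmeasZ.
  rewrite EX_Z// lerD2l mulNr lerN2; apply: ler_wpM2l => //.
  by apply: Ex_le => [|w]; [exact: (bmeas_comp_RV X N bU)|case/andP: (U01 (X N w))].
move=> Hdyn.
have Hsup : h * x * ((1 - 2 * t) / a) <= sup.
  have -> : h * x * ((1 - 2 * t) / a) = (y1 - y0) * x / a by rewrite lE; ring.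
  rewrite /sup /test_sup ler_wpDl ?divr_ge0 ?sqr_ge0//.
  by rewrite ler_pM2r ?invr_gt0// ler_pM2l.
have H1 : sup * (1 - 5 * t) - t * (h * x) <= b / 2 * (1 + t) * oc.
  have st : 0 <= sup * (t * t) by rewrite mulr_ge0// mulr_ge0// ltW.
  have -> : sup * (1 - 5 * t) = sup * (1 - t) * (1 - t) - 3 * (sup * t) - sup * (t * t) by ring.
  move: fN Hdyn Herr upt smt F0 FN st.
  by move: (sup * t) (sup * (1 - t) * _) (sup * up) (h * C * _) => *; lra.
have t5 : 0 <= 1 - 5 * t by lra.
have H2 := ler_wpM2r t5 Hsup.
have E0 : 2 / (2 * mu - b) = 2 / b * a0^-1.
  by rewrite /a0; field; rewrite !gt_eqF//; lra.
have -> : (2 / (2 * mu - b) - e) * (x * h) = 2 / b * (h * x) * (a0^-1 - e * b / 2).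
  by rewrite E0; field; rewrite !gt_eqF.
apply: (@le_trans _ _ (2 / b * (h * x) *
    (((1 - 5 * t) * ((1 - 2 * t) / (a0 * (1 + t))) - t) / (1 + t)))).
  by apply: ler_wpM2l => //; rewrite !mulr_ge0 ?invr_ge0// ltW.
rewrite -/a.
have -> : 2 / b * (h * x) * (((1 - 5 * t) * ((1 - 2 * t) / a) - t) / (1 + t)) =
   (h * x * ((1 - 2 * t) / a) * (1 - 5 * t) - t * (h * x)) * (2 / b / (1 + t)).
  by field; rewrite !gt_eqF.
have -> : oc = b / 2 * (1 + t) * oc * (2 / b / (1 + t)).
  by field; rewrite !gt_eqF.
apply: ler_wpM2r; first by rewrite !mulr_ge0 ?invr_ge0// ltW.
by apply: le_trans H1; rewrite lerD2r.
Qed.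

End lower_bound.

(** * Dyadic summability of a decreasing integrable function *)

Section condensation.
Variable R : realType.
Implicit Types (g p : R -> R) (c x y k : R).
Local Notation leb := (@lebesgue_measure R).

Lemma Rintegral_initial_le g c x : leb.-integrable `]c, +oo[ (EFin \o g) ->
  c <= x -> (forall y, c < y -> 0 <= g y) ->
  \int[leb]_(y in `]c, x]) g y <= \int[leb]_(y in `]c, +oo[) g y.
Proof.
move=> ig cx g0; rewrite -subr_ge0 Rintegral_itvB//.
apply: Rintegral_ge0 => y /=; rewrite in_itv/= andbT => xy.
by apply: g0; exact: le_lt_trans xy.
Qed.

Lemma Rintegral_ge_block g c x y k : leb.-integrable `]c, +oo[ (EFin \o g) ->
  c <= x -> x <= y -> (forall z, x < z -> z <= y -> k <= g z) ->
  (y - x) * k <= \int[leb]_(z in `]x, y]) g z.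
Proof.
move=> ig cx xy kg.
have lxy : leb `]x, y]%classic = (y - x)%:E.
  rewrite lebesgue_measure_itv/= lte_fin; case: (ltP x y) => // yx.
  by have -> : x = y by [apply/le_anti; rewrite xy]; rewrite subrr.
have <- : \int[leb]_(z in `]x, y]) k = (y - x) * k.
  by rewrite Rintegral_cst// mulrC; congr (_ * _); exact: (congr1 fine lxy).
have lfin : (leb `]x, y]%classic < +oo)%E by rewrite lxy ltry.
apply: le_Rintegral => //.
- apply: measurable_bounded_integrable => //.
  by exists `|k|; split => [|u ku z _]; [exact: num_real|exact: ltW].
- apply: integrableS ig => // z /=; rewrite !in_itv/= andbT => /andP[xz _].
  exact: le_lt_trans xz.
- by move=> z /=; rewrite in_itv/= => /andP[xz zy]; exact: kg.
Qed.

(** Past a negative value, [- p] would stay above a positive constant and its integral would exceed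
    every multiple of it. *)
Lemma decreasing_integrable_ge0 p :
  {in `]0, +oo[ &, nonincreasing_fun p} -> integrable_at_infinity p ->
  forall y, 0 < y -> 0 <= p y.
Proof.
move=> pd [a ip] y y0; rewrite leNgt; apply/negP => py.
pose c := Num.max a y.
have ig : leb.-integrable `]c, +oo[ (EFin \o (fun z => - p z)).
  have : leb.-integrable `]c, +oo[ (EFin \o p).
    apply: integrableS ip => // z /=.
    by rewrite !in_itv/= !andbT gt_max => /andP[/ltW].
  by move=> /integrableN; apply.
have yc : y <= c by rewrite le_max lexx orbT.
have pz z : c < z -> - p y <= - p z.
  move=> cz; have yz := ltW (le_lt_trans yc cz).
  by rewrite lerN2; apply: pd => //; rewrite in_itv/= andbT// (lt_le_trans y0).
have g0 z : c < z -> 0 <= - p z by move=> /pz; apply: le_trans; rewrite oppr_ge0 ltW.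
set J := \int[leb]_(z in `]c, +oo[) - p z.
have bound (n : nat) : n%:R * - p y <= J.
  have cn : c <= c + n%:R by rewrite lerDl.
  apply: le_trans (Rintegral_initial_le ig cn g0).
  have := @Rintegral_ge_block _ c c (c + n%:R) (- p y) ig (lexx _) cn.
  have -> : c + n%:R - c = n%:R by ring.
  by apply=> z cz _; exact: pz.
have := bound (Num.truncn (J / - p y)).+1.
rewrite leNgt -ltr_pdivrMr ?oppr_gt0// => /negP; apply; exact: truncnS_gt.
Qed.

(** The integral over the block from [2 ^ j] to [2 ^ (j + 1)] is at least [2 ^ j * p (2 ^ (j + 1))];
    the shift of index costs the factor 2. The terms before integrability is available form a fixed
    finite sum. *)
Lemma cauchy_condensation p :
  {in `]0, +oo[ &, nonincreasing_fun p} -> integrable_at_infinity p ->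
  exists B, forall n, \sum_(j < n) 2 ^+ j * p (2 ^+ j) <= B.
Proof.
move=> pd ip; have p0 := decreasing_integrable_ge0 pd ip.
case: ip => a ip.
have v0 j : 0 < 2 ^+ j :> R by rewrite exprn_gt0.
pose j0 := (Num.truncn a).+1; pose c : R := 2 ^+ j0.
have ac : a <= c.
  apply: (le_trans (ltW (truncnS_gt a))).
  by rewrite /c -natrX ler_nat ltnW// ltn_expl.
have ig : leb.-integrable `]c, +oo[ (EFin \o p).
  apply: integrableS ip => // z /=; rewrite !in_itv/= !andbT => /ltW.
  exact: le_trans.
have pg z : c < z -> 0 <= p z by move=> cz; apply: p0; exact: (lt_trans (v0 j0) cz).
set J := \int[leb]_(z in `]c, +oo[) p z.
have block n : \sum_(i < n) 2 ^+ (j0 + i) * p (2 ^+ (j0 + i).+1) <=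
    \int[leb]_(z in `]c, 2 ^+ (j0 + n)]) p z.
  elim: n => [|n IH].
    rewrite big_ord0; apply: Rintegral_ge0 => z /=.
    by rewrite in_itv/= => /andP[/pg].
  rewrite big_ord_recr/=.
  have le1 : c <= 2 ^+ (j0 + n) by rewrite ler_weXn2l ?ler1n// leq_addr.
  have le2 : 2 ^+ (j0 + n) <= 2 ^+ (j0 + n.+1) :> R.
    by rewrite ler_weXn2l ?ler1n// addnS.
  have -> : \int[leb]_(z in `]c, 2 ^+ (j0 + n.+1)]) p z =
    \int[leb]_(z in `]c, 2 ^+ (j0 + n)]) p z +
    \int[leb]_(z in `]2 ^+ (j0 + n), 2 ^+ (j0 + n.+1)]) p z.
    apply/eqP; rewrite addrC -subr_eq; apply/eqP; apply: Rintegral_itvB.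
    - by apply: integrableS ig => // z /=; rewrite !in_itv/= andbT => /andP[].
    - by rewrite bnd_simp.
    - by rewrite bnd_simp.
  apply: (lerD IH).
  have := @Rintegral_ge_block p c _ _ (p (2 ^+ (j0 + n.+1))) ig le1 le2.
  have -> : 2 ^+ (j0 + n.+1) - 2 ^+ (j0 + n) = 2 ^+ (j0 + n) :> R.
    by rewrite addnS exprS; ring.
  rewrite addnS; apply=> z z1 z2; apply: pd => //; rewrite in_itv/= andbT//.
  exact: lt_trans z1.
have blockJ n : \sum_(i < n) 2 ^+ (j0 + i) * p (2 ^+ (j0 + i).+1) <= J.
  apply: (le_trans (block n)); apply: Rintegral_initial_le => //.
  by rewrite ler_weXn2l ?ler1n// leq_addr.
exists (\sum_(j < j0.+1) 2 ^+ j * p (2 ^+ j) + 2 * J) => n.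
apply: (@le_trans _ _ (\sum_(j < j0.+1 + n) 2 ^+ j * p (2 ^+ j))).
  rewrite addnC big_split_ord/= lerDl; apply: sumr_ge0 => j _.
  by apply: mulr_ge0; [exact: ltW|exact: p0].
rewrite big_split_ord/= lerD2l; apply: le_trans (ler_wpM2l _ (blockJ n)) => //.
by rewrite mulr_sumr; apply: ler_sum => j _; rewrite addSn exprS mulrA.
Qed.

(** The dyadic sum of the correction [y ^- 2] that is added to [p]. *)
Lemma geometric_half n : \sum_(j < n) 2 ^+ j * (2 ^+ j) ^- 2 <= 2 :> R.
Proof.
suff -> : \sum_(j < n) 2 ^+ j * (2 ^+ j) ^- 2 = 2 - 2 * (2 ^+ n)^-1 :> R.
  by rewrite gerBl mulr_ge0// invr_ge0 exprn_ge0.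
elim: n => [|n IH]; first by rewrite big_ord0 expr0 invr1; ring.
rewrite big_ord_recr/= IH [2 ^+ n.+1]exprS.
have : (2 : R) ^+ n != 0 by rewrite expf_neq0.
move: (2 ^+ n) => q q0; field; exact: q0.
Qed.

End condensation.

(** * Tail sums of a square-integrable variable *)

Section second_moment_tail.
Variables (R : realType) (d : measure_display) (T : measurableType d).
Variables (Q : probability T R) (Y : {RV Q >-> R}).

Lemma count_sq_le (v : R) n :
  \sum_(j < n) (2 * j%:R + 1) * (j%:R < v)%R%:R <= 2 * v ^+ 2 + 2.
Proof.
have : \sum_(j < n) (2 * j%:R + 1) * (j%:R < v)%R%:R <= (`|v| + 1) ^+ 2.
  elim: n => [|n IH]; first by rewrite big_ord0 sqr_ge0.
  rewrite big_ord_recr/=; case: (ltP n%:R v) => nv; last by rewrite mulr0 addr0.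
  apply: (@le_trans _ _ (n.+1%:R ^+ 2)).
    rewrite -sum_odd big_ord_recr/= mulr1 lerD2r; apply: ler_sum => i _.
    by rewrite ler_piMr ?lern1 ?leq_b1// addr_ge0// mulr_ge0.
  rewrite ler_sqr ?nnegrE ?addr_ge0// -natr1 lerD2r.
  by apply: (le_trans (ltW nv)); exact: ler_norm.
move=> /le_trans; apply; rewrite -[v ^+ 2]real_normK ?num_real//.
by have := sqr_ge0 (`|v| - 1); move: (`|v|) => u; lra.
Qed.

(** The weighted count of levels below [v] is at most [(|v| + 1) ^ 2], hence at most
    [2 * v ^ 2 + 2], whose expectation is finite. *)
Lemma second_moment_tail : ('E_Q[fun w => (Y w ^+ 2)%R] < +oo)%E ->
  exists B : R, forall n,
    \sum_(j < n) (2 * j%:R + 1) * fine (Q [set w | j%:R < Y w]) <= B.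
Proof.
move=> EY; have mY : measurable_fun setT Y by exact: measurable_funPT.
have mY2 : measurable_fun setT (fun w => Y w ^+ 2) by exact: measurable_funX.
exists (2 * fine ('E_Q[fun w => (Y w ^+ 2)%R])%E + 2) => n.
have mc (j : nat) : measurable_fun setT (fun w => j%:R < Y w).
  by apply: measurable_fun_ltr.
have bc (j : nat) : bmeas (fun w => (j%:R < Y w)%R%:R : R) by exact: bmeas_bool.
pose g w : R := \sum_(j < n) (2 * j%:R + 1) * (j%:R < Y w)%R%:R.
have bg : bmeas g by apply: bmeas_sum => j _; exact: bmeasZ.
have -> : \sum_(j < n) (2 * j%:R + 1) * fine (Q [set w | j%:R < Y w]) = Ex Q g.
  rewrite /g Ex_sum; last by move=> j _; exact: bmeasZ.
  by apply: eq_bigr => j _; rewrite ExZ// Ex_bool.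
have i2 : Q.-integrable setT (EFin \o (fun w => Y w ^+ 2)).
  apply/integrableP; split; first exact/measurable_EFinP.
  rewrite (eq_integral (fun w => (Y w ^+ 2)%:E)); first by move: EY; rewrite unlock.
  by move=> w _ /=; rewrite ger0_norm// sqr_ge0.
have -> : 2 * fine ('E_Q[fun w => (Y w ^+ 2)%R])%E + 2 =
   \int[Q]_w (2 * Y w ^+ 2 + 2).
  rewrite RintegralD//; last 2 first.
  - by apply: (integrableZl _ 2 i2).
  - by apply: bmeas_integrable; exact: bmeas_cst.
  rewrite RintegralZl//; congr (_ + _); first by rewrite unlock.
  exact/esym/(Ex_cst Q 2).
apply: le_Rintegral => //; first exact: bmeas_integrable.
  have ic : Q.-integrable setT (EFin \o (fun _ => 2 : R)).
    by apply: bmeas_integrable; exact: bmeas_cst.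
  exact: (integrableD measurableT (integrableZl measurableT 2 i2) ic).
by move=> w _; exact: count_sq_le.
Qed.

End second_moment_tail.

(** * From the hypotheses of the theorem to their real-valued form *)

Section translation.
Variables (R : realType) (d : measure_display) (T : measurableType d).
Variables (Pr : probability T R) (S : set R) (K : R -> probability R R).
Variable X : nat -> {RV Pr >-> R}.

(** A path that never passes [M] has upper limit at most [M], so passing has probability one;
    continuity from below then gives a finite time. *)
Lemma passed_unbounded :
  {ae Pr, forall w, limn_esup (fun n => (X n w)%:E) = +oo%E} ->
  forall M e : R, 0 < e -> exists N, 1 - e <= fine (Pr (passed X M N)).
Proof.
move=> [A [mA A0 HA]] M e e0.
have mp N : measurable (passed X M N).
  exact: (history_measurable (history_passed M (leqnn N))).
have mU : measurable (\bigcup_N passed X M N) by exact: bigcup_measurable.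
have CA : ~` (\bigcup_N passed X M N) `<=` A.
  move=> w wU; apply: HA => /= wlim.
  have : (limn_esup (fun n => (X n w)%:E) <= M%:E)%E.
    apply: ge_ereal_inf; exists (ereal_sup (range (fun n => (X n w)%:E))).
      by exists setT => //; exact: filterT.
    apply: ge_ereal_sup => _ [n _ <-]; rewrite lee_fin leNgt; apply/negP => Mn.
    apply: wU; exists n => //.
    by case: (n) Mn => [|m] Mn; left; rewrite /= in_itv/= andbT.
  by rewrite wlim.
have PU : Pr (\bigcup_N passed X M N) = 1%E.
  have P0 : Pr (~` (\bigcup_N passed X M N)) = 0%E.
    exact: (subset_measure0 (measurableC mU) mA CA A0).
  by rewrite -[X in Pr X]setCK probability_setC ?P0 ?sube0//; exact: measurableC.
have : Pr (passed X M N) @[N --> \oo] --> Pr (\bigcup_N passed X M N).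
  apply: nondecreasing_cvg_mu => // i j ij; apply/subsetPset; exact: passed_sub.
rewrite PU => /fine_cvg /cvgrPdist_le /(_ _ e0)[N _ /(_ N (leqnn N))] /=.
by move=> /ler_normlP[_ ?]; exists N; lra.
Qed.

Lemma near_pinfty (P : R -> Prop) : (\forall x \near +oo, P x) ->
  exists2 A, 0 < A & forall y, A <= y -> P y.
Proof.
move=> [M [_ HM]]; exists (Num.max (M + 1) 1); first by rewrite lt_max ltr01 orbT.
by move=> y; rewrite ge_max => /andP[My _]; apply: HM; lra.
Qed.

Lemma near_pinfty_within (P : R -> Prop) :
  (\forall x \near within S (pinfty_nbhs R), P x) -> evS S P.
Proof. by move=> /near_pinfty[A A0 HA]; exists A => // y Ay Sy; exact: HA. Qed.

Lemma truncated_momentE (s : R -> R) k x :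
  truncated_moment K k (s x) x = (tmom K s k x)%:E.
Proof.
have bj := bmeas_jump_pow s x k.
have E : (fun y : R => jump x y ^+ k * \1_(small_jump (s x) x) y) =
         (fun z => (z - x) ^+ k * (small s x z)%:R).
  by apply/funext => z; rewrite indicE mem_setE.
rewrite /truncated_moment E unlock /tmom /Ex /Rintegral fineK//.
exact: integrable_fin_num (bmeas_integrable _ bj).
Qed.

(* Off [S] the kernel is replaced by its value at a fixed point of [S], which
   makes it measurable on the whole line. *)
Definition patch_kernel (c x : R) : probability R R := K (if x \in S then x else c).

Lemma patch_kernelE c x : S x -> patch_kernel c x = K x.
Proof. by move=> Sx; rewrite /patch_kernel mem_set. Qed.

Lemma measurable_patch_kernel c : measurable S -> transition_kernel S K ->
  forall B, measurable B -> measurable_fun setT (fun x => patch_kernel c x B).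
Proof.
move=> mS [_ mK] B mB; rewrite -(setUv S).
apply/measurable_funU; [exact: mS|exact: measurableC|split].
  apply: eq_measurable_fun (mK B mB) => x; rewrite inE => Sx.
  by rewrite patch_kernelE.
apply: (@eq_measurable_fun _ _ _ _ _ (fun=> K c B)); last exact: measurable_cst.
by move=> x; rewrite inE /patch_kernel => Sx; rewrite memNset.
Qed.

Lemma green_partial (P : R -> bool) N : measurable_fun setT P ->
  (\sum_(0 <= n < N) Pr (X n @^-1` [set z | P z]))%E = (occ X N (fun z => (P z)%:R))%:E.
Proof.
move=> mP; rewrite big_mkord /occ -sumEFin; apply: eq_bigr => n _.
have mPX : measurable_fun setT (fun w => P (X n w)) by exact: measurableT_comp.
by rewrite /EX Ex_bool// fineK//; apply: fin_num_measure; exact: measurable_setb.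
Qed.

Lemma green_le (P : R -> bool) (u : R) : measurable_fun setT P ->
  (forall N, occ X N (fun z => (P z)%:R) <= u) -> (green X [set z | P z] <= u%:E)%E.
Proof.
move=> mP Hu; rewrite /green; apply: lime_le; first exact: is_cvg_nneseries.
by apply: nearW => N; rewrite green_partial// lee_fin.
Qed.

Lemma green_ge (P : R -> bool) (u : R) N : measurable_fun setT P ->
  u <= occ X N (fun z => (P z)%:R) -> (u%:E <= green X [set z | P z])%E.
Proof.
move=> mP Hu; apply: (le_trans _ (nneseries_lim_ge N _)) => //.
by rewrite green_partial// lee_fin.
Qed.

Section regime_of_hypotheses.
Variables (b mu : R) (s p : R -> R).
Hypothesis (b_gt0 : 0 < b) (mu_gt : b / 2 < mu).
Hypothesis s_gt0 : forall x : R, 0 <= x -> 0 < s x.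
Hypothesis s_incr : {in `[0, +oo[ &, nondecreasing_fun s}.
Hypothesis s_small : s x / x @[x --> +oo] --> 0.
Hypothesis m1_equiv : asymp_equiv (within S (pinfty_nbhs R))
  (fun x => truncated_moment K 1 (s x) x) (fun x => mu / x).
Hypothesis m2_lim : truncated_moment K 2 (s x) x @[x --> within S (pinfty_nbhs R)]
  --> b%:E.
Hypothesis p_decr : {in `]0, +oo[ &, nonincreasing_fun p}.
Hypothesis p_int : integrable_at_infinity p.
Hypothesis big_jumps : forall y, S y -> 0 < y ->
  (K y [set z | (s y <= `|jump y z|)%R] <= (p y / y)%:E)%E.
Variables (d' : measure_display) (T' : measurableType d') (Q : probability T' R).
Variable xihat : {RV Q >-> R}.
Hypothesis xihat_sq : ('E_Q[fun w => (xihat w ^+ 2)%R] < +oo)%E.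
Hypothesis jumps_dom : forall y, S y -> 0 <= y ->
  st_le (K y) (fun z => `|jump y z| * \1_(small_jump (s y) y) z) Q xihat.

(** Adding [y ^- 2] to [p] keeps it decreasing with a convergent dyadic sum, and makes it positive
    even where [p] vanishes; the strict increase of the Lyapunov function rests on weights that are
    positive. *)
Lemma regime_of_hypotheses c : regime S (patch_kernel c) s
  (fun y => p y + y ^- 2) b mu (fun j => fine (Q [set w | j%:R < xihat w])).
Proof.
have mu0 : 0 < mu by apply: lt_trans mu_gt; rewrite divr_gt0.
have pK y k : S y -> tmom (patch_kernel c) s k y = tmom K s k y.
  by move=> Sy; rewrite /tmom patch_kernelE.
have p0 := decreasing_integrable_ge0 p_decr p_int.
have in0 (y : R) : 0 < y -> y \in `]0, +oo[ by rewrite in_itv/= andbT.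
have c_ge0 j : 0 <= (2 : R) ^+ j * (p (2 ^+ j) + (2 ^+ j) ^- 2).
  apply: mulr_ge0; first exact: exprn_ge0.
  by apply: addr_ge0; [apply: p0; exact: exprn_gt0|rewrite invr_ge0 sqr_ge0].
split => //.
- move=> y z y0 yz; apply: s_incr => //; rewrite in_itv/= andbT//.
  exact: le_trans yz.
- move=> e e0; have /cvgrPdist_le/(_ _ e0)/near_pinfty[A A0 HA] := s_small.
  exists A => // y Ay; have y0 := lt_le_trans A0 Ay.
  have := HA y Ay; rewrite sub0r normrN => /ler_normlP[_].
  by rewrite ler_pdivrMr.
- move=> e e0.
  have /fine_cvgP[_ /cvgrPdist_le/(_ (e / mu))] := m1_equiv.
  rewrite divr_gt0// => /(_ isT)/near_pinfty_within[A A0 HA].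
  exists A => // y Ay Sy; have y0 := lt_le_trans A0 Ay.
  have := HA y Ay Sy; rewrite /= truncated_momentE inver gt_eqF ?divr_gt0//=.
  rewrite pK//; set m := tmom _ _ _ _ => h.
  have -> : y * m - mu = - (mu * (1 - m * (mu / y)^-1)) by field; rewrite !gt_eqF.
  rewrite normrN normrM (gtr0_norm mu0).
  by rewrite mulrC -ler_pdivlMr.
- move=> e e0.
  have /fine_cvgP[_ /cvgrPdist_le/(_ _ e0)/near_pinfty_within[A A0 HA]] := m2_lim.
  exists A => // y Ay Sy; have := HA y Ay Sy.
  by rewrite /= truncated_momentE pK// distrC.
- move=> y Sy y0; rewrite /pbig patch_kernelE//.
  have mb : measurable_fun setT (fun z => ~~ small s y z).
    by apply: measurable_neg; exact: measurable_small.
  rewrite Ex_bool//; apply: (@le_trans _ _ (p y / y)); last first.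
    by rewrite ler_pM2r ?invr_gt0// lerDl invr_ge0 sqr_ge0.
  rewrite -lee_fin fineK ?fin_num_measure//; last exact: measurable_setb.
  apply: le_trans (big_jumps Sy y0); apply: le_measure; rewrite ?inE.
  + exact: measurable_setb.
  + apply: measurable_setb; apply: measurable_fun_ler => //.
    exact: measurable_dist.
  + by move=> z /=; rewrite /small -ltNge => /ltW.
- by move=> y y0; apply: ltr_wpDl; [exact: p0|rewrite invr_gt0 exprn_gt0].
- move=> y z y0 yz; have z0 := lt_le_trans y0 yz; apply: lerD.
    by apply: p_decr => //; exact: in0.
  by rewrite lef_pV2 ?posrE ?exprn_gt0// ler_sqr ?nnegrE// ltW.
- have [B HB] := cauchy_condensation p_decr p_int.
  apply: (@bounded_tail_small _ _ (B + 2) c_ge0) => n.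
  under eq_bigr do rewrite mulrDr.
  by rewrite big_split/=; apply: lerD; [exact: HB|exact: geometric_half].
- by move=> j; exact: fine_ge0.
- move=> y Sy y0 j; rewrite patch_kernelE//.
  have mf : measurable_fun setT (fun z : R => (j%:R < `|z - y|) && small s y z).
    apply: measurable_and; last exact: measurable_small.
    by apply: measurable_fun_ltr => //; exact: measurable_dist.
  rewrite Ex_bool//; apply: fine_le.
  + by apply: fin_num_measure; exact: measurable_setb.
  + apply: fin_num_measure; apply: measurable_setb; apply: measurable_fun_ltr => //.
  + have := jumps_dom Sy y0 j%:R; congr (_ <= _)%E; congr (K y _).
    apply: eq_set => z; congr is_true; rewrite indicE.
    have -> : (z \in small_jump (s y) y) = small s y z by rewrite mem_setE.
    case: (small s y z); first by rewrite mulr1 andbT.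
    by rewrite mulr0 andbF ltNge ler0n.
- have [B HB] := second_moment_tail xihat_sq.
  apply: (@bounded_tail_small _ _ B) => // j.
  by apply: mulr_ge0; [apply: addr_ge0 => //; exact: mulr_ge0|exact: fine_ge0].
Qed.

End regime_of_hypotheses.

End translation.

Theorem theorem1 (R : realType)
    (d : measure_display) (T : measurableType d) (Pr : probability T R)
    (S : set R) (K : R -> probability R R) (X : nat -> {RV Pr >-> R})
    (chainX : markov_chain S K X)
    (limsupX : {ae Pr, forall w, limn_esup (fun n => (X n w)%:E) = +oo%E})
    (b mu : R) (b_gt0 : 0 < b) (mu_gt : b / 2 < mu)
    (s : R -> R)
    (s_gt0 : forall x : R, 0 <= x -> 0 < s x)
    (s_incr : {in `[0, +oo[ &, nondecreasing_fun s})
    (s_small : s x / x @[x --> +oo] --> 0)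
    (m1_equiv : asymp_equiv (within S (pinfty_nbhs R))
       (fun x => truncated_moment K 1 (s x) x) (fun x => mu / x))
    (m2_lim : truncated_moment K 2 (s x) x @[x --> within S (pinfty_nbhs R)]
       --> b%:E)
    (p : R -> R)
    (p_decr : {in `]0, +oo[ &, nonincreasing_fun p})
    (p_int : integrable_at_infinity p)
    (big_jumps : forall y, S y -> 0 < y ->
       (K y [set z | (s y <= `|jump y z|)%R] <= (p y / y)%:E)%E)
    (d' : measure_display) (T' : measurableType d') (Q : probability T' R)
    (xihat : {RV Q >-> R})
    (xihat_sq : ('E_Q[fun w => (xihat w ^+ 2)%R] < +oo)%E)
    (jumps_dom : forall y, S y -> 0 <= y ->
       st_le (K y) (fun z => `|jump y z| * \1_(small_jump (s y) y) z)
             Q xihat)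
    (h : R -> R)
    (h_incr : {in `[0, +oo[ &, nondecreasing_fun h})
    (h_infty : h x @[x --> +oo] --> +oo)
    (h_small : h x / x @[x --> +oo] --> 0) :
  asymp_equiv (pinfty_nbhs R)
    (fun x => green X `]x, x + h x]) (fun x => 2 / (2 * mu - b) * x * h x).
Proof.
have [mS tK XS HM] := chainX.
(* A space of total mass 1 has a sample point, hence [S] has the point [X 0 w0], whose kernel serves
   off [S]. *)
have [w0 _] : [set: T] !=set0.
  apply/set0P/eqP => T0; have := probability_setT Pr.
  by rewrite T0 measure0 => /eqP; rewrite eqe eq_sym oner_eq0.
pose Kp := patch_kernel S K (X 0%N w0).
have HK := measurable_patch_kernel (X 0%N w0) mS tK.
have HMp n (A : set T) (B : set R) : history X n A -> measurable B ->
    (Pr (A `&` X n.+1 @^-1` B) = \int[Pr]_(w in A) Kp (X n w) B)%E.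
  move=> hA mB; rewrite HM//; apply: eq_integral => w _.
  by rewrite /Kp patch_kernelE.
have Hr := regime_of_hypotheses b_gt0 mu_gt s_gt0 s_incr s_small m1_equiv m2_lim
  p_decr p_int big_jumps xihat_sq jumps_dom (X 0%N w0).
have Hun := passed_unbounded limsupX.
have c0_gt0 : 0 < 2 / (2 * mu - b) by rewrite divr_gt0//; lra.
set c0 := 2 / (2 * mu - b) in c0_gt0 *.
have itvE x y : `]x, y]%classic = [set z : R | x < z <= y].
  by apply/seteqP; split => z /=; rewrite in_itv.
have bounds e : 0 < e -> \forall x \near +oo, 0 < x * h x /\
    (((c0 - e) * (x * h x))%:E <= green X `]x, (x + h x)%R] <=
     ((c0 + e) * (x * h x))%:E)%E.
  move=> e0.
  have [A1 [L1 [d1 [A10 L10 d10 Hup]]]] := occ_upper HK XS HMp Hr e0.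
  have [A2 [L2 [d2 [A20 L20 d20 Hlow]]]] := occ_lower HK XS HMp Hr Hun e0.
  have hL : \forall x \near +oo, Num.max L1 L2 <= h x.
    by move/cvgryPge: h_infty; apply.
  have hd : \forall x \near +oo, h x / x <= Num.min d1 d2.
    have d0 : 0 < Num.min d1 d2 by rewrite lt_min d10.
    have /cvgrPdist_le/(_ _ d0) := h_small.
    apply: filterS => x; rewrite sub0r normrN; apply: le_trans; exact: ler_norm.
  near=> x.
  have xA : Num.max A1 A2 <= x by near: x; apply: nbhs_pinfty_ge; exact: num_real.
  have hLx : Num.max L1 L2 <= h x by near: x.
  have hdx : h x / x <= Num.min d1 d2 by near: x.
  move: xA hLx hdx; rewrite !ge_max le_min => /andP[xA1 xA2] /andP[hL1 hL2].
  have x0 := lt_le_trans A10 xA1; have h0 := lt_le_trans L10 hL1.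
  rewrite !ler_pdivrMr// => /andP[hd1 hd2].
  split; first by rewrite mulr_gt0.
  have mP : measurable_fun setT (fun z : R => x < z <= x + h x).
    apply: measurable_and; first by apply: measurable_fun_ltr.
    by apply: measurable_fun_ler.
  rewrite itvE; apply/andP; split; last by apply: green_le => // N; exact: Hup.
  (* A single late time suffices from below, as the partial sums increase to the Green function. *)
  have [N HN] := Hlow x (h x) xA2 hL2 hd2.
  by apply: (@green_ge _ _ _ _ _ _ _ N) => //; exact: HN.
apply/fine_cvgP; split.
  apply: filterS (bounds 1 ltr01) => x [xh /andP[l u]].
  have c0xh : 0 < c0 * x * h x by rewrite -mulrA mulr_gt0.
  have : green X `]x, (x + h x)%R] \is a fin_num.
    by rewrite fin_numE -ltNye -ltey (lt_le_trans _ l) ?ltNyr// (le_lt_trans u) ?ltry.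
  by move=> /fineK <-; rewrite inver gt_eqF.
apply/cvgrPdist_le => e e0.
(* The bounds have an absolute error on the constant; scaling by [c0] turns it into the relative
   error [e]. *)
have ec0 : 0 < e * c0 by rewrite mulr_gt0.
apply: filterS (bounds _ ec0) => x [xh /andP[l u]] /=.
have c0xh : 0 < c0 * x * h x by rewrite -mulrA mulr_gt0.
have gfin : green X `]x, (x + h x)%R] \is a fin_num.
  by rewrite fin_numE -ltNye -ltey (lt_le_trans _ l) ?ltNyr// (le_lt_trans u) ?ltry.
move: l u; rewrite -(fineK gfin) !lee_fin inver gt_eqF//=; set g := fine _ => l u.
have -> : 1 - g * (c0 * x * h x)^-1 = (c0 * x * h x - g) / (c0 * x * h x).
  by rewrite mulrBl mulfV ?gt_eqF.
rewrite normrM normfV (gtr0_norm c0xh) ler_pdivrMr//; apply/ler_normlP.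
by split; move: l u; lra.
Unshelve. all: by end_near.
Qed.
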